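(* Let $d\ge2$, $T>0$, $\varepsilon\in(0,1)$, $0<\gamma<\frac12$, let $u^\varepsilon\in(C^\infty(\Omega\times[0,T]))^d$ and $g^\varepsilon\in C^\infty(\Omega\times[0,T])$ with $L^\varepsilon\le\varepsilon^{-\gamma}$, and let $\varphi^\varepsilon$ be a classical solution of $$\varepsilon\varphi^\varepsilon_t=\varepsilon\Delta\varphi^\varepsilon-\frac{W'(\varphi^\varepsilon)}{\varepsilon}-\varepsilon u^\varepsilon\cdot\nabla\varphi^\varepsilon-(g^\varepsilon+L^\varepsilon r^\varepsilon)\sqrt{2W(\varphi^\varepsilon)}\ \text{ in }\Omega\times(0,T),\qquad\varphi^\varepsilon(\cdot,0)=\varphi_0^\varepsilon,$$ whose initial data satisfies $|\varphi_0^\varepsilon(x)|<1$ and $|\nabla r^\varepsilon(x,0)|\le1$ for all $x\in\Omega$. Then, for all $y\in\mathbb{R}^d$ and $0\le t<s<T$, $$\frac{d}{dt}\int_{\mathbb{R}^d}\rho_{y,s}(x,t)\,d\mu_t^\varepsilon(x)\le\frac1{2\sigma}\int_{\mathbb{R}^d}\rho_{y,s}(x,t)|f^\varepsilon(x,t)|^2\frac{W(\varphi^\varepsilon(x,t))}{\varepsilon}\,dx\le\frac12\int_{\mathbb{R}^d}\rho_{y,s}(x,t)|f^\varepsilon(x,t)|^2\,d\mu_t^\varepsilon(x)$$ and $$\frac{d}{dt}\int_{\mathbb{R}^d}\tilde\rho_{y,s}(x,t)\,d\mu_t^\varepsilon(x)\le\frac1{2\sigma}\int_{\mathbb{R}^d}\tilde\rho_{y,s}(x,t)|f^\varepsilon(x,t)|^2\frac{W(\varphi^\varepsilon(x,t))}{\varepsilon}\,dx+C\,e^{-\frac1{128(s-t)}}\mu_t^\varepsilon(B^d_{1/2}(y)),$$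 where $C>0$ depends only on $d$ (the cut-off function $\eta$ used in $\tilde\rho$ being fixed), and $\varphi^\varepsilon$, $\mu_t^\varepsilon$ and $f^\varepsilon$ are extended periodically to $\mathbb{R}^d$.
   Context: $\Omega=\mathbb{T}^d=(\mathbb{R}/\mathbb{Z})^d$. The potential $W$ is assumed to satisfy: $W:\mathbb{R}\to[0,\infty)$ is smooth and $W(\pm1)=W'(\pm1)=0$; for some $\alpha_1\in(-1,1)$, $W'<0$ on $(\alpha_1,1)$ and $W'>0$ on $(-1,\alpha_1)$; there is $\alpha_2\in(0,1)$ with $W''(s)>0$ for all $\alpha_2\le|s|\le1$; there is $c_W>0$ with $((q^1)^{-1}(s))^2W(s)\le c_W$ for all $|s|<1$. Here $q^\varepsilon:\mathbb{R}\to(-1,1)$ solves $\frac{\varepsilon(q^\varepsilon_r)^2}{2}=\frac{W(q^\varepsilon)}{\varepsilon}$ on $\mathbb{R}$, $q^\varepsilon(\pm\infty)=\pm1$, $q^\varepsilon(0)=0$, $q_r^\varepsilon>0$. $r^\varepsilon$ is defined by $\varphi^\varepsilon(x,t)=q^\varepsilon(r^\varepsilon(x,t))$; being a solution includes $|\varphi^\varepsilon|<1$. $L^\varepsilon:=2\sup_{\Omega\times(0,T)}|\nabla u^\varepsilon|+\sup_{\Omega\times(0,T)}|\nabla g^\varepsilon|$ and $f^\varepsilon:=-u^\varepsilon\cdot\nabla r^\varepsilon-g^\varepsilon-L^\varepsilon r^\varepsilon$. $\sigma:=\int_{-1}^1\sqrt{2W(s)}\,ds$ and $d\mu_t^\varepsilon=\frac1\sigma\left(\frac{\varepsilon|\nabla\varphi^\varepsilon(x,t)|^2}{2}+\frac{W(\varphi^\varepsilon(x,t))}{\varepsilon}\right)dx$.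 The backward heat kernel is $\rho_{y,s}(x,t):=\frac1{(4\pi(s-t))^{\frac{d-1}2}}e^{-\frac{|x-y|^2}{4(s-t)}}$ for $t<s$, $x,y\in\mathbb{R}^d$. A radially symmetric cut-off $\eta\in C_c^\infty(B^d_{1/2}(0))$ with $\eta=1$ on $B^d_{1/4}(0)$ and $0\le\eta\le1$ is fixed, and $\tilde\rho_{y,s}(x,t):=\eta(x-y)\rho_{y,s}(x,t)$. *)

(* Defs.v *)
From HB Require Import structures.
From mathcomp Require Import all_boot all_order all_algebra.
From mathcomp Require Import all_classical all_reals all_analysis.

Set Implicit Arguments.
Unset Strict Implicit.
Unset Printing Implicit Defensive.

Import Order.TTheory GRing.Theory Num.Theory.
Import numFieldNormedType.Exports.

Local Open Scope ring_scope.
Local Open Scope classical_set_scope.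

Section LebesgueRd.
Context {R : realType}.

(* [n.-tuple (measurableTypeR R)] carries the product of the Borel
   sigma-algebras; Lebesgue measure is the iterated product measure,
   transported along (a, v) |-> a :: v at each step. *)
Definition cons_pair n (p : measurableTypeR R * n.-tuple (measurableTypeR R)) :
  n.+1.-tuple (measurableTypeR R) := [the n.+1.-tuple _ of p.1 :: p.2].

Lemma measurable_cons_pair n : measurable_fun [set: _] (@cons_pair n).
Proof. exact: measurable_cons. Qed.

Section step.
Variables (n : nat)
  (m : {sigma_finite_measure set (n.-tuple (measurableTypeR R)) -> \bar R}).

Definition leb_step : set (n.+1.-tuple (measurableTypeR R)) -> \bar R :=
  pushforward (lebesgue_measure \x m)%E (@cons_pair n).

Let leb_step0 : leb_step set0 = 0%E.
Proof. by rewrite /leb_step /pushforward preimage_set0 measure0. Qed.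

Let leb_step_ge0 A : (0 <= leb_step A)%E.
Proof. exact: (measure_ge0 (lebesgue_measure \x m)%E). Qed.

Let leb_step_sigma_additive : semi_sigma_additive leb_step.
Proof.
move=> F mF tF mUF; rewrite /leb_step /pushforward preimage_bigcup.
have mc A : measurable A -> measurable (@cons_pair n @^-1` A).
  by move=> mA; rewrite -[X in measurable X]setTI; exact: measurable_cons_pair.
apply: measure_semi_sigma_additive.
- by move=> k; exact: mc.
- apply/trivIsetP => /= i j _ _ ij; rewrite -preimage_setI.
  by move/trivIsetP : tF => /(_ _ _ _ _ ij) ->//; rewrite preimage_set0.
- by rewrite -preimage_bigcup; exact: mc.
Qed.

HB.instance Definition _ := isMeasure.Build _ _ _ leb_step
  leb_step0 leb_step_ge0 leb_step_sigma_additive.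

Let leb_step_sigma_finite : sigma_finite setT leb_step.
Proof.
have [F TF Foo] := sigma_finiteT (@lebesgue_measure R).
have [G TG Goo] := sigma_finiteT m.
pose H (ij : nat * nat) := [set v : n.+1.-tuple (measurableTypeR R) |
  F ij.1 (thead v) /\ G ij.2 [tuple of behead v]].
pose K k := if unpickle k is Some ij then H ij else set0.
have HE ij : @cons_pair n @^-1` H ij = F ij.1 `*` G ij.2.
  have bE (a : measurableTypeR R) (v : n.-tuple (measurableTypeR R)) :
    [tuple of behead (cons_pair (a, v))] = v by exact/val_inj.
  by apply/seteqP; split => -[a v] /=; rewrite /H /= bE.
have mH ij : measurable (H ij).
  apply: measurableI.
    rewrite -[X in measurable X]setTI.
    by apply: (@measurable_tnth _ (measurableTypeR R) n.+1 ord0) => //;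
       exact: (Foo _).1.
  rewrite -[X in measurable X]setTI.
  by apply: (@measurable_behead _ (measurableTypeR R) n) => //;
     exact: (Goo _).1.
exists K.
  apply/seteqP; split => // v _.
  have : [set: measurableTypeR R] (thead v) by [].
  rewrite TF => -[i _ Fi].
  have : [set: n.-tuple (measurableTypeR R)] [tuple of behead v] by [].
  rewrite TG => -[j _ Gj].
  by exists (pickle (i, j)) => //; rewrite /K pickleK.
move=> k; rewrite /K; case: (unpickle k) => [ij|]; last first.
  by split => //; rewrite measure0.
split; first exact: mH.
rewrite /leb_step /pushforward HE product_measure1E;
  [|exact: (Foo _).1|exact: (Goo _).1].
have [? ?] := Foo ij.1; have [? ?] := Goo ij.2.
by rewrite lte_mul_pinfty// ge0_fin_numE.
Qed.

HB.instance Definition _ :=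
  Measure_isSigmaFinite.Build _ _ _ leb_step leb_step_sigma_finite.

End step.

Fixpoint leb (n : nat) :
    {sigma_finite_measure set (n.-tuple (measurableTypeR R)) -> \bar R} :=
  match n with
  | 0%N => @dirac _ _ [tuple] R
  | n'.+1 => @leb_step n' (leb n')
  end.

Definition vec d (x : d.-tuple (measurableTypeR R)) : 'rV[R]_d :=
  \row_i tnth x i.

(* [\int_D f dx] for D a subset of R^d. *)
Definition intRd d (D : set 'rV[R]_d) (f : 'rV[R]_d -> R) : R :=
  \int[leb d]_(z in @vec d @^-1` D) f (vec z).

End LebesgueRd.

Section Calculus.
Context {R : realType} {d : nat}.
Implicit Types (x y v w : 'rV[R]_d) (I : set R).

(* The library's norm on ['rV[R]_d] is the sup norm. *)
Definition dot v w : R := \sum_i v 0 i * w 0 i.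
Definition enorm v : R := Num.sqrt (dot v v).
Definition eball y (r : R) : set 'rV[R]_d := [set x | enorm (x - y) < r].

Definition evec (i : 'I_d) : 'rV[R]_d := delta_mx 0 i.
Definition partial (i : 'I_d) (f : 'rV[R]_d -> R) x : R := 'D_(evec i) f x.
Definition grad (f : 'rV[R]_d -> R) x : 'rV[R]_d := \row_i partial i f x.
Definition laplacian (f : 'rV[R]_d -> R) x : R :=
  \sum_i partial i (partial i f) x.

Fixpoint Ck (k : nat) (f : 'rV[R]_d -> R) : Prop :=
  continuous f /\
  match k with
  | 0%N => True
  | k'.+1 => forall i, (forall x, derivable f x (evec i)) /\
                       Ck k' (partial i f)
  end.
Definition smooth f := forall k, Ck k f.

(* Derivative of F at t relative to I: the usual derivative at interior
   points of the interval I, the one-sided derivative at its end points. *)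
Definition has_deriv_in I (F : R -> R) (t l : R) : Prop :=
  h^-1 * (F (t + h) - F t) @[h --> within [set h | I (t + h)] 0^'] --> l.

Definition continuous_on I (f : 'rV[R]_d -> R -> R) : Prop :=
  {within [set: 'rV[R]_d] `*` I, continuous (fun p => f p.1 p.2)}.

Fixpoint Ck_on I (k : nat) (f : 'rV[R]_d -> R -> R) : Prop :=
  continuous_on I f /\
  match k with
  | 0%N => True
  | k'.+1 =>
      (forall i, (forall x t, I t -> derivable (f^~ t) x (evec i)) /\
                 Ck_on I k' (fun x t => partial i (f^~ t) x)) /\
      (exists2 ft, forall x t, I t -> has_deriv_in I (f x) t (ft x t) &
                   Ck_on I k' ft)
  end.
Definition smooth_on I f := forall k, Ck_on I k f.

(* C^2 in space and C^1 in time, up to those end points belonging to I. *)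
Definition C21_on I (f : 'rV[R]_d -> R -> R) : Prop :=
  [/\ continuous_on I f,
      forall i, (forall x t, I t -> derivable (f^~ t) x (evec i)) /\
                continuous_on I (fun x t => partial i (f^~ t) x),
      forall i j,
        (forall x t, I t -> derivable (partial i (f^~ t)) x (evec j)) /\
        continuous_on I (fun x t => partial j (partial i (f^~ t)) x) &
      exists2 ft, forall x t, I t -> has_deriv_in I (f x) t (ft x t) &
                  continuous_on I ft].

(* Functions on the torus are Z^d-periodic functions on R^d; in particular
   their periodic extension to R^d is implicit. *)
Definition periodic_on (V : Type) I (f : 'rV[R]_d -> R -> V) : Prop :=
  forall x t (k : 'rV[int]_d), I t -> f (x + map_mx intr k) t = f x t.

End Calculus.

Section PhaseField.
Context {R : realType}.

Definition standing_wave (W : R -> R) (eps : R) (q : R -> R) : Prop :=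
  (forall z, -1 < q z < 1) /\
  (forall z, [/\ derivable q z 1,
                 eps * (derive1 q z) ^+ 2 / 2 = W (q z) / eps &
                 0 < derive1 q z]) /\
  [/\ q z @[z --> +oo] --> (1 : R), q z @[z --> -oo] --> (-1 : R) & q 0 = 0].

(* A standing wave is a bijection from R onto ]-1, 1[. *)
Definition wave_inv (q : R -> R) : R -> R := 'pinv_(fun=> 0) [set: R] q.

Definition admissible_potential (W q1 : R -> R) : Prop :=
  [/\ (forall n s, derivable (derive1n n W) s 1) /\ (forall s, 0 <= W s),
      [/\ W 1 = 0, W (-1) = 0, derive1 W 1 = 0 & derive1 W (-1) = 0],
      exists a1, [/\ -1 < a1 < 1,
                     forall s, a1 < s < 1 -> derive1 W s < 0 &
                     forall s, -1 < s < a1 -> 0 < derive1 W s],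
      exists2 a2, 0 < a2 < 1 & forall s, a2 <= `|s| <= 1 -> 0 < derive1n 2 W s &
      exists2 cW, 0 < cW &
        forall s, `|s| < 1 -> (wave_inv q1 s) ^+ 2 * W s <= cW].

Definition surface_tension (W : R -> R) : R :=
  \int[lebesgue_measure]_(s in `[-1, 1]) Num.sqrt (2 * W s).

Context {d : nat}.
Implicit Types (u : 'rV[R]_d -> R -> 'rV[R]_d) (g phi : 'rV[R]_d -> R -> R).

Definition dist_fun (q : R -> R) phi (x : 'rV[R]_d) (t : R) : R :=
  wave_inv q (phi x t).

(* Frobenius norm of the spatial Jacobian. *)
Definition jac_norm u (x : 'rV[R]_d) (t : R) : R :=
  Num.sqrt (\sum_i \sum_j (partial j (fun z => u z t 0 i) x) ^+ 2).

Definition Lconst (T : R) u g : R :=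
  2 * sup [set a | exists x t, 0 < t < T /\ a = jac_norm u x t] +
  sup [set a | exists x t, 0 < t < T /\ a = enorm (grad (g^~ t) x)].

Definition forcing u g (L : R) (r : 'rV[R]_d -> R -> R) x t : R :=
  - dot (u x t) (grad (r^~ t) x) - g x t - L * r x t.

(* The conditions on [0, T[ are continuity up to the initial time and
   |phi| < 1; the equation is posed on the open time interval. *)
Definition classical_solution (W : R -> R) (eps T : R) u g (L : R)
    (r : 'rV[R]_d -> R -> R) phi (phi0 : 'rV[R]_d -> R) : Prop :=
  [/\ periodic_on `[0, T[ phi,
      C21_on `]0, T[ phi /\ continuous_on `[0, T[ phi,
      forall x t, 0 <= t < T -> `|phi x t| < 1,
      forall x t, 0 < t < T ->
        eps * derive1 (phi x) t =
          eps * laplacian (phi^~ t) x - derive1 W (phi x t) / eps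
          - eps * dot (u x t) (grad (phi^~ t) x)
          - (g x t + L * r x t) * Num.sqrt (2 * W (phi x t)) &
      forall x, phi x 0 = phi0 x].

Definition energy_density (W : R -> R) (eps : R) phi x t : R :=
  eps * (enorm (grad (phi^~ t) x)) ^+ 2 / 2 + W (phi x t) / eps.

(* [\int_D h dmu_t] and [mu_t D]. *)
Definition mu_int (W : R -> R) (eps : R) phi (t : R) (D : set 'rV[R]_d)
    (h : 'rV[R]_d -> R) : R :=
  intRd D (fun x =>
    h x * ((surface_tension W)^-1 * energy_density W eps phi x t)).
Definition mu (W : R -> R) (eps : R) phi (t : R) (D : set 'rV[R]_d) : R :=
  mu_int W eps phi t D (fun=> 1).

Definition heat_kernel (y : 'rV[R]_d) (s : R) (x : 'rV[R]_d) (t : R) : R :=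
  ((4 * pi * (s - t)) `^ ((d%:R - 1) / 2))^-1 *
  expR (- (enorm (x - y)) ^+ 2 / (4 * (s - t))).

Definition cutoff (eta : 'rV[R]_d -> R) : Prop :=
  [/\ smooth eta,
      forall x y, enorm x = enorm y -> eta x = eta y,
      closure [set x | eta x != 0] `<=` eball 0 2^-1,
      forall x, eball 0 4^-1 x -> eta x = 1 &
      forall x, 0 <= eta x <= 1].

Definition cut_heat_kernel (eta : 'rV[R]_d -> R) y s x t : R :=
  eta (x - y) * heat_kernel y s x t.

End PhaseField.

(* Main.v *)
Require Import Defs.
From mathcomp Require Import all_boot all_order all_algebra.
From mathcomp Require Import all_classical all_reals all_analysis.
From mathcomp Require Import measurable_realfun ring lra.

(** The proof is written for [phi = q (r)] with [q] the standing wave, [rho] the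
    backward heat kernel, [tau = s - t], and [e] the energy density.

    The gradient of [r] stays bounded by [1].  In terms of [r] the equation is
    [r_t = Laplacian r + K (|grad r|^2 - 1) - u . grad r - g - L r]
    ([phase_field_dist]).  A maximum principle for the doubled variables shows
    that [r x t - r y t <= |x - y|] is preserved ([lipschitz_preserved]): where
    this is violated most, both gradients are the same unit vector, so the term
    with [K] drops out, and the constant [L] was chosen such that [- L r]
    outweighs the variation of [u] and [g] ([transport_lipschitz]).  Hence
    [|grad r| <= 1] at all times ([dist_grad_le1]), which says that the
    discrepancy [eps |grad phi|^2 / 2 - W (phi) / eps] is nonpositive
    ([discrepancy_le0]).

    The time derivative of [int psi e] is computed by dominated convergence
    ([energy_derivative]).  As [grad phi] is not assumed to have a time
    derivative, the integration by parts is done on difference quotients, before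
    the limit.  The integral of the divergence of the stress tensor contracted
    with [grad psi] vanishes ([intRd_stress]); adding it, one can complete the
    square in [phi_t].  For [psi = rho] the matrix
    [D^2 rho - grad rho (x) grad rho / rho] is [- rho / (2 tau)] times the
    identity, so that what remains is the discrepancy times [rho / (2 tau)], plus
    [eps rho F^2 / 4], where [F = sqrt (2 W (phi)) / eps * f] is the part of
    [phi_t] due to the forcing [f] ([monotonicity_integrand_le]).  The former is
    nonpositive, the latter is [rho f^2 W (phi) / (2 eps)].  This is the first
    estimate; its second half is [W (phi) / eps <= e].

    For [psi = eta rho] with the cut-off [eta], the terms with derivatives of
    [eta] are supported in the annulus [1/4 <= |x - y| <= 1/2].  The square of
    [grad eta] must be absorbed in [eta], which is possible because [eta] is
    nonnegative with bounded second derivatives ([cutoff_gradient_sqr]).  The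
    remaining terms are at most a constant times [(1 + 1 / tau) rho e]
    ([cutoff_error_le]), and on the annulus [(1 + 1 / tau) rho] is at most a
    constant times [exp (- 1 / (128 tau))] ([heat_kernel_far]).

    The integrals over the whole space make sense because periodic continuous
    functions are bounded and the kernel is a Gaussian: every integrand is
    dominated by a Gaussian.  The integral of a derivative vanishes for such
    functions because Lebesgue measure is invariant under translations
    ([intRd_derive_eq0]). *)

Import Order.TTheory GRing.Theory Num.Theory.
Import numFieldNormedType.Exports.

Local Open Scope ring_scope.
Local Open Scope classical_set_scope.

Set Implicit Arguments.
Unset Strict Implicit.
Unset Printing Implicit Defensive.

(** * Calculus in one variable *)

Lemma is_derive_cvg (R : realType) (V : normedModType R) (f : V -> R) (x v : V)
    (l : R) : is_derive x v f l <->
  h^-1 * (f (h *: v + x) - f x) @[h --> (0 : R)^'] --> l.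
Proof.
split=> [[df <-]|H]; first exact: df.
split; last exact/cvg_lim.
by apply/cvg_ex; exists l.
Qed.

Section line_calculus.
Context {R : realType} {V : normedModType R}.
Implicit Types (f : V -> R) (x v : V).

(** Reduces directional derivatives to derivatives of functions of one real
    variable. *)
Lemma is_derive_line f x v h l :
  is_derive (h *: v + x) v f l <->
  is_derive h 1 (fun k : R => f (k *: v + x)) l.
Proof.
rewrite is_derive_cvg is_derive_cvg.
suff -> : (fun k : R => k^-1 * (f (k *: v + (h *: v + x)) - f (h *: v + x))) =
  (fun k : R => k^-1 * (f ((k *: (1 : R) + h) *: v + x) - f (h *: v + x))) by [].
by apply/funext => k; rewrite scalerDl addrA /GRing.scale/= mulr1.
Qed.

Lemma is_derive_comp1 f (g : R -> R) x v a b :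
  is_derive (f x) 1 g a -> is_derive x v f b ->
  is_derive x v (fun z => g (f z)) (a * b).
Proof.
move=> dg df.
have df' : is_derive (0 : R) 1 (fun k : R => f (k *: v + x)) b.
  by apply/is_derive_line; rewrite scale0r add0r.
have -> : x = (0 : R) *: v + x by rewrite scale0r add0r.
apply/is_derive_line; apply: is_derive1_comp.
by rewrite scale0r add0r.
Qed.

End line_calculus.

Section one_variable.
Context {R : realType}.

Lemma is_derive1_continuous (f : R -> R) (x l : R) : is_derive x 1 f l -> {for x, continuous f}.
Proof. by case=> df _; apply: differentiable_continuous; apply/derivable1_diffP. Qed.

(** The end points come in either order, as needed for two-sided difference
    quotients. *)
Lemma MVT_any (f df : R -> R) (a b : R) : (forall x : R, is_derive x 1 f (df x)) ->
  exists2 c, `|c - a| <= `|b - a| & f b - f a = df c * (b - a).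
Proof.
move=> dfP.
have cf i : {within i, continuous f}.
  by apply: continuous_subspaceT => x; apply: is_derive1_continuous (dfP x).
have [ab|ba] := leP a b.
- have [c] := MVT_segment ab (fun x _ => dfP x) (cf _).
  rewrite in_itv/= => /andP[ac cb] E; exists c => //.
  by rewrite !ger0_norm ?subr_ge0// lerD2r.
- have [c] := MVT_segment (ltW ba) (fun x _ => dfP x) (cf _).
  rewrite in_itv/= => /andP[ac cb] E; exists c.
    rewrite ler0_norm ?subr_le0// ler0_norm ?subr_le0 ?(ltW ba)//; lra.
  by rewrite -[LHS]opprB E -mulrN opprB.
Qed.

Lemma derive_at_max (f : R -> R) (x l : R) : is_derive x 1 f l ->
  (forall z, f z <= f x) -> l = 0.
Proof.
move=> /is_derive_cvg H fx; apply/eqP; rewrite eq_le; apply/andP; split.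
- have H1 : h^-1 * (f (h *: (1:R) + x) - f x) @[h --> (0 : R)^'+] --> l.
    exact: cvg_dnbhs_at_right H.
  apply: (cvgr_to_le H1); near=> h.
  apply: mulr_ge0_le0; last by rewrite subr_le0.
  by rewrite invr_ge0; near: h; exact: nbhs_right_ge.
- have H1 : h^-1 * (f (h *: (1:R) + x) - f x) @[h --> (0 : R)^'-] --> l.
    exact: cvg_dnbhs_at_left H.
  apply: (cvgr_to_ge H1); near=> h.
  apply: mulr_le0; last by rewrite subr_le0.
  by rewrite invr_le0; near: h; exact: nbhs_left_le.
Unshelve. all: by end_near. Qed.

(** A positive second derivative would make the function increase to the right
    of the maximum point. *)
Lemma derive2_at_max (f f' : R -> R) (x l : R) : (forall z : R, is_derive z 1 f (f' z)) ->
  is_derive x 1 f' l -> (forall z, f z <= f x) -> l <= 0.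
Proof.
move=> df df' fx; rewrite leNgt; apply/negP => l0.
have f'x : f' x = 0 by apply: derive_at_max (df x) fx.
have [d /= d0 dH] : \forall h \near (0 : R)^', 0 < h^-1 * (f' (h *: (1:R) + x) - f' x).
  by move/is_derive_cvg : df' => H; apply: cvgr_gt H _ l0.
have d2 : 0 < d / 2 by rewrite divr_gt0.
have cf : {within `[x, x + d / 2], continuous f}.
  by apply: continuous_subspaceT => z; apply: is_derive1_continuous (df z).
have [|c] := @MVT R f f' x (x + d / 2) _ (fun z _ => df z) cf.
  by rewrite ltrDl.
rewrite in_itv/= => /andP[xc cd] E.
have := dH (c - x).
rewrite /ball_ /= sub0r normrN gtr0_norm ?subr_gt0// => /(_ _ _).
have -> : (c - x) *: (1:R) + x = c by rewrite /GRing.scale/= mulr1 subrK.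
rewrite f'x subr0 => P.
have {}P : 0 < (c - x)^-1 * f' c by apply: P; [lra|rewrite gt_eqF// subr_gt0].
have : 0 < f' c by rewrite -(pmulr_rgt0 _ (_ : 0 < (c - x)^-1)) // invr_gt0 subr_gt0.
have := fx (x + d / 2); nra.
Qed.

End one_variable.

(** * Directional derivatives and Euclidean geometry *)

Section several_variables.
Context {R : realType} {V : normedModType R}.
Implicit Types (f : V -> R) (x v w : V).

Lemma MVT_line f (df : V -> R) x v (h : R) : (forall z, is_derive z v f (df z)) ->
  exists2 c : R, `|c| <= `|h| & f (h *: v + x) - f x = h * df (c *: v + x).
Proof.
move=> dfP.
have [c] := @MVT_any R (fun k => f (k *: v + x)) (fun k => df (k *: v + x)) 0 h
  (fun k => (is_derive_line f x v k _).1 (dfP _)).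
rewrite !subr0 scale0r add0r => ch E; exists c => //.
by rewrite E mulrC.
Qed.

(** The difference quotient in the direction [v + w] is the one in the direction
    [v] plus a mean value of the derivative in the direction [w], which
    converges by continuity of that derivative alone. *)
Lemma is_derive_addv f (fw : V -> R) x v w a :
  is_derive x v f a -> (forall z, is_derive z w f (fw z)) -> {for x, continuous fw} ->
  is_derive x (v + w) f (a + fw x).
Proof.
move=> /is_derive_cvg dv dw cw; apply/is_derive_cvg.
pose c h := sval (cid2 (MVT_line (h *: v + x) h dw)).
have cP h : `|c h| <= `|h| /\
    f (h *: w + (h *: v + x)) - f (h *: v + x) = h * fw (c h *: w + (h *: v + x)).
  by rewrite /c; case: cid2.
have c0 : c h @[h --> (0 : R)^'] --> (0 : R).
  apply/cvgr0Pnorm_le => e e0; near=> h; rewrite (le_trans (cP h).1)//.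
  by near: h; apply: dnbhs0_le.
have id0 : h @[h --> (0 : R)^'] --> (0 : R) by apply: cvg_within.
have zx : c h *: w + (h *: v + x) @[h --> (0 : R)^'] --> x.
  rewrite -[X in _ --> X](add0r x) -[X in _ --> X](add0r (0 + x)).
  apply: cvgD; first by rewrite -(scale0r w); apply: cvgZr_tmp.
  by apply: cvgD; [rewrite -(scale0r v); apply: cvgZr_tmp | exact: cvg_cst].
have fwx : fw (c h *: w + (h *: v + x)) @[h --> (0 : R)^'] --> fw x.
  by apply: (cvg_comp _ _ zx cw).
apply: cvg_trans (cvgD dv fwx); apply: near_eq_cvg; near=> h.
have h0 : h != 0 by near: h; exact: nbhs_dnbhs_neq.
have := (cP h).2; rewrite scalerDr addrCA -addrA => E.
have -> : f (h *: v + (h *: w + x)) - f x =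
  (f (h *: v + x) - f x) + h * fw (c h *: w + (h *: v + x)).
  rewrite -E addrCA; lra.
by rewrite mulrDr mulKf//.
Unshelve. all: by end_near. Qed.

(** Both second differences are equal to one double difference quotient. *)
Lemma is_derive_swap f (fv fw fvw fwv : V -> R) x v w :
  (forall z, is_derive z v f (fv z)) -> (forall z, is_derive z w f (fw z)) ->
  (forall z, is_derive z w fv (fvw z)) -> (forall z, is_derive z v fw (fwv z)) ->
  {for x, continuous fvw} -> {for x, continuous fwv} -> fvw x = fwv x.
Proof.
move=> dv dw dvw dwv cvw cwv.
pose D (h : R) := f (h *: v + (h *: w + x)) - f (h *: v + x) - f (h *: w + x) + f x.
have main (v' w' : V) (fv' fvw' : V -> R) : (forall z, is_derive z v' f (fv' z)) ->
  (forall z, is_derive z w' fv' (fvw' z)) -> {for x, continuous fvw'} ->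
  h^-1 * (h^-1 * (f (h *: v' + (h *: w' + x)) - f (h *: v' + x) - f (h *: w' + x) + f x))
    @[h --> (0 : R)^'] --> fvw' x.
  move=> dv' dvw' cvw'.
  have H (h : R) : exists p : R * R, `|p.1| <= `|h| /\ `|p.2| <= `|h| /\
      f (h *: v' + (h *: w' + x)) - f (h *: v' + x) - f (h *: w' + x) + f x =
      h * (h * fvw' (p.2 *: w' + (p.1 *: v' + x))).
    have dg z : is_derive z v' (fun z => f (h *: w' + z) - f z)
        (fv' (h *: w' + z) - fv' z).
      have sh : is_derive z v' (fun z => f (h *: w' + z)) (fv' (h *: w' + z)).
        apply/is_derive_cvg; have /is_derive_cvg := dv' (h *: w' + z).
        by under eq_fun do rewrite addrCA.
      exact: is_deriveB.
    have [c ch E] := MVT_line x h dg.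
    have [c' ch' E'] := MVT_line (c *: v' + x) h dvw'.
    exists (c, c'); split=> //=; split=> //.
    by rewrite -E' -E [h *: w' + (_ + _)]addrCA; lra.
  have [c cP] := choice H.
  have cvg0 (g : R -> R) : (forall h, `|g h| <= `|h|) -> g h @[h --> (0 : R)^'] --> (0 : R).
    move=> gh; apply/cvgr0Pnorm_le => e e0; near=> h; rewrite (le_trans (gh h))//.
    by near: h; apply: dnbhs0_le.
  have c1 : (c h).1 @[h --> (0 : R)^'] --> (0 : R) by apply: cvg0 => h; apply: (cP h).1.
  have c2 : (c h).2 @[h --> (0 : R)^'] --> (0 : R) by apply: cvg0 => h; apply: (cP h).2.1.
  have zx : (c h).2 *: w' + ((c h).1 *: v' + x) @[h --> (0 : R)^'] --> x.
    rewrite -[X in _ --> X](add0r x) -[X in _ --> X](add0r (0 + x)).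
    apply: cvgD; first by rewrite -(scale0r w'); apply: cvgZr_tmp.
    by apply: cvgD; [rewrite -(scale0r v'); apply: cvgZr_tmp | exact: cvg_cst].
  have F : fvw' ((c h).2 *: w' + ((c h).1 *: v' + x)) @[h --> (0 : R)^'] --> fvw' x.
    exact: (cvg_comp _ _ zx cvw').
  apply: cvg_trans F; apply: near_eq_cvg; near=> h.
  have h0 : h != 0 by near: h; exact: nbhs_dnbhs_neq.
  by rewrite (cP h).2.2 !mulKf.
have A := main v w fv fvw dv dvw cvw; have B := main w v fw fwv dw dwv cwv.
have AB : h^-1 * (h^-1 * (f (h *: w + (h *: v + x)) - f (h *: w + x) - f (h *: v + x) + f x))
    @[h --> (0 : R)^'] --> fvw x.
  apply: cvg_trans A; apply: near_eq_cvg; near=> h.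
  have -> : h *: w + (h *: v + x) = h *: v + (h *: w + x) by rewrite addrCA.
  by congr (_ * (_ * _)); lra.
exact: (cvg_unique _ AB B).
Unshelve. all: by end_near. Qed.

End several_variables.

Section euclid.
Context {R : realType} {d : nat}.
Implicit Types (x y v w : 'rV[R]_d).

Lemma dotC v w : dot v w = dot w v.
Proof. by apply: eq_bigr => i _; rewrite mulrC. Qed.
Lemma dotDl v v' w : dot (v + v') w = dot v w + dot v' w.
Proof. by rewrite -big_split/=; apply: eq_bigr => i _; rewrite mxE mulrDl. Qed.
Lemma dotZl (a : R) v w : dot (a *: v) w = a * dot v w.
Proof. by rewrite /dot mulr_sumr; apply: eq_bigr => i _; rewrite mxE mulrA. Qed.
Lemma dotDr v w w' : dot v (w + w') = dot v w + dot v w'.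
Proof. by rewrite dotC dotDl !(dotC _ v). Qed.
Lemma dotZr (a : R) v w : dot v (a *: w) = a * dot v w.
Proof. by rewrite dotC dotZl dotC. Qed.
Lemma dotNl v w : dot (- v) w = - dot v w.
Proof. by rewrite -scaleN1r dotZl mulN1r. Qed.
Lemma dotNr v w : dot v (- w) = - dot v w.
Proof. by rewrite dotC dotNl dotC. Qed.
Lemma dot_ge0 v : 0 <= dot v v.
Proof. by apply: sumr_ge0 => i _; rewrite -expr2 sqr_ge0. Qed.
Lemma dot_eq0 v : (dot v v == 0) = (v == 0).
Proof.
apply/eqP/eqP => [|->]; last by rewrite /dot big1// => i _; rewrite mxE mul0r.
move=> /eqP; rewrite /dot psumr_eq0 => [/allP H|i _]; last by rewrite -expr2 sqr_ge0.
apply/rowP => i; have := H i (mem_index_enum _).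
by rewrite mxE -expr2 sqrf_eq0 => /eqP.
Qed.

Lemma enorm_ge0 v : 0 <= enorm v. Proof. exact: sqrtr_ge0. Qed.
Lemma sqr_enorm v : enorm v ^+ 2 = dot v v.
Proof. by rewrite sqr_sqrtr// dot_ge0. Qed.
Lemma enorm_eq0 v : (enorm v == 0) = (v == 0).
Proof. by rewrite -sqrf_eq0 sqr_enorm dot_eq0. Qed.
Lemma enormZ (a : R) v : enorm (a *: v) = `|a| * enorm v.
Proof. by rewrite /enorm dotZl dotZr mulrA -expr2 sqrtrM ?sqr_ge0// sqrtr_sqr. Qed.
Lemma enormN v : enorm (- v) = enorm v.
Proof. by rewrite -scaleN1r enormZ normrN normr1 mul1r. Qed.
Lemma enorm0 : enorm (0 : 'rV[R]_d) = 0.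
Proof. by apply/eqP; rewrite enorm_eq0. Qed.

Lemma cauchy_schwarz_sqr v w : dot v w ^+ 2 <= dot v v * dot w w.
Proof.
have [->|w0] := eqVneq w 0.
  have z u : dot u 0 = 0 :> R by rewrite /dot big1// => i _; rewrite mxE mulr0.
  by rewrite !z expr0n mulr0.
have W0 : 0 < dot w w by rewrite lt_def dot_eq0 w0 dot_ge0.
have := dot_ge0 (dot w w *: v - dot v w *: w).
rewrite !(dotDl, dotDr, dotNl, dotNr, dotZl, dotZr) (dotC w v).
set a := dot v v; set b := dot v w; set c := dot w w => H.
rewrite -(ler_pM2l W0) -/c; nra.
Qed.

Lemma cauchy_schwarz v w : `|dot v w| <= enorm v * enorm w.
Proof.
rewrite -(@ler_pXn2r _ 2)// ?nnegrE ?mulr_ge0 ?enorm_ge0//.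
by rewrite exprMn !sqr_enorm real_normK ?num_real// cauchy_schwarz_sqr.
Qed.

Lemma dot_evec v i : dot v (evec i) = v 0 i.
Proof.
rewrite /dot (bigD1 i)//= big1 ?addr0 => [|j ji]; rewrite mxE !eqxx ?mulr1//=.
by rewrite (negbTE ji) mulr0.
Qed.

Lemma coord_le_enorm v i : `|v 0 i| <= enorm v.
Proof.
rewrite -dot_evec (le_trans (cauchy_schwarz _ _))//.
suff -> : enorm (evec i : 'rV[R]_d) = 1 by rewrite mulr1.
by rewrite /enorm dot_evec mxE !eqxx sqrtr1.
Qed.

Lemma row_sum_evec v : v = \sum_i v 0 i *: evec i.
Proof. by rewrite {1}[v]row_sum_delta. Qed.

(** A function with continuous partial derivatives is differentiable along
    every direction: the directions for which this holds form a subspace. *)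
Lemma is_derive_grad (f : 'rV[R]_d -> R) (x v : 'rV[R]_d) :
  (forall i z, derivable f z (evec i)) -> (forall i, continuous (partial i f)) ->
  is_derive x v f (dot (grad f x) v).
Proof.
move=> df cf.
have dfi i a z : is_derive z (a *: evec i) f (a * partial i f z).
  have /is_derive_line D : is_derive (0 *: evec i + z) (evec i) f (partial i f z).
    by rewrite scale0r add0r; exact: derivableP.
  suff /is_derive_line : is_derive (0 : R) 1 (fun k : R => f (k *: (a *: evec i) + z))
    (a * partial i f z) by rewrite scale0r add0r.
  have da : is_derive (0 : R) 1 (fun k : R => k * a) a.
    apply: (is_derive_eq (is_deriveM _ _)).
    by rewrite scale0r add0r /GRing.scale/= mulr1.
  rewrite mulrC.
  have D' : is_derive (0 * a : R) 1 (fun k : R => f (k *: evec i + z)) (partial i f z).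
    by rewrite mul0r.
  have E : (fun k : R => f (k *: (a *: evec i) + z)) =
    (fun k : R => f (k *: evec i + z)) \o (fun k => k * a).
    by apply/funext => k /=; rewrite scalerA.
  rewrite E; exact: (@is_derive1_comp R (fun k => f (k *: evec i + z)) (fun k => k * a) 0 _ _ D' da).
rewrite {1}[v]row_sum_evec.
have -> : dot (grad f x) v = \sum_i v 0 i * partial i f x.
  by apply: eq_bigr => i _; rewrite mxE mulrC.
elim: (index_enum _) => [|i s IH].
  by rewrite !big_nil; exact: is_derive0.
rewrite !big_cons addrC [X in is_derive _ _ _ X]addrC.
apply: (@is_derive_addv _ _ f (fun z => v 0 i * partial i f z)) => //.
by apply: continuousM; [exact: cst_continuous | exact: cf].
Qed.

End euclid.

(** * Measurability on R^d *)

Section lebesgue_space.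
Context {R : realType}.

Lemma cvg_rV (T : Type) (F : set_system T) {FF : Filter F} d (u : T -> 'rV[R]_d) (l : 'rV[R]_d) :
  (forall i, u x 0 i @[x --> F] --> l 0 i) -> u x @[x --> F] --> l.
Proof.
move=> ul; apply/cvg_ballP => e e0.
have : \forall x \near F, forall j, ball (l 0 j) e (u x 0 j).
  by apply: filter_forall => j; move/cvg_ballP : (ul j); exact.
by apply: filterS => x H; split => // i j; rewrite ord1.
Qed.

Definition grid_point d k (m : d.-tuple int) : 'rV[R]_d :=
  \row_i ((tnth m i)%:~R / k.+1%:R).
Definition grid_index d k (z : d.-tuple (measurableTypeR R)) : d.-tuple int :=
  [tuple Num.floor (tnth z i * k.+1%:R) | i < d].

(** Rounding to a finer and finer grid approximates a continuous function by
    functions with countably many values, each taken on a product of Borel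
    sets. *)
Lemma measurable_continuous_vec d (f : 'rV[R]_d -> R) :
  continuous f -> measurable_fun setT (fun z => f (vec z)).
Proof.
move=> cf.
apply: (@measurable_fun_cvg _ _ _ setT (fun k z => f (grid_point k (grid_index k z)))).
  move=> k _ B mB; rewrite setTI.
  have -> : (fun z => f (grid_point k (grid_index k z))) @^-1` B =
    \bigcup_(m : d.-tuple int) (if `[< B (f (grid_point k m)) >]
       then [set z | grid_index k z = m] else set0).
    apply/seteqP; split => [z /= Bz|z [m _]].
      by exists (grid_index k z) => //; rewrite asboolT.
    by case: asboolP => // Bm /= ->.
  apply: countable_bigcupT_measurable; first exact: countableP.
  move=> m; case: asboolP => // _.
  have -> : [set z | @grid_index d k z = m] =
    \bigcap_(i in [set: 'I_d]) [set z : d.-tuple (measurableTypeR R) | Num.floor (tnth z i * k.+1%:R) = tnth m i].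
    apply/seteqP; split => [z /= <- i _|z H].
      by rewrite /= tnth_mktuple.
    by apply: eq_from_tnth => i; rewrite tnth_mktuple; apply: H.
  apply: fin_bigcap_measurable => [|i _]; first exact: finite_finset.
  have -> : [set z : d.-tuple (measurableTypeR R) | Num.floor (tnth z i * k.+1%:R) = tnth m i] =
    setT `&` (fun z => tnth z i) @^-1` [set a : R | Num.floor (a * k.+1%:R) = tnth m i].
    by rewrite setTI.
  apply: (measurable_tnth i) => //.
  have mf : measurable_fun setT (fun a : R => a * k.+1%:R).
    by apply: measurable_funM => //; exact: measurable_cst.
  have -> : [set a : R | Num.floor (a * k.+1%:R) = tnth m i] =
    setT `&` (fun a : R => a * k.+1%:R) @^-1` `[(tnth m i)%:~R, (tnth m i + 1)%:~R[%classic.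
    rewrite setTI; apply/seteqP; split => a /=; rewrite in_itv/=.
      by move=> <-; exact: floor_itv.
    by move=> H; apply: floor_def.
  by apply: mf => //; exact: measurable_itv.
move=> z _; apply: (cvg_comp (fun k => grid_point k (grid_index k z)) f _ (cf (vec z))).
apply: cvg_rV => i.
under eq_fun do rewrite mxE tnth_mktuple.
rewrite mxE.
apply/cvgrPdist_le => e e0; near=> k.
have k0 : 0 < k.+1%:R :> R by rewrite ltr0n.
have /andP[l u] := floor_itv (tnth z i * k.+1%:R).
have /andP[{}l {}u] : 0 <= tnth z i * k.+1%:R - (Num.floor (tnth z i * k.+1%:R))%:~R < 1.
  by rewrite subr_ge0 l/= ltrBlDl; move: u; rewrite intrD addrC.
have -> : tnth z i - (Num.floor (tnth z i * k.+1%:R))%:~R / k.+1%:R =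
  (tnth z i * k.+1%:R - (Num.floor (tnth z i * k.+1%:R))%:~R) / k.+1%:R.
  by rewrite mulrBl mulfK// gt_eqF.
rewrite ger0_norm ?divr_ge0// ?(ltW k0)// (@le_trans _ _ (k.+1%:R^-1))//.
  by rewrite ler_pdivrMr// mulVf ?gt_eqF// ltW.
apply: ltW; near: k; exact: (near_infty_natSinv_lt (PosNum e0)).
Unshelve. all: by end_near. Qed.

End lebesgue_space.

(** * Lebesgue integrals over R^d *)

Section lebesgue_integrals.
Context {R : realType}.
Local Notation mT := (measurableTypeR R).

(** Lebesgue measure is determined by its values on half-open intervals, and
    these are invariant under translation. *)
Lemma lebesgue_integral_shift (c : R) (f : mT -> \bar R) :
  measurable_fun setT f -> (forall a, 0 <= f a)%E ->
  (\int[lebesgue_measure]_a f (a + c)%R = \int[lebesgue_measure]_a f a)%E.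
Proof.
move=> mf f0.
have ms : measurable_fun setT ((fun a : mT => a + c) : mT -> mT).
  by apply: (@measurable_funD _ mT R) => //; exact: measurable_cst.
have -> : (\int[lebesgue_measure]_a f (a + c)%R =
    \int[pushforward lebesgue_measure ((fun a : mT => (a + c)%R) : mT -> mT)]_a f a)%E.
  by rewrite ge0_integral_pushforward// preimage_setT.
apply: eq_measure_integral => /= A mA _.
apply/esym.
have X : forall X, measurable X -> lebesgue_measure X =
    pushforward lebesgue_measure ((fun a : mT => a + c) : mT -> mT) X.
  apply: lebesgue_measure_unique => _ [[a b]] _ <-.
  transitivity (lebesgue_measure ((fun r : mT => r + c) @^-1` `]a, b])) => //.
  rewrite [X in _ = _ X](_ : _ = `]a - c, b - c]%classic); last first.
    by apply/seteqP; split => z /=; rewrite !in_itv/= ltrBlDr lerBrDr.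
  rewrite !lebesgue_measure_itv/= !lte_fin ltrD2r -!EFinB.
  by congr (if _ then (_)%:E else _); lra.
exact: X.
Qed.

Lemma integral_leb_cons d (f : d.+1.-tuple mT -> \bar R) :
  measurable_fun setT f -> (forall z, 0 <= f z)%E ->
  (\int[leb d.+1]_z f z = \int[lebesgue_measure]_a \int[leb d]_v f (cons_pair (a, v)))%E.
Proof.
move=> mf f0.
rewrite [LHS](@ge0_integral_pushforward _ _ _ _ _ _ (@measurable_cons_pair R d)
  (lebesgue_measure \x leb d)%E setT f)//.
rewrite preimage_setT fubini_tonelli1//; last by move=> x; exact: f0.
by apply: measurableT_comp => //; exact: measurable_cons_pair.
Qed.

Definition shift_tuple d (w z : d.-tuple mT) : d.-tuple mT :=
  [tuple (tnth z i + tnth w i : mT) | i < d].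

Lemma measurable_shift_tuple d (w : d.-tuple mT) :
  measurable_fun setT (shift_tuple w).
Proof.
apply/measurable_fun_tnthP => i.
rewrite (_ : _ \o _ = fun z => tnth z i + tnth w i); last first.
  by apply/funext => z /=; rewrite tnth_mktuple.
apply: (@measurable_funD _ _ R); last exact: measurable_cst.
exact: measurable_tnth.
Qed.

Lemma shift_tuple_cons d (w : d.+1.-tuple mT) a v :
  shift_tuple w (cons_pair (a, v)) =
  cons_pair (a + thead w, shift_tuple [tuple of behead w] v).
Proof.
apply: eq_from_tnth => i; rewrite tnth_mktuple /cons_pair/=.
have [j ->|->] := unliftP ord0 i; last by rewrite !tnth0.
by rewrite !tnthS tnth_mktuple {1}[w]tuple_eta tnthS.
Qed.

(** Iterates the one-dimensional translation invariance, one coordinate at a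
    time. *)
Lemma integral_leb_shift d (w : d.-tuple mT) (f : d.-tuple mT -> \bar R) :
  measurable_fun setT f -> (forall z, 0 <= f z)%E ->
  (\int[leb d]_z f (shift_tuple w z) = \int[leb d]_z f z)%E.
Proof.
elim: d w f => [|d IH] w f mf f0.
  by apply: eq_integral => z _; rewrite tuple0 [in RHS]tuple0.
have msw : measurable_fun setT (fun z => f (shift_tuple w z)).
  by apply: measurableT_comp => //; exact: measurable_shift_tuple.
rewrite (integral_leb_cons mf f0) (integral_leb_cons msw (fun z => f0 _)).
have mc a : measurable_fun setT (fun v => f (cons_pair (a, v))).
  apply: measurableT_comp => //.
  by apply: (@measurable_cons _ _ _ _ (fun=> a) d id) => //; exact: measurable_cst.
under eq_integral => a _.
  under eq_integral => v _ do rewrite shift_tuple_cons.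
  rewrite (IH _ (fun v => f (cons_pair (a + thead w, v))))//.
  over.
rewrite (lebesgue_integral_shift (thead w) (f := fun a => \int[leb d]_v f (cons_pair (a, v)))%E)//.
- apply: (@measurable_fun_fubini_tonelli_F _ _ _ _ R (leb d) (fun p => f (cons_pair p))) => //.
  by apply: measurableT_comp => //; exact: measurable_cons_pair.
- by move=> a; apply: integral_ge0.
Qed.

Lemma cvg_sumr (T : Type) (F : set_system T) {FF : Filter F} (I : Type) (r : seq I)
    (P : pred I) (f : I -> T -> R) (l : I -> R) :
  (forall i, f i x @[x --> F] --> l i) ->
  \sum_(i <- r | P i) f i x @[x --> F] --> \sum_(i <- r | P i) l i.
Proof.
move=> fl; elim: r => [|i r IH].
  by under eq_fun do rewrite big_nil; rewrite big_nil; exact: cvg_cst.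
under eq_fun do rewrite big_cons; rewrite big_cons; case: (P i) => //.
exact: cvgD.
Qed.

Lemma continuous_coordB d (w : 'rV[R]_d) i :
  continuous (fun x : 'rV[R]_d => (x - w) 0 i).
Proof.
have -> : (fun x : 'rV[R]_d => (x - w) 0 i) = (fun x : 'rV[R]_d => x 0 i - w 0 i).
  by apply/funext => x; rewrite !mxE.
by move=> x; apply: continuousB; [exact: coord_continuous | exact: cst_continuous].
Qed.

Lemma continuous_sqdist d (w : 'rV[R]_d) :
  continuous (fun x : 'rV[R]_d => dot (x - w) (x - w)).
Proof.
move=> x; apply: (cvg_sumr (F := nbhs x)) => i.
by apply: (@cvgM _ _ (nbhs x)); exact: continuous_coordB.
Qed.

Lemma continuous_gauss d (c : R) (w : 'rV[R]_d) :
  continuous (fun x : 'rV[R]_d => expR (- (c * dot (x - w) (x - w)))).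
Proof.
move=> x; apply: continuous_comp; last exact: continuous_expR.
by apply: continuousN; apply: continuousM; [exact: cst_continuous | exact: continuous_sqdist].
Qed.

(** Each coordinate contributes a one-dimensional Gaussian integral. *)
Lemma integral_gauss_lt_pinfty (c : R) d (y : 'rV[R]_d) : 0 < c ->
  (\int[leb d]_z (expR (- (c * dot (vec z - y) (vec z - y))))%:E < +oo)%E.
Proof.
move=> c0.
have cg n := @continuous_gauss n c.
elim: d y => [|d IH] y.
  rewrite integral_dirac//; last by apply/measurable_EFinP; exact: (measurable_continuous_vec (@cg _ _)).
  by rewrite diracT mul1e ltry.
rewrite integral_leb_cons; first last.
- by move=> z; rewrite lee_fin expR_ge0.
- by apply/measurable_EFinP; exact: (measurable_continuous_vec (@cg _ _)).
pose y' : 'rV[R]_d := \row_i y 0 (lift ord0 i).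
(* The standard deviation of the normal law with density proportional to
   [exp (- c a^2)]. *)
pose s := (Num.sqrt (2 * c))^-1.
have c2 : 0 < 2 * c by rewrite mulr_gt0.
have s0 : s != 0 by rewrite gt_eqF// invr_gt0 sqrtr_gt0.
pose g1 (a : mT) := normal_fun (y 0 ord0) s a.
have g1E a : g1 a = expR (- (c * (a - y 0 ord0) ^+ 2)).
  rewrite /g1 /normal_fun; congr (expR _).
  rewrite /s exprVn sqr_sqrtr ?(ltW c2)// mulNr; congr (- _).
  have c0' := lt0r_neq0 c0.
  by field; rewrite c0'.
pose K := (\int[leb d]_z (expR (- (c * dot (vec z - y') (vec z - y'))))%:E)%E.
have K0 : (0 <= K)%E by apply: integral_ge0 => z _; rewrite lee_fin expR_ge0.
have Kfin : K \is a fin_num by rewrite ge0_fin_numE//; exact: IH.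
have -> : (\int[lebesgue_measure]_a (\int[leb d]_v
   (expR (- (c * dot (vec (cons_pair (a, v)) - y) (vec (cons_pair (a, v)) - y))))%:E) =
   \int[lebesgue_measure]_a ((g1 a)%:E * K))%E.
  apply: eq_integral => a _; rewrite -ge0_integralZl//; try by [rewrite lee_fin expR_ge0
    | move=> z _; rewrite lee_fin expR_ge0
    | apply/measurable_EFinP; exact: (measurable_continuous_vec (@cg _ _))].
  apply: eq_integral => v _; rewrite -EFinM g1E -expRD; congr (expR _)%:E.
  rewrite -opprD -mulrDr; congr (- (c * _)).
  rewrite {1}/dot big_ord_recl !mxE tnth0 expr2; congr (_ + _).
  by apply: eq_bigr => i _; rewrite !mxE tnthS.
have mg1 : measurable_fun setT g1 by exact: measurable_normal_fun.
rewrite ge0_integralZr//; try by [move=> a _; rewrite lee_fin expR_ge0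
  | apply/measurable_EFinP].
have G0 : (0 <= \int[lebesgue_measure]_a (g1 a)%:E)%E.
  by apply: integral_ge0 => a _; rewrite lee_fin expR_ge0.
suff E : (\int[lebesgue_measure]_a (g1 a)%:E < +oo)%E.
  by apply: lte_mul_pinfty => //; [rewrite ge0_fin_numE | exact: IH].
have -> : g1 = (fun a => (normal_peak s)^-1 * normal_pdf (y 0 ord0) s a).
  apply/funext => a; rewrite normal_pdfE// mulrA mulVf ?mul1r//.
  by rewrite gt_eqF ?normal_peak_gt0.
under eq_integral do rewrite EFinM.
rewrite integralZl//; last exact: integrable_normal_pdf.
by rewrite integral_normal_pdf mule1 ltry.
Qed.
End lebesgue_integrals.

(** * Rules for directional derivatives *)

Section derivative_rules.
Context {R : realType} {V : normedModType R}.
Implicit Types (f g : V -> R) (x v : V) (a b : R).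

Lemma is_derive_addf f g x v a b : is_derive x v f a -> is_derive x v g b ->
  is_derive x v (fun z => f z + g z) (a + b).
Proof. by move=> df dg; exact: is_deriveD. Qed.

Lemma is_derive_oppf f x v a : is_derive x v f a -> is_derive x v (fun z => - f z) (- a).
Proof. by move=> df; exact: is_deriveN. Qed.

Lemma is_derive_subf f g x v a b : is_derive x v f a -> is_derive x v g b ->
  is_derive x v (fun z => f z - g z) (a - b).
Proof. by move=> df dg; exact: is_deriveB. Qed.

Lemma is_derive_mulf f g x v a b : is_derive x v f a -> is_derive x v g b ->
  is_derive x v (fun z => f z * g z) (a * g x + f x * b).
Proof.
move=> df dg; apply: (is_derive_eq (is_deriveM df dg)).
by rewrite /GRing.scale/= addrC mulrC.
Qed.

Lemma is_derive_cstf (k : R) x v : is_derive x v (fun=> k) 0.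
Proof. exact: is_derive_cst. Qed.

Lemma is_derive_mulcf f x v a k : is_derive x v f a -> is_derive x v (fun z => k * f z) (k * a).
Proof.
move=> df; apply: (is_derive_eq (is_derive_mulf (is_derive_cstf k x v) df)).
by rewrite mul0r add0r.
Qed.

Lemma is_derive_sumf I (r : seq I) (P : pred I) (f : I -> V -> R) (l : I -> R) x v :
  (forall i, is_derive x v (f i) (l i)) ->
  is_derive x v (fun z => \sum_(i <- r | P i) f i z) (\sum_(i <- r | P i) l i).
Proof.
move=> df; elim: r => [|i r IH].
  by under eq_fun do rewrite big_nil; rewrite big_nil; exact: is_derive_cst.
under eq_fun do rewrite big_cons; rewrite big_cons; case: (P i) => //.
exact: is_derive_addf.
Qed.

Lemma is_derive_expf f x v a : is_derive x v f a ->
  is_derive x v (fun z => expR (f z)) (expR (f x) * a).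
Proof. by move=> df; exact: (@is_derive_comp1 _ _ f expR). Qed.

Lemma is_derive_lnf f x v a : 0 < f x -> is_derive x v f a ->
  is_derive x v (fun z => ln (f z)) ((f x)^-1 * a).
Proof. by move=> f0 df; apply: (@is_derive_comp1 _ _ f (@ln R)) => //; exact: is_derive1_ln. Qed.

End derivative_rules.

Section derivative_rules_Rd.
Context {R : realType} {d : nat}.
Implicit Types (x y v w : 'rV[R]_d).

Lemma is_derive_coord w x v i : is_derive x v (fun z : 'rV[R]_d => (z - w) 0 i) (v 0 i).
Proof.
apply/is_derive_cvg.
have : \forall h \near (0 : R)^', v 0 i = h^-1 * ((h *: v + x - w) 0 i - (x - w) 0 i).
  near=> h; have h0 : h != 0 by near: h; exact: nbhs_dnbhs_neq.
  by rewrite !mxE -addrA addrK mulKf.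
by move/near_eq_cvg => H; apply: cvg_trans H _; exact: cvg_cst.
Unshelve. all: by end_near. Qed.

Lemma is_derive_sqdist w x v :
  is_derive x v (fun z => dot (z - w) (z - w)) (2 * dot (x - w) v).
Proof.
rewrite /dot mulr_sumr; apply: is_derive_sumf => i.
have D := is_derive_coord w x v i.
by apply: (is_derive_eq (is_derive_mulf D D)); ring.
Qed.

Lemma is_derive_edist w x v : x != w ->
  is_derive x v (fun z => enorm (z - w)) (dot (x - w) v / enorm (x - w)).
Proof.
move=> xw; have dw : 0 < dot (x - w) (x - w) by rewrite lt_def dot_eq0 subr_eq0 xw dot_ge0.
have D := @is_derive_comp1 _ _ (fun z => dot (z - w) (z - w)) Num.sqrt x v _ _
  (is_derive1_sqrt dw) (is_derive_sqdist w x v).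
apply: (is_derive_eq D).
rewrite -/(enorm (x - w)); have n0 : enorm (x - w) != 0 by rewrite enorm_eq0 subr_eq0.
by field.
Qed.

Lemma continuous_edist w : continuous (fun x : 'rV[R]_d => enorm (x - w)).
Proof.
rewrite /enorm => x.
pose f z := dot (z - w) (z - w).
have cs : {for f x, continuous (Num.sqrt : R -> R)} by exact: sqrt_continuous.
have cf : {for x, continuous f} by exact: continuous_sqdist.
exact: (continuous_comp cf cs).
Qed.

End derivative_rules_Rd.

(** * Integrals over R^d *)

Section integrals_on_Rd.
Context {R : realType} {d : nat}.
Implicit Types (f g : 'rV[R]_d -> R) (x y v : 'rV[R]_d).

Definition gauss (c : R) y x : R := expR (- (c * dot (x - y) (x - y))).

(** Measures live on tuples, functions on row vectors. *)
Definition mRd f := measurable_fun setT (fun z : d.-tuple (measurableTypeR R) => f (vec z)).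

(** A class of integrable functions which is stable under products with bounded
    functions and under translations, and which contains the backward heat
    kernel with its derivatives. *)
Definition gdom y f := mRd f /\
  exists C c : R, 0 < c /\ forall x, `|f x| <= C * gauss c y x.

(** The multipliers of [gdom]; periodic continuous functions are among them. *)
Definition bdm f := mRd f /\ exists C : R, forall x, `|f x| <= C.

Lemma gauss_gt0 c y x : 0 < gauss c y x. Proof. exact: expR_gt0. Qed.

Lemma gdom_integrable y f : gdom y f ->
  (leb d).-integrable setT (fun z => (f (vec z))%:E).
Proof.
move=> [mf [C [c [c0 fC]]]].
apply: (@le_integrable _ _ _ _ _ measurableT _ (fun z => (C * gauss c y (vec z))%:E)).
- exact/measurable_EFinP.
- move=> z _; rewrite lee_fin (le_trans (fC _))//.
  exact: ler_norm.
- under eq_fun do rewrite EFinM.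
  apply: integrableZl => //; apply/integrableP; split.
    by apply/measurable_EFinP; exact: (measurable_continuous_vec (@continuous_gauss _ _ _ _)).
  under eq_integral do rewrite gee0_abs ?lee_fin ?expR_ge0//.
  exact: integral_gauss_lt_pinfty.
Qed.

Lemma intRdE f : intRd setT f = \int[leb d]_z f (vec z).
Proof. by rewrite /intRd preimage_setT. Qed.

Lemma intRdD y f g : gdom y f -> gdom y g ->
  intRd setT (fun x => f x + g x) = intRd setT f + intRd setT g.
Proof.
move=> /gdom_integrable F /gdom_integrable G; rewrite !intRdE.
exact: (RintegralD _ F G).
Qed.

Lemma intRdZ y f (a : R) : gdom y f ->
  intRd setT (fun x => a * f x) = a * intRd setT f.
Proof.
by move=> /gdom_integrable F; rewrite !intRdE; apply: RintegralZl.
Qed.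

Lemma le_intRd y f g : gdom y f -> gdom y g -> (forall x, f x <= g x) ->
  intRd setT f <= intRd setT g.
Proof.
move=> /gdom_integrable F /gdom_integrable G fg; rewrite !intRdE.
by apply: (le_Rintegral _ F G).
Qed.

Lemma intRd_mkcond D f : intRd D f = intRd setT (f \_ D).
Proof.
rewrite /intRd preimage_setT Rintegral_mkcond; apply: eq_Rintegral => z _.
by rewrite /= !patchE; congr (if _ then _ else _); apply/asboolP/asboolP; rewrite !inE.
Qed.

Lemma intRd_shift y f v : gdom y f -> intRd setT (fun x => f (v + x)) = intRd setT f.
Proof.
move=> [mf _]; rewrite !intRdE /Rintegral; congr fine.
pose w : d.-tuple (measurableTypeR R) := [tuple v 0 i | i < d].
have E z : f (v + vec z) = f (vec (shift_tuple w z)).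
  by congr (f _); apply/rowP => i; rewrite !mxE !tnth_mktuple addrC.
under eq_integral do rewrite E.
rewrite integralE [RHS]integralE.
have mE : measurable_fun setT (fun z => (f (vec z))%:E) by exact/measurable_EFinP.
congr (_ - _)%E.
  rewrite -[RHS](integral_leb_shift w (measurable_funepos mE) (funepos_ge0 _)).
  by apply: eq_integral => z _; rewrite ?funeposE ?funenegE.
rewrite -[RHS](integral_leb_shift w (measurable_funeneg mE) (funeneg_ge0 _)).
  by apply: eq_integral => z _; rewrite ?funeposE ?funenegE.
Qed.

(** ** Domination by a Gaussian *)

(** Half of the rate pays for a translation: the inequality is
    [|z + 2 v|^2 >= 0] in disguise. *)
Lemma gaussS c y v x : 0 <= c ->
  gauss c y (v + x) <= expR (c * dot v v) * gauss (c / 2) y x.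
Proof.
move=> c0; rewrite /gauss -expRD ler_expR.
rewrite -(addrA v x (- y)); move: (x - y) => z.
have := dot_ge0 (z + 2 *: v).
rewrite !(dotDl, dotDr, dotZl, dotZr) (dotC v z); nra.
Qed.

Lemma gdom_bound y f : gdom y f ->
  exists C c : R, [/\ 0 <= C, 0 < c & forall x, `|f x| <= C * gauss c y x].
Proof.
move=> [_ [C [c [c0 H]]]]; exists C, c; split => //.
by rewrite -(pmulr_lge0 _ (gauss_gt0 c y 0)) (le_trans _ (H _)).
Qed.

Lemma bdm_bound f : bdm f -> exists2 C : R, 0 <= C & forall x, `|f x| <= C.
Proof. by move=> [_ [C H]]; exists C => //; rewrite (le_trans _ (H 0)). Qed.

Lemma continuous_mRd f : continuous f -> mRd f.
Proof. exact: measurable_continuous_vec. Qed.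

Lemma gauss_le c c' y x : c <= c' -> gauss c' y x <= gauss c y x.
Proof. by move=> cc; rewrite ler_expR lerN2 ler_wpM2r// dot_ge0. Qed.

Lemma gdomD y f g : gdom y f -> gdom y g -> gdom y (fun x => f x + g x).
Proof.
move=> F G; have [C [c [C0 c0 H]]] := gdom_bound F; have [C' [c' [C0' c0' H']]] := gdom_bound G.
split; first exact: (measurable_funD F.1 G.1).
exists (C + C'), (Num.min c c'); split; first by rewrite lt_min c0.
move=> x; rewrite (le_trans (ler_normD _ _))// mulrDl lerD//.
- by rewrite (le_trans (H x))// ler_wpM2l// gauss_le// ge_min lexx.
- by rewrite (le_trans (H' x))// ler_wpM2l// gauss_le// ge_min lexx orbT.
Qed.

Lemma gdomM y f g : gdom y f -> bdm g -> gdom y (fun x => f x * g x).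
Proof.
move=> F G; have [C [c [C0 c0 H]]] := gdom_bound F; have [C' C0' H'] := bdm_bound G.
split; first exact: (measurable_funM F.1 G.1).
exists (C * C'), c; split => // x; rewrite normrM mulrAC ler_pM//.
Qed.

Lemma gdomMr y f g : bdm f -> gdom y g -> gdom y (fun x => f x * g x).
Proof. by move=> F G; under eq_fun do rewrite mulrC; exact: gdomM. Qed.

Lemma bdm_cst (a : R) : bdm (fun=> a).
Proof. by split; [exact: measurable_cst | exists `|a|]. Qed.

Lemma bdmD f g : bdm f -> bdm g -> bdm (fun x => f x + g x).
Proof.
move=> [mf [C H]] [mg [C' H']]; split; first exact: (measurable_funD mf mg).
by exists (C + C') => x; rewrite (le_trans (ler_normD _ _))// lerD.
Qed.

Lemma bdmM f g : bdm f -> bdm g -> bdm (fun x => f x * g x).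
Proof.
move=> [mf [C H]] [mg [C' H']]; split; first exact: (measurable_funM mf mg).
by exists (C * C') => x; rewrite normrM ler_pM.
Qed.

Lemma bdmN f : bdm f -> bdm (fun x => - f x).
Proof. by move=> F; under eq_fun do rewrite -mulN1r; apply: bdmM => //; exact: bdm_cst. Qed.

Lemma gdomN y f : gdom y f -> gdom y (fun x => - f x).
Proof. by move=> F; under eq_fun do rewrite -mulN1r; apply: gdomMr => //; exact: bdm_cst. Qed.

Lemma gdom0 y : gdom y (fun=> 0).
Proof.
by split; [exact: measurable_cst | exists 0, 1; split => // x; rewrite normr0 mul0r].
Qed.

Lemma gdom_sum y I (r : seq I) (P : pred I) (f : I -> 'rV[R]_d -> R) :
  (forall i, gdom y (f i)) -> gdom y (fun x => \sum_(i <- r | P i) f i x).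
Proof.
move=> F; elim: r => [|i r IH]; first by under eq_fun do rewrite big_nil; exact: gdom0.
by under eq_fun do rewrite big_cons; case: (P i) => //; exact: gdomD.
Qed.

Lemma bdm_sum I (r : seq I) (P : pred I) (f : I -> 'rV[R]_d -> R) :
  (forall i, bdm (f i)) -> bdm (fun x => \sum_(i <- r | P i) f i x).
Proof.
move=> F; elim: r => [|i r IH]; first by under eq_fun do rewrite big_nil; exact: bdm_cst.
by under eq_fun do rewrite big_cons; case: (P i) => //; exact: bdmD.
Qed.

Lemma intRd_sum y I (r : seq I) (P : pred I) (f : I -> 'rV[R]_d -> R) :
  (forall i, gdom y (f i)) ->
  intRd setT (fun x => \sum_(i <- r | P i) f i x) = \sum_(i <- r | P i) intRd setT (f i).
Proof.
move=> F; elim: r => [|i r IH].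
  rewrite big_nil intRdE; under eq_Rintegral do rewrite big_nil.
  by rewrite /Rintegral integral0.
rewrite big_cons -IH.
have -> : (fun x => \sum_(j <- i :: r | P j) f j x) =
  (fun x => if P i then f i x + \sum_(j <- r | P j) f j x else \sum_(j <- r | P j) f j x).
  by apply/funext => x; rewrite big_cons.
by case: (P i) => //; rewrite (@intRdD y)//; exact: gdom_sum.
Qed.

Lemma intRd_cvg_seq y (u : nat -> 'rV[R]_d -> R) f (C c : R) : 0 < c ->
  (forall n, mRd (u n)) -> (forall n x, `|u n x| <= C * gauss c y x) ->
  (forall x, u n x @[n --> \oo] --> f x) ->
  intRd setT (u n) @[n --> \oo] --> intRd setT f.
Proof.
move=> c0 mu uC uf; rewrite intRdE; under eq_fun do rewrite intRdE.
have C0 : 0 <= C.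
  by rewrite -(pmulr_lge0 _ (gauss_gt0 c y 0)) (le_trans _ (uC 0%N 0)).
have mf : mRd f by apply: (measurable_fun_cvg mu) => z _; exact: uf.
have fC x : `|f x| <= C * gauss c y x.
  have /cvg_norm un := uf x; apply: (cvgr_to_le un).
  by apply: nearW => n; exact: uC.
have G n : gdom y (u n) by split => //; exists C, c.
have Gf : gdom y f by split => //; exists C, c.
apply: fine_cvg.
have -> : (fine (\int[leb d]_z (f (vec z))%:E))%:E = (\int[leb d]_z (f (vec z))%:E)%E.
  by rewrite fineK//; apply: integrable_fin_num (gdom_integrable Gf).
apply: (@dominated_cvg _ _ _ (leb d) setT measurableT
  (fun n z => (u n (vec z))%:E) _ (fun z => (C * gauss c y (vec z))%:E)).
- by move=> n; apply/measurable_EFinP; exact: mu.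
- by move=> z _; apply/fine_cvgP; split; [exact: nearW | exact: uf].
- by [].
- apply: (@gdom_integrable y (fun x => C * gauss c y x)); split.
    apply: measurable_funM; first exact: measurable_cst.
    exact: (measurable_continuous_vec (@continuous_gauss _ _ _ _)).
  exists C, c; split => // x; rewrite ger0_norm// mulr_ge0 ?(ltW (gauss_gt0 _ _ _))//.
- by move=> n z _; rewrite lee_fin.
Qed.

(** If the limit fails, the balls of radius [1 / (n + 1)] contain a sequence along
    which it fails. *)
Lemma cvg_dnbhs_seq (A : set R) (F : R -> R) (l : R) :
  (forall u : nat -> R, (forall n, A (u n) /\ u n != 0) -> u n @[n --> \oo] --> (0 : R) ->
     F (u n) @[n --> \oo] --> l) ->
  F h @[h --> within A (0 : R)^'] --> l.
Proof.
move=> H; apply/cvgrPdist_lt => e e0; apply: contrapT => N.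
have K (n : nat) : exists h, [/\ A h, h != 0, `|h| < n.+1%:R^-1 & e <= `|l - F h|].
  apply: contrapT => M; apply: N.
  rewrite near_withinE /=.
  exists n.+1%:R^-1 => /=; first by rewrite invr_gt0 ltr0n.
  move=> h; rewrite /= sub0r normrN => hn h0 Ah.
  by rewrite ltNge; apply/negP => eh; apply: M; exists h; split.
have [u uP] := choice K.
have u0 : u n @[n --> \oo] --> (0 : R).
  apply/cvgr0Pnorm_lt => a a0; near=> n.
  have [_ _ un _] := uP n; rewrite (lt_trans un)//.
  by near: n; exact: (near_infty_natSinv_lt (PosNum a0)).
have uA n : A (u n) /\ u n != 0 by have [] := uP n.
have /cvgrPdist_lt /(_ e e0) [N0 _ NP] := H u uA u0.
have [_ _ _] := uP N0; rewrite leNgt.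
by rewrite (NP N0)//=.
Unshelve. all: by end_near. Qed.

Lemma cvg_dnbhs_within_seq (A : set R) (F : R -> R) (l : R) (u : nat -> R) :
  (forall n, A (u n) /\ u n != 0) -> u n @[n --> \oo] --> (0 : R) ->
  F h @[h --> within A (0 : R)^'] --> l -> F (u n) @[n --> \oo] --> l.
Proof.
move=> uA u0 Fl; apply/cvgrPdist_lt => e e0.
move/cvgrPdist_lt : Fl => /(_ e e0); rewrite near_withinE => -[a /= a0 aP].
move/cvgr0Pnorm_lt : u0 => /(_ a a0); apply: filterS => n un.
by apply: aP; rewrite /= ?sub0r ?normrN//; have [] := uA n.
Qed.

(** Dominated convergence holds along sequences, and a limit at [0] can be
    tested on sequences of nonzero numbers tending to [0]. *)
Lemma intRd_cvg y (A : set R) (f : R -> 'rV[R]_d -> R) (f0 : 'rV[R]_d -> R) (C c : R) :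
  0 < c ->
  (forall h, A h -> h != 0 -> mRd (f h)) ->
  (forall h x, A h -> h != 0 -> `|f h x| <= C * gauss c y x) ->
  (forall x, f h x @[h --> within A (0 : R)^'] --> f0 x) ->
  intRd setT (f h) @[h --> within A (0 : R)^'] --> intRd setT f0.
Proof.
move=> c0 mf fC ff; apply: cvg_dnbhs_seq => u uA u0.
apply: (@intRd_cvg_seq y _ _ C c) => //.
- by move=> n; apply: mf; have [] := uA n.
- by move=> n x; apply: fC; have [] := uA n.
- by move=> x; apply: (cvg_dnbhs_within_seq uA u0 (ff x)).
Qed.

(** Translation invariance makes the integral of every difference quotient
    vanish, and these converge dominatedly to the derivative. *)
Lemma intRd_derive_eq0 y v (F dF : 'rV[R]_d -> R) :
  (forall x, is_derive x v F (dF x)) -> gdom y F -> gdom y dF ->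
  intRd setT dF = 0.
Proof.
move=> FdF gF gdF; have [C [c [C0 c0 H]]] := gdom_bound gdF.
pose h (n : nat) : R := n.+1%:R^-1.
have h0 n : 0 < h n by rewrite invr_gt0 ltr0n.
have mS k : mRd (fun x => F (k *: v + x)).
  pose w : d.-tuple (measurableTypeR R) := [tuple (k *: v) 0 i | i < d].
  have E z : F (k *: v + vec z) = F (vec (shift_tuple w z)).
    by congr (F _); apply/rowP => i; rewrite !mxE !tnth_mktuple !mxE addrC.
  rewrite /mRd; under eq_fun do rewrite E.
  apply: (@measurableT_comp _ _ _ _ _ _ (fun z => F (vec z))); first exact: gF.1.
  exact: measurable_shift_tuple.
have gS k : gdom y (fun x => F (k *: v + x)).
  split => //; have [C' [c' [C0' c0' H']]] := gdom_bound gF.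
  exists (C' * expR (c' * dot (k *: v) (k *: v))), (c' / 2); split; first by rewrite divr_gt0.
  by move=> x; rewrite (le_trans (H' _))// -mulrA ler_wpM2l// gaussS// ltW.
pose Q n x := (h n)^-1 * (F (h n *: v + x) - F x).
have Q0 n : intRd setT (Q n) = 0.
  rewrite (@intRdZ y); last by apply: gdomD => //; exact: gdomN.
  rewrite (@intRdD y)//; last exact: gdomN.
  rewrite (intRd_shift _ gF).
  have -> : intRd setT (fun x => - F x) = - intRd setT F.
    by under eq_fun do rewrite -mulN1r; rewrite (intRdZ _ gF) mulN1r.
  by rewrite subrr mulr0.
have QC : intRd setT (Q n) @[n --> \oo] --> intRd setT dF.
  apply: (@intRd_cvg_seq y _ _ (C * expR (c * dot v v)) (c / 2)); first by rewrite divr_gt0.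
  - move=> n; apply: measurable_funM; first exact: measurable_cst.
    apply: measurable_funB; first exact: mS.
    exact: gF.1.
  - move=> n x; have [k kh E] := MVT_line x (h n) FdF.
    rewrite /Q E mulKf ?gt_eqF// (le_trans (H _))// -mulrA ler_wpM2l//.
    rewrite (le_trans (gaussS _ _ _ (ltW c0)))// ler_wpM2r ?(ltW (gauss_gt0 _ _ _))//.
    rewrite ler_expR ler_wpM2l ?(ltW c0)// dotZl dotZr mulrA ler_piMl ?dot_ge0//.
    rewrite -expr2 -real_normK ?num_real// expr_le1//.
    by rewrite (le_trans kh)// gtr0_norm// invf_le1 ?ltr0n// ler1n.
  - move=> x; have /is_derive_cvg D := FdF x.
    apply: (@cvg_dnbhs_within_seq setT (fun k => k^-1 * (F (k *: v + x) - F x)) _ h).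
    + by move=> n; rewrite gt_eqF.
    + apply/cvgr0Pnorm_lt => e e0; near=> n; rewrite gtr0_norm//.
      by near: n; exact: (near_infty_natSinv_lt (PosNum e0)).
    + by apply: cvg_trans D; apply: cvg_app; exact: cvg_within.
have Z : intRd setT (Q n) @[n --> \oo] --> (0 : R).
  by under eq_fun do rewrite Q0; exact: cvg_cst.
exact: (cvg_unique _ QC Z).
Unshelve. all: by end_near. Qed.

End integrals_on_Rd.

(** * Functions of space and time *)

Section space_time.
Context {R : realType} {d : nat}.
Implicit Types (f : 'rV[R]_d -> R -> R) (x y : 'rV[R]_d) (I : set R).

(** Continuity on a slab yields limits along every pair of variables whose time
    stays in the slab; all limits in space and time are taken through this. *)
Lemma continuous_on_cvg I f (S : Type) (F : set_system S) {FF : Filter F}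
    (u : S -> 'rV[R]_d) (v : S -> R) x t :
  continuous_on I f -> I t -> u a @[a --> F] --> x -> v a @[a --> F] --> t ->
  (\forall a \near F, I (v a)) -> f (u a) (v a) @[a --> F] --> f x t.
Proof.
move=> /subspace_continuousP cf It ux vt Iv.
have /= H := cf (x, t) (conj Logic.I It).
apply: (cvg_comp (fun a => (u a, v a)) (fun p : 'rV[R]_d * R => f p.1 p.2) _ H).
move=> P HP; change (F (fun a => P (u a, v a))).
refine (@filterS2 _ F _ (fun a => I (v a)) _ _ _ Iv (cvg_pair ux vt HP)).
by move=> a Ia; apply; split.
Qed.

Lemma continuous_onW I J f : J `<=` I -> continuous_on I f -> continuous_on J f.
Proof.
by move=> JI; apply: continuous_subspaceW => -[x t] [/= _ Jt]; split => //; exact: JI.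
Qed.

Lemma continuous_on_space I f t : continuous_on I f -> I t -> continuous (f^~ t).
Proof.
move=> cf It x; apply: (@continuous_on_cvg I f _ (nbhs x) _ id (fun=> t) x t cf It) => //.
  exact: cvg_cst.
exact: nearW.
Qed.

Lemma continuous_onP I f :
  (forall x t, I t -> f p.1 p.2 @[p --> within (setT `*` I) (nbhs (x, t))] --> f x t) ->
  continuous_on I f.
Proof. by move=> H; apply/subspace_continuousP => -[x t] [/= _ It]; exact: H. Qed.

(** A periodic function takes all its values on a compact cell. *)
Lemma periodic_bounded (a b : R) f : continuous_on `[a, b] f -> periodic_on `[a, b] f ->
  exists C : R, forall x t, a <= t <= b -> `|f x t| <= C.
Proof.
move=> cf pf.
pose cell := [set v : 'rV[R]_d | forall i, `[0, 1]%classic (v ord0 i)].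
have cK : compact (cell `*` `[a, b]%classic).
  apply: compact_setX; last exact: segment_compact.
  by apply: (@rV_compact R d (fun=> `[0, 1]%classic)) => _; exact: segment_compact.
have /compact_bounded [M [_ MP]] : compact ((fun p => f p.1 p.2) @` (cell `*` `[a, b]%classic)).
  apply: continuous_compact => //; apply: continuous_subspaceW cf.
  by move=> -[x t] [].
exists (M + 1) => x t tab; apply: (MP (M + 1)); first by rewrite ltrDl.
have It : `[a, b]%classic t by rewrite /= in_itv.
(* The integer translation that brings [x] into the unit cell. *)
pose k : 'rV[int]_d := \row_i (- Num.floor (x 0 i)).
exists (x + map_mx intr k, t) => /=; last exact: pf.
split => //= i; rewrite /= !mxE in_itv/= rmorphN/=.
have /andP[l u] := floor_itv (x ord0 i).
by rewrite subr_ge0 l/= lerBlDl (le_trans (ltW u))// intrD addrC.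
Qed.

Lemma periodic_partial I f i : periodic_on I f ->
  periodic_on I (fun x t => partial i (f^~ t) x).
Proof.
move=> pf x t k It; rewrite /partial /derive.
rewrite [X in lim (X @ _) = _](_ : _ = (fun h : R => h^-1 *:
  (((f^~ t) \o shift x) (h *: evec i) - f x t)))//.
apply/funext => h /=; congr (_ *: (_ - _)); last exact: pf.
by rewrite addrA pf.
Qed.

(** ** Derivatives relative to an interval *)

Lemma has_deriv_in_interior I (F : R -> R) t l (a b : R) : a < t < b ->
  (forall k, a < k < b -> I k) -> has_deriv_in I F t l -> is_derive t 1 F l.
Proof.
move=> /andP[at_ tb] abI H; apply/is_derive_cvg.
have E : (fun h : R => h^-1 * (F (h *: (1 : R) + t) - F t)) =
    (fun h => h^-1 * (F (t + h) - F t)).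
  by apply/funext => h; rewrite /GRing.scale/= mulr1 [h + t]addrC.
rewrite E; apply: cvg_trans H; apply: cvg_app => A.
rewrite {1}/nbhs/= /within/=.
have : \forall h \near (0 : R)^', I (t + h).
  apply: cvg_within; exists (Num.min (t - a) (b - t)) => /=.
    by rewrite lt_min !subr_gt0 at_.
  move=> h; rewrite /= sub0r normrN lt_min => /andP[h1 h2]; apply: abI.
  by move: h1 h2; rewrite !ltr_norml => /andP[h3 h4] /andP[h5 h6]; apply/andP; split; lra.
by apply: filterS2 => h Ih; apply.
Qed.

(** At the end points of [I] only one-sided derivatives are available; the mean
    value theorem uses none there. *)
Lemma has_deriv_in_le I (F l : R -> R) (a b C : R) :
  (forall k, a <= k <= b -> I k) ->
  (forall k, I k -> has_deriv_in I F k (l k)) ->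
  (forall k, I k -> F h @[h --> within I (nbhs k)] --> F k) ->
  (forall k, a <= k <= b -> `|l k| <= C) ->
  forall k k', a <= k <= b -> a <= k' <= b -> `|F k' - F k| <= C * `|k' - k|.
Proof.
move=> abI dF cF lC.
suff H k k' : a <= k <= b -> a <= k' <= b -> k <= k' -> `|F k' - F k| <= C * `|k' - k|.
  move=> k k' kab k'ab; have [kk|/ltW kk] := leP k k'; first exact: H.
  by rewrite distrC [`|k' - k|]distrC; exact: H.
move=> /andP[ak kb] /andP[ak' kb'] kk'.
have IJ z : k <= z <= k' -> I z.
  by move=> /andP[kz zk]; apply: abI; rewrite (le_trans ak)// (le_trans zk).
have [| |c] := @MVT_segment R F l k k' kk'.
- move=> z; rewrite in_itv/= => /andP[kz zk].
  apply: (@has_deriv_in_interior I _ _ _ k k'); first by rewrite kz.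
    by move=> w /andP[kw wk]; apply: IJ; rewrite !ltW.
  by apply/dF/IJ; rewrite !ltW.
- apply/subspace_continuousP => z; rewrite /= in_itv/= => zkk.
  apply: cvg_trans (cF z (IJ z zkk)); apply: cvg_app.
  apply: within_subset => // w; rewrite /= in_itv/=; exact: IJ.
rewrite in_itv/= => /andP[kc ck] ->; rewrite normrM ler_wpM2r//; apply: lC.
by rewrite (le_trans ak)// (le_trans ck).
Qed.

End space_time.

(** * The standing wave *)

Section wave.
Context {R : realType}.

(** The profile tends to [-1] and [1], so the intermediate value theorem gives
    every value in between. *)
Lemma standing_wave_bij (W q : R -> R) (eps : R) : standing_wave W eps q ->
  forall s, `|s| < 1 -> exists z, q z = s.
Proof.
move=> [_ [dq [qy qNy _]]] s; rewrite ltr_norml => /andP[s1 s2].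
have cq (i : set R) : {within i, continuous q}.
  apply: continuous_subspaceT => z; apply: differentiable_continuous.
  by apply/derivable1_diffP; have [] := dq z.
have [b [b0 sb]] : exists b, 0 < b /\ s < q b.
  near ((+oo : set_system R)) => b; exists b; split; first by near: b; exact: nbhs_pinfty_gt.
  by near: b; exact: (cvgr_gt _ qy).
have [a [a0 sa]] : exists a, a < 0 /\ q a < s.
  near ((-oo : set_system R)) => a; exists a; split; first by near: a; exact: nbhs_ninfty_lt.
  by near: a; exact: (cvgr_lt _ qNy).
have ab : a <= b by rewrite ltW// (lt_trans a0).
have [|c cab <-] := @IVT R q a b s ab (cq _); last by exists c.
by rewrite minEle maxEle (le_trans (ltW sa) (ltW sb)) (ltW sa) (ltW sb).
Unshelve. all: by end_near. Qed.

Lemma standing_wave_inj (W q : R -> R) (eps : R) : standing_wave W eps q -> injective q.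
Proof.
move=> [_ [dq _]].
have lt z z' : z < z' -> q z < q z'.
  have D (w : R) : is_derive w 1 q (derive1 q w).
    by have [dw _ _] := dq w; split => //; rewrite derive1E.
  move=> zz; have [|c _ E] := @MVT R q (derive1 q) z z' zz (fun w _ => D w).
    by apply: continuous_subspaceT => w; apply: is_derive1_continuous (D w).
  by rewrite -subr_gt0 E mulr_gt0 ?subr_gt0//; have [] := dq c.
move=> z z' E; apply/eqP; rewrite eq_le !leNgt.
by apply/andP; split; apply/negP => /lt; rewrite E ltxx.
Qed.

Lemma wave_potential_gt0 (W q : R -> R) (eps : R) : 0 < eps -> standing_wave W eps q ->
  forall s, `|s| < 1 -> 0 < W s.
Proof.
move=> e0 qW s s1; have [z <-] := standing_wave_bij qW s1.
have [_ [dq _]] := qW; have [_ E q0] := dq z.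
suff : 0 < W (q z) / eps by rewrite pmulr_lgt0// invr_gt0.
by rewrite -E divr_gt0// mulr_gt0// exprn_gt0.
Qed.

(** The profile equation is of first order, so the inverse of the profile is a
    primitive of the reciprocal speed [eps / sqrt (2 W)]. *)
Lemma is_derive_wave_inv (W q : R -> R) (eps : R) : 0 < eps -> standing_wave W eps q ->
  forall s : R, `|s| < 1 ->
  is_derive s 1 (wave_inv q) (eps / Num.sqrt (2 * W s)).
Proof.
move=> e0 qW s s1; have [z zs] := standing_wave_bij qW s1; rewrite -zs.
have [_ [dq _]] := qW; have [dz E q0] := dq z.
have pK : cancel q (wave_inv q).
  move=> w; apply: pinvKV; last by rewrite inE.
  by move=> w1 w2 _ _; exact: (standing_wave_inj qW).
have -> : eps / Num.sqrt (2 * W (q z)) = (derive1 q z)^-1.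
  have -> : 2 * W (q z) = (eps * derive1 q z) ^+ 2.
    rewrite exprMn; have -> : W (q z) = eps * (W (q z) / eps) by rewrite mulrC divfK ?gt_eqF.
    by rewrite -E; field.
  rewrite sqrtr_sqr gtr0_norm ?mulr_gt0// invfM mulrA divff ?mul1r// gt_eqF//.
apply: (@is_derive_inverse R q (wave_inv q) (derive1 q z) z).
- by near=> w; rewrite pK.
- near=> w; apply: differentiable_continuous.
  by apply/derivable1_diffP; have [] := dq w.
- by split => //; rewrite derive1E.
- by rewrite gt_eqF.
Unshelve. all: by end_near. Qed.
End wave.

(** * The two-point maximum principle *)

Section maximum_principle.
Context {R : realType}.

(** Only times before [t] are compared, so that the maximum over a time interval
    may be attained at its right end. *)
Lemma derive_ge0_at_max (f : R -> R) (t l a : R) : is_derive t 1 f l -> 0 < a ->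
  (forall k, t - a <= k <= t -> f k <= f t) -> 0 <= l.
Proof.
move=> /is_derive_cvg H a0 ft.
have H1 : h^-1 * (f (h *: (1:R) + t) - f t) @[h --> (0 : R)^'-] --> l.
  exact: cvg_dnbhs_at_left H.
apply: (cvgr_to_ge H1); near=> h.
have h0 : h <= 0 by near: h; exact: nbhs_left_le.
have ha : - a < h by near: h; apply: nbhs_left_gt; rewrite oppr_lt0.
apply: mulr_le0; first by rewrite invr_le0.
by rewrite subr_le0 ft// /GRing.scale/= mulr1; apply/andP; split; lra.
Unshelve. all: by end_near. Qed.

Context {d : nat}.
Implicit Types (r g K : 'rV[R]_d -> R -> R) (u : 'rV[R]_d -> R -> 'rV[R]_d).

(** At a positive maximum of [r x t - r y t - |x - y| - delta (1 + t)] both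
    gradients are the unit vector pointing from [y] to [x], so the term with
    the factor [|grad r|^2 - 1] disappears; translating [x] and [y] together
    shows that the difference of the two Laplacians is nonpositive. *)
Lemma lipschitz_preserved r rt g K u (T L : R) :
  continuous_on `[0, T[ r -> periodic_on `[0, T[ r ->
  (forall x t, 0 < t < T -> is_derive t 1 (r x) (rt x t)) ->
  (forall i x t, 0 < t < T -> derivable (r^~ t) x (evec i)) ->
  (forall i x t, 0 < t < T -> derivable (partial i (r^~ t)) x (evec i)) ->
  (forall x t, 0 < t < T -> rt x t = laplacian (r^~ t) x
     + K x t * (enorm (grad (r^~ t) x) ^+ 2 - 1)
     - dot (u x t) (grad (r^~ t) x) - g x t - L * r x t) ->
  0 <= L ->
  (forall x y e t, 0 < t < T -> enorm e = 1 ->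
     dot (u y t - u x t) e + (g y t - g x t) <= L * enorm (x - y)) ->
  (forall x y, r x 0 - r y 0 <= enorm (x - y)) ->
  forall x y t, 0 <= t < T -> r x t - r y t <= enorm (x - y).
Proof.
move=> cr pr drt dr ddr eqr L0 uL init x0 y0 t0 /andP[t00 t0T].
rewrite leNgt; apply/negP => bad.
pose m0 := r x0 t0 - r y0 t0 - enorm (x0 - y0).
have m00 : 0 < m0 by rewrite subr_gt0.
(* This makes the penalty [delta (1 + t0)] half of the violation [m0]. *)
pose delta := m0 / (2 * (1 + t0)).
have t01 : 0 < 1 + t0 by rewrite ltr_pwDl.
have delta0 : 0 < delta by rewrite divr_gt0// mulr_gt0.
pose F x y t := r x t - r y t - enorm (x - y) - delta * (1 + t).
have F0 : 0 < F x0 y0 t0.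
  rewrite /F -/m0 /delta; have -> : m0 / (2 * (1 + t0)) * (1 + t0) = m0 / 2.
    by field; rewrite gt_eqF.
  lra.
have It0 : `[0, t0]%classic `<=` `[0, T[%classic.
  by move=> z; rewrite /= !in_itv/= => /andP[-> zt]; rewrite (le_lt_trans zt).
have [B BP] : exists B : R, forall x t, 0 <= t <= t0 -> `|r x t| <= B.
  apply: periodic_bounded; first exact: continuous_onW It0 cr.
  by move=> x t k It; apply: pr; exact: It0.
have B0 : 0 <= B by rewrite (le_trans _ (BP 0 0 _))// lexx.
have FB x y t : 0 <= t <= t0 -> 0 < F x y t -> enorm (x - y) <= 2 * B.
  move=> tt; have := BP x t tt; have := BP y t tt; rewrite !ler_norml.
  move=> /andP[a1 a2] /andP[b1 b2]; rewrite /F => P.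
  have : 0 <= delta * (1 + t) by case/andP: tt => tt _; rewrite mulr_ge0 ?(ltW delta0)// addr_ge0.
  lra.
have Fper x y t (k : 'rV[int]_d) : 0 <= t <= t0 ->
    F (x + map_mx intr k) (y + map_mx intr k) t = F x y t.
  move=> tt; have It : `[0, T[%classic t by apply: It0; rewrite /= in_itv.
  by rewrite /F !(pr _ _ _ It) opprD addrACA subrr addr0.
pose box (M : R) := [set v : 'rV[R]_d | forall i, `[- M, M]%classic (v ord0 i)].
have cbox M : compact (box M).
  by apply: (@rV_compact R d (fun=> `[- M, M]%classic)) => _; exact: segment_compact.
pose D := (box 1 `*` box (2 * B + 1)) `*` `[0, t0]%classic.
have cD : compact D by apply: compact_setX; [exact: compact_setX | exact: segment_compact].
have norm_box x y t : 0 <= t <= t0 -> 0 < F x y t ->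
    exists x' y', D (x', y', t) /\ F x' y' t = F x y t.
  move=> tt Fp; pose k : 'rV[int]_d := \row_i (- Num.floor (x 0 i)).
  exists (x + map_mx intr k), (y + map_mx intr k); split; last exact: Fper.
  have xb i : 0 <= (x + map_mx intr k) 0 i <= 1.
    rewrite !mxE rmorphN/=; have /andP[l u'] := floor_itv (x 0 i).
    by rewrite subr_ge0 l/= lerBlDl (le_trans (ltW u'))// intrD addrC.
  split; last by rewrite /= in_itv.
  split=> i /=; rewrite in_itv/=.
    by have /andP[a ->] := xb i; rewrite (le_trans _ a).
  have := FB x y t tt Fp; have /andP[a b] := xb i.
  have := coord_le_enorm (x - y) i; rewrite ler_norml => /andP[c e] f.
  have -> : (y + map_mx intr k) ord0 i = (x + map_mx intr k) 0 i - (x - y) 0 i.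
    by rewrite !mxE; ring.
  by apply/andP; split; lra.
have tt0 : 0 <= t0 <= t0 by rewrite t00/=.
have [x1 [y1 [D1 F1]]] := norm_box x0 y0 t0 tt0 F0.
have cF : {within D, continuous (fun p : 'rV[R]_d * 'rV[R]_d * R => F p.1.1 p.1.2 p.2)}.
  apply/subspace_continuousP => -[[x y] t] [/= _ tt].
  have It : `[0, T[%classic t by exact: It0.
  set G := within _ _.
  have FG : Filter G by exact: within_filter.
  have G1 : p @[p --> G] --> ((x, y), t) by apply: cvg_within.
  have px : p.1.1 @[p --> G] --> x.
    by apply: (cvg_comp _ (fun p => p.1.1) G1); apply: (cvg_comp fst fst); exact: cvg_fst.
  have py : p.1.2 @[p --> G] --> y.
    by apply: (cvg_comp _ (fun p => p.1.2) G1); apply: (cvg_comp fst snd); [exact: cvg_fst | exact: cvg_snd].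
  have pt : p.2 @[p --> G] --> t by apply: (cvg_comp _ _ G1); exact: cvg_snd.
  have GI : \forall p \near G, `[0, T[%classic p.2.
    by rewrite /G near_withinE; apply: nearW => -[[? ?] ?] [_ /= H]; exact: It0.
  apply: cvgB; last first.
    by apply: cvgM; [exact: cvg_cst | apply: cvgD; [exact: cvg_cst | exact: pt]].
  apply: cvgB; first by apply: cvgB; apply: (continuous_on_cvg cr It).
  have := @continuous_edist R d 0 (x - y); rewrite /continuous_at subr0 => ce.
  under eq_fun do rewrite -[X in enorm X]subr0.
  by apply: (cvg_comp _ _ _ ce); exact: cvgB.
have D10 : D !=set0 by exists (x1, y1, t0).
have [[[x y] t] /set_mem[_ /= tt] Fmax] := compact_EVT_max D10 cD cF.
rewrite in_itv/= in tt.
have max_all x' y' t' : 0 <= t' <= t0 -> F x' y' t' <= F x y t.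
  move=> tt'; have [Fp|Fn] := ltP 0 (F x' y' t').
    have [x2 [y2 [D2 <-]]] := norm_box x' y' t' tt' Fp.
    by apply: (Fmax (x2, y2, t')); rewrite inE.
  rewrite (le_trans Fn)// (le_trans (ltW F0))// -F1.
  by apply: (Fmax (x1, y1, t0)); rewrite inE.
have Fpos : 0 < F x y t by rewrite (lt_le_trans F0)// max_all// t00/=.
have t_gt0 : 0 < t.
  rewrite lt_def; case/andP: tt => -> _; rewrite andbT; apply/eqP => tE.
  move: Fpos; rewrite /F tE addr0 mulr1; have := init x y; lra.
have t_T : 0 < t < T by rewrite t_gt0 (le_lt_trans _ t0T)//; case/andP: tt.
have rxy : enorm (x - y) + delta * (1 + t) < r x t - r y t by move: Fpos; rewrite /F; lra.
have dt0 : 0 < delta * (1 + t) by rewrite mulr_gt0// addr_gt0.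
have xy : x != y.
  apply/eqP => E; move: rxy; rewrite E !subrr enorm0; lra.
have n0 : enorm (x - y) != 0 by rewrite enorm_eq0 subr_eq0.
pose e := (enorm (x - y))^-1 *: (x - y).
have e1 : enorm e = 1.
  by rewrite /e enormZ ger0_norm ?invr_ge0 ?enorm_ge0// mulVf.
have eE i : e 0 i = (x - y) 0 i / enorm (x - y) by rewrite /e mxE mulrC.
have gx : grad (r^~ t) x = e.
  apply/rowP => i; rewrite mxE eE.
  have D2 := is_derive_subf (derivableP (dr i x t t_T)) (is_derive_edist (evec i) xy).
  rewrite dot_evec in D2.
  have D3 : is_derive (0 : R) 1 (fun k : R => r (k *: evec i + x) t - enorm (k *: evec i + x - y))
      (partial i (r^~ t) x - (x - y) 0 i / enorm (x - y)).
    by apply/(is_derive_line (fun z => r z t - enorm (z - y))); rewrite scale0r add0r.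
  apply/eqP; rewrite -subr_eq0; apply/eqP; apply: derive_at_max D3 _ => k.
  by have := max_all (k *: evec i + x) y t tt; rewrite /F scale0r add0r; lra.
have gy : grad (r^~ t) y = e.
  apply/rowP => i; rewrite mxE eE.
  have yx : y != x by rewrite eq_sym.
  have D2 := is_derive_oppf (is_derive_addf (derivableP (dr i y t t_T)) (is_derive_edist (evec i) yx)).
  rewrite dot_evec in D2.
  have D3 : is_derive (0 : R) 1 (fun k : R => - (r (k *: evec i + y) t + enorm (k *: evec i + y - x)))
      (- (partial i (r^~ t) y + (y - x) 0 i / enorm (y - x))).
    by apply/(is_derive_line (fun z => - (r z t + enorm (z - x)))); rewrite scale0r add0r.
  have sym z w : enorm (z - w : 'rV[R]_d) = enorm (w - z) by rewrite -enormN opprB.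
  have top (k : R) : - (r (k *: evec i + y) t + enorm (k *: evec i + y - x)) <=
      - (r (0 *: evec i + y) t + enorm (0 *: evec i + y - x)).
    have := max_all x (k *: evec i + y) t tt.
    by rewrite /F scale0r add0r (sym _ x) (sym y x); lra.
  have := derive_at_max D3 top; rewrite (sym y x).
  have -> : (y - x) 0 i = - (x - y) 0 i by rewrite !mxE; ring.
  by rewrite mulNr; lra.
have lap : laplacian (r^~ t) x - laplacian (r^~ t) y <= 0.
  rewrite /laplacian -sumrB; apply: sumr_le0 => i _.
  have A (z : 'rV[R]_d) (k : R) : is_derive k 1 (fun k : R => r (k *: evec i + z) t)
      (partial i (r^~ t) (k *: evec i + z)).
    by apply: (is_derive_line (fun z => r z t) z (evec i) k _).1; exact: derivableP (dr i _ t t_T).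
  have A2 (z : 'rV[R]_d) : is_derive (0 : R) 1 (fun k : R => partial i (r^~ t) (k *: evec i + z))
      (partial i (partial i (r^~ t)) z).
    apply: (is_derive_line (partial i (r^~ t)) z (evec i) 0 _).1.
    by rewrite scale0r add0r; exact: derivableP (ddr i z t t_T).
  apply: (derive2_at_max (fun k => is_derive_subf (A x k) (A y k)) (is_derive_subf (A2 x) (A2 y))).
  move=> k; have := max_all (k *: evec i + x) (k *: evec i + y) t tt.
    by rewrite /F !scale0r !add0r opprD addrACA subrr add0r; lra.
have time : 0 <= rt x t - rt y t - delta.
  have Dt : is_derive t 1 (fun k : R => r x k - r y k - delta * k) (rt x t - rt y t - delta).
    have D1' := is_derive_mulcf delta (is_derive_id t (1 : R)).
    apply: (is_derive_eq (is_derive_subf (is_derive_subf (drt x t t_T) (drt y t t_T)) D1')).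
    by rewrite mulr1.
  apply: (derive_ge0_at_max Dt t_gt0) => k; rewrite subrr => /andP[k0 kt].
  have kt0 : 0 <= k <= t0 by rewrite k0 (le_trans kt)//; case/andP: tt.
  have := max_all x y k kt0; rewrite /F.
  by move: (r x k) (r y k) (r x t) (r y t) (enorm _); clear=> *; lra.
rewrite (eqr x t t_T) (eqr y t t_T) gx gy e1 expr1n subrr !mulr0 in time.
have := uL x y e t t_T e1; rewrite dotDl dotNl => ul.
have : L * enorm (x - y) <= L * (r x t - r y t) by rewrite ler_wpM2l//; move: rxy dt0; clear; lra.
move: time lap ul; rewrite mulrBr.
move: (laplacian (r^~ t) x) (laplacian (r^~ t) y) (dot (u x t) e) (dot (u y t) e)
  (g x t) (g y t) (L * r x t) (L * r y t) (L * enorm (x - y)) delta0.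
by clear=> *; lra.
Qed.

(** The difference quotients in the direction of the gradient itself converge to
    its squared norm, and are bounded by its norm. *)
Lemma lipschitz_grad_le1 (f : 'rV[R]_d -> R) :
  (forall i z, derivable f z (evec i)) -> (forall i, continuous (partial i f)) ->
  (forall x y, f x - f y <= enorm (x - y)) -> forall x, enorm (grad f x) <= 1.
Proof.
move=> df cf lip x; set G := grad f x.
have D := is_derive_grad x G df cf.
rewrite -/G -sqr_enorm in D.
have /is_derive_cvg C := D.
have : enorm G ^+ 2 <= enorm G.
  have C1 : h^-1 * (f (h *: G + x) - f x) @[h --> (0 : R)^'+] --> enorm G ^+ 2.
    exact: cvg_dnbhs_at_right C.
  apply: (cvgr_to_le C1); near=> h.
  have h0 : 0 < h by near: h; exact: nbhs_right_gt.
  rewrite mulrC ler_pdivrMr// (le_trans (lip _ _))// addrK enormZ gtr0_norm//.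
  by rewrite mulrC.
have := enorm_ge0 G; rewrite expr2 => g0; nra.
Unshelve. all: by end_near. Qed.

Lemma grad_le1_lipschitz (f : 'rV[R]_d -> R) :
  (forall x, differentiable f x) -> (forall x, enorm (grad f x) <= 1) ->
  forall x y, f x - f y <= enorm (x - y).
Proof.
move=> df g1 x y.
have D z : is_derive z (x - y) f (dot (grad f z) (x - y)).
  have dz := df z.
  split; first exact: diff_derivable.
  rewrite deriveE// {1}[x - y]row_sum_evec linear_sum /dot; apply: eq_bigr => i _.
  by rewrite linearZ/= !mxE /partial deriveE// /GRing.scale/= mulrC.
have [c _] := MVT_line y 1 D.
rewrite scale1r subrK mul1r => ->.
rewrite (le_trans (ler_norm _))// (le_trans (cauchy_schwarz _ _))//.
by rewrite ler_piMl ?enorm_ge0.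
Qed.

End maximum_principle.

(** * Derivatives of the backward heat kernel *)

Section heat_kernel_calculus.
Context {R : realType} {d : nat}.
Implicit Types (x y : 'rV[R]_d) (s t : R).

Lemma heat_kernelE y s x t : heat_kernel y s x t =
  ((4 * pi * (s - t)) `^ ((d%:R - 1) / 2))^-1 * gauss ((4 * (s - t))^-1) y x.
Proof. by rewrite /heat_kernel sqr_enorm /gauss mulNr [dot _ _ / _]mulrC. Qed.

Lemma heat_kernel_gt0 y s x t : t < s -> 0 < heat_kernel y s x t.
Proof.
move=> ts; rewrite heat_kernelE mulr_gt0 ?gauss_gt0// invr_gt0 powR_gt0//.
by rewrite mulr_gt0 ?subr_gt0// mulr_gt0// pi_gt0.
Qed.

(** A Gaussian absorbs any quadratic polynomial at the price of half its rate. *)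
Lemma gauss_poly (c : R) y x : 0 < c ->
  (1 + dot (x - y) (x - y)) * gauss c y x <= (1 + 2 / c) * gauss (c / 2) y x.
Proof.
move=> c0; rewrite /gauss; set u := dot (x - y) (x - y).
have u0 : 0 <= u by exact: dot_ge0.
have -> : - (c * u) = - (c / 2 * u) + - (c / 2 * u) by field.
rewrite expRD mulrA ler_wpM2r ?expR_ge0//.
have cu : 0 <= c / 2 * u by rewrite mulr_ge0// divr_ge0// ltW.
have E : 1 + c / 2 * u <= expR (c / 2 * u) by exact: expR_ge1Dx.
rewrite expRN ler_pdivrMr ?expR_gt0//.
apply: (le_trans _ (ler_wpM2l _ E)); last by rewrite addr_ge0// divr_ge0// ltW.
have c2 : 0 <= 2 / c by rewrite divr_ge0// ltW.
have -> : (1 + 2 / c) * (1 + c / 2 * u) = 1 + u + 2 / c + c / 2 * u.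
  by field; rewrite gt_eqF.
by rewrite -addrA lerDl addr_ge0.
Qed.

(** Derivatives of the heat kernel are polynomials times a Gaussian. *)
Lemma gdom_gauss_poly (c C : R) y (P : 'rV[R]_d -> R) : 0 < c -> mRd P ->
  (forall x, `|P x| <= C * (1 + dot (x - y) (x - y))) ->
  gdom y (fun x => P x * gauss c y x).
Proof.
move=> c0 mP PC; have C0 : 0 <= C.
  have := le_trans (normr_ge0 _) (PC y); rewrite pmulr_lge0//.
  by rewrite ltr_pwDl// dot_ge0.
split; first exact: (measurable_funM mP (measurable_continuous_vec (@continuous_gauss _ _ c y))).
exists (C * (1 + 2 / c)), (c / 2); split; first by rewrite divr_gt0.
move=> x; rewrite normrM [`|gauss _ _ _|]ger0_norm ?(ltW (gauss_gt0 _ _ _))//.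
rewrite (le_trans (ler_wpM2r (ltW (gauss_gt0 _ _ _)) (PC x)))// -!mulrA ler_wpM2l//.
exact: gauss_poly.
Qed.

Lemma coord_le_quadratic x i : `|x 0 i| <= 1 + dot x x.
Proof.
rewrite (le_trans (coord_le_enorm x i))// -sqr_enorm.
have := sqr_ge0 (enorm x - 1); have := enorm_ge0 x; nra.
Qed.

Lemma coord2_le_quadratic x i j : `|x 0 i * x 0 j| <= dot x x.
Proof.
rewrite normrM -sqr_enorm expr2.
by rewrite ler_pM// coord_le_enorm.
Qed.

Definition hk1 y s (i : 'I_d) x t : R := - ((x - y) 0 i / (2 * (s - t))) * heat_kernel y s x t.
Definition hk2 y s (i j : 'I_d) x t : R :=
  ((x - y) 0 i * (x - y) 0 j / (4 * (s - t) ^+ 2) - (i == j)%:R / (2 * (s - t))) *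
  heat_kernel y s x t.
Definition hkt y s x t : R :=
  ((d%:R - 1) / (2 * (s - t)) - dot (x - y) (x - y) / (4 * (s - t) ^+ 2)) *
  heat_kernel y s x t.

Lemma is_derive_heat_kernel y s t i x : t < s ->
  is_derive x (evec i) (fun z => heat_kernel y s z t) (hk1 y s i x t).
Proof.
move=> ts; have st : s - t != 0 by rewrite gt_eqF// subr_gt0.
under eq_fun do rewrite heat_kernelE; rewrite /hk1 heat_kernelE.
set A := (_ `^ _)^-1; set c := (4 * _)^-1.
have D1 := is_derive_oppf (is_derive_mulcf c (is_derive_sqdist y x (evec i))).
have D2 := is_derive_expf D1.
apply: (is_derive_eq (is_derive_mulcf A D2)).
rewrite dot_evec -/(gauss c y x) /c; field.
by rewrite st.
Qed.

Lemma is_derive_hk1 y s t i j x : t < s ->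
  is_derive x (evec j) (fun z => hk1 y s i z t) (hk2 y s i j x t).
Proof.
move=> ts; have st : s - t != 0 by rewrite gt_eqF// subr_gt0.
have D1 := is_derive_coord y x (evec j) i.
have D2 := is_derive_mulf D1 (is_derive_heat_kernel y j x ts).
have D3 := is_derive_mulcf (- (2 * (s - t))^-1) D2.
have -> : (fun z => hk1 y s i z t) =
    (fun z => - (2 * (s - t))^-1 * ((z - y) 0 i * heat_kernel y s z t)).
  by apply/funext => z; rewrite /hk1; ring.
apply: (is_derive_eq D3); rewrite /hk1 /hk2 mxE eqxx/= eq_sym; field.
by rewrite st.
Qed.

(** The kernel is the exponential of [- a ln (4 pi (s - t)) - |x - y|^2 / (4 (s - t))]
    with [a = (d - 1) / 2]. *)
Lemma is_derive_heat_kernel_time y s t x : t < s ->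
  is_derive t 1 (fun k => heat_kernel y s x k) (hkt y s x t).
Proof.
move=> ts; have st : 0 < s - t by rewrite subr_gt0.
set a : R := (d%:R - 1) / 2; set Z := dot (x - y) (x - y).
have p0 : 0 < 4 * pi * (s - t) by rewrite mulr_gt0// mulr_gt0// pi_gt0.
have Ds : is_derive t 1 (fun k : R => s - k) (- 1).
  by apply: (is_derive_eq (is_derive_subf (is_derive_cstf s t 1) (is_derive_id t (1 : R)))); rewrite sub0r.
have Dl := @is_derive_lnf _ _ (fun k : R => 4 * pi * (s - k)) t 1 _ p0 (is_derive_mulcf (4 * pi) Ds).
have Di := @is_deriveV R (fun k : R => s - k) t (- 1) 1 (lt0r_neq0 st) Ds.
have D := is_derive_subf (is_derive_mulcf (- a) Dl) (is_derive_mulcf (Z / 4) Di).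
have De := is_derive_expf D.
have E k : k < s -> heat_kernel y s x k =
    expR (- a * ln (4 * pi * (s - k)) - Z / 4 * (s - k)^-1).
  move=> ks; have sk : 0 < s - k by rewrite subr_gt0.
  rewrite heat_kernelE /gauss -/Z expRD; congr (_ * _); last first.
    by congr expR; field; rewrite gt_eqF.
  rewrite /powR gt_eqF; last by rewrite mulr_gt0// mulr_gt0// pi_gt0.
  by rewrite mulNr expRN.
apply: (@near_eq_is_derive _ _ _ (fun k => expR (- a * ln (4 * pi * (s - k)) - Z / 4 * (s - k)^-1))).
- near=> k; rewrite E//; near: k; exact: lt_nbhsl.
- apply: (is_derive_eq De); rewrite /hkt E// -/Z [RHS]mulrC; congr (_ * _).
  have pp : 4 * pi != 0 :> R by rewrite gt_eqF// mulr_gt0// pi_gt0.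
  rewrite /a /GRing.scale/=; move: (4 * pi : R) pp => p pp; field.
  by rewrite pp gt_eqF.
Unshelve. all: by end_near. Qed.

End heat_kernel_calculus.

(** * Bounds on the backward heat kernel *)

Section heat_kernel_bounds.
Context {R : realType} {d : nat}.
Implicit Types (x y : 'rV[R]_d) (s t : R).

Lemma mRd_coordB y i : mRd (fun x : 'rV[R]_d => (x - y) 0 i).
Proof. apply: continuous_mRd; exact: continuous_coordB. Qed.

Lemma mRd_sqdist y : mRd (fun x : 'rV[R]_d => dot (x - y) (x - y)).
Proof. apply: continuous_mRd; exact: continuous_sqdist. Qed.

Lemma gdom_heat_kernel_poly y s t (C : R) (P : 'rV[R]_d -> R) : t < s -> mRd P ->
  (forall x, `|P x| <= C * (1 + dot (x - y) (x - y))) ->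
  gdom y (fun x => P x * heat_kernel y s x t).
Proof.
move=> ts mP PC; have c0 : 0 < (4 * (s - t))^-1 by rewrite invr_gt0 mulr_gt0// subr_gt0.
set A := ((4 * pi * (s - t)) `^ ((d%:R - 1) / 2))^-1.
have E : (fun x => P x * heat_kernel y s x t) =
    (fun x => A * (P x * gauss (4 * (s - t))^-1 y x)).
  by apply/funext => x; rewrite heat_kernelE -/A mulrCA.
rewrite E; apply: gdomMr; first exact: bdm_cst.
exact: (gdom_gauss_poly c0 mP PC).
Qed.

Lemma gdom_heat_kernel y s t : t < s -> gdom y (fun x => heat_kernel y s x t).
Proof.
move=> ts; have := @gdom_heat_kernel_poly y s t 1 (fun=> 1) ts (measurable_cst _).
under eq_fun do rewrite mul1r; apply=> x.
by rewrite normr1 mul1r lerDl dot_ge0.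
Qed.

Lemma gdom_hk1 y s t i : t < s -> gdom y (fun x => hk1 y s i x t).
Proof.
move=> ts; have st : 0 < 2 * (s - t) by rewrite mulr_gt0// subr_gt0.
apply: (@gdom_heat_kernel_poly _ _ _ (2 * (s - t))^-1) => //.
  apply: measurable_funN; apply: measurable_funM; last exact: measurable_cst.
  exact: mRd_coordB.
move=> x; rewrite normrN normrM [`|_^-1|]gtr0_norm ?invr_gt0// mulrC ler_wpM2l//.
  by rewrite invr_ge0 ltW.
exact: coord_le_quadratic.
Qed.

Lemma gdom_hk2 y s t i j : t < s -> gdom y (fun x => hk2 y s i j x t).
Proof.
move=> ts; have st : 0 < s - t by rewrite subr_gt0.
have a0 : 0 <= (4 * (s - t) ^+ 2)^-1 by rewrite invr_ge0 mulr_ge0// sqr_ge0.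
have b0 : 0 <= (2 * (s - t))^-1 by rewrite invr_ge0 mulr_ge0// ltW.
apply: (@gdom_heat_kernel_poly _ _ _ ((4 * (s - t) ^+ 2)^-1 + (2 * (s - t))^-1)) => //.
  apply: measurable_funB; last exact: measurable_cst.
  apply: measurable_funM; last exact: measurable_cst.
  exact: (measurable_funM (mRd_coordB y i) (mRd_coordB y j)).
move=> x; rewrite (le_trans (ler_normB _ _))// [leRHS]mulrDl.
have z0 := dot_ge0 (x - y); rewrite lerD//.
  rewrite normrM [`|_^-1|]ger0_norm// mulrC ler_wpM2l//.
  by rewrite (le_trans (coord2_le_quadratic _ _ _))// lerDr.
rewrite normrM [`|_^-1|]ger0_norm// mulrC ler_wpM2l// ger0_norm ?ler0n//.
by case: (i == j); rewrite ?lerDl// addr_ge0.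
Qed.

Lemma gdom_hkt y s t : t < s -> gdom y (fun x => hkt y s x t).
Proof.
move=> ts; have st : 0 < s - t by rewrite subr_gt0.
have a0 : 0 <= (4 * (s - t) ^+ 2)^-1 by rewrite invr_ge0 mulr_ge0// sqr_ge0.
apply: (@gdom_heat_kernel_poly _ _ _ (`|(d%:R - 1) / (2 * (s - t))| + (4 * (s - t) ^+ 2)^-1)) => //.
  apply: measurable_funB; first exact: measurable_cst.
  by apply: measurable_funM; [exact: mRd_sqdist | exact: measurable_cst].
move=> x; rewrite (le_trans (ler_normB _ _))// [leRHS]mulrDl.
have z0 := dot_ge0 (x - y); rewrite lerD//.
  by rewrite ler_peMr// lerDl.
rewrite normrM [`|_^-1|]ger0_norm// mulrC ler_wpM2l//.
by rewrite ger0_norm// lerDr.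
Qed.

(** As [d >= 1] the exponent [(d - 1) / 2] is nonnegative, so the prefactor
    increases with time. *)
Lemma heat_kernel_le y s t b x : (0 < d)%N -> t <= b -> b < s ->
  heat_kernel y s x t <= ((4 * pi * (s - b)) `^ ((d%:R - 1) / 2))^-1 * gauss ((4 * (s - t))^-1) y x.
Proof.
move=> d0 tb bs; have sb : 0 < s - b by rewrite subr_gt0.
have p4 : 0 < 4 * pi :> R by rewrite mulr_gt0// pi_gt0.
have st : 0 < s - t by lra.
rewrite heat_kernelE ler_wpM2r ?(ltW (gauss_gt0 _ _ _))//.
rewrite lef_pV2 ?posrE ?powR_gt0 ?(mulr_gt0 p4)//.
apply: ge0_ler_powR; rewrite ?nnegrE ?(mulr_ge0 (ltW p4)) ?(ltW sb) ?(ltW st)//.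
  by rewrite divr_ge0// subr_ge0 ler1n.
by rewrite (ler_wpM2l (ltW p4))//; lra.
Qed.

(** One Gaussian dominates the time derivative over a whole time interval, as
    dominated convergence of the difference quotients in time requires. *)
Lemma hkt_bounded y s a b : (0 < d)%N -> b < s ->
  exists C c : R, [/\ 0 <= C, 0 < c & forall x t, a <= t <= b ->
    `|hkt y s x t| <= C * gauss c y x].
Proof.
move=> d0 bs; have sb : 0 < s - b by rewrite subr_gt0.
have [ab|ba] := leP a b; last first.
  exists 0, 1; split => // x t /andP[at_ tb]; exfalso.
  by move: (le_trans at_ tb); rewrite leNgt ba.
have sa : 0 < s - a by lra.
set A := ((4 * pi * (s - b)) `^ ((d%:R - 1) / 2))^-1.
have A0 : 0 <= A by rewrite invr_ge0 powR_ge0.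
set c := (4 * (s - a))^-1; have c0 : 0 < c by rewrite invr_gt0 mulr_gt0.
set K := `|d%:R - 1| / (2 * (s - b)) + (4 * (s - b) ^+ 2)^-1.
have K0 : 0 <= K.
  rewrite addr_ge0// ?divr_ge0 ?invr_ge0 ?mulr_ge0 ?sqr_ge0 ?(ltW sb)//.
exists (K * A * (1 + 2 / c)), (c / 2); split.
- by rewrite !mulr_ge0// addr_ge0// divr_ge0// ltW.
- by rewrite divr_gt0.
move=> x t /andP[at_ tb]; have st : 0 < s - t by lra.
have z0 := dot_ge0 (x - y).
have HK : heat_kernel y s x t <= A * gauss c y x.
  rewrite (le_trans (heat_kernel_le y x d0 tb bs))// ler_wpM2l// gauss_le//.
  rewrite /c lef_pV2 ?posrE ?mulr_gt0// ler_wpM2l//; lra.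
have ts : t < s by lra.
have PK : `|(d%:R - 1) / (2 * (s - t)) - dot (x - y) (x - y) / (4 * (s - t) ^+ 2)| <=
    K * (1 + dot (x - y) (x - y)).
  rewrite (le_trans (ler_normB _ _))// /K [leRHS]mulrDl lerD//.
    rewrite normrM [`|_^-1|]gtr0_norm ?invr_gt0 ?mulr_gt0//.
    apply: (@le_trans _ _ (`|d%:R - 1| / (2 * (s - b)))).
      rewrite ler_wpM2l// lef_pV2 ?posrE ?mulr_gt0//; lra.
    by rewrite ler_peMr ?divr_ge0 ?mulr_ge0 ?(ltW sb)// lerDl.
  rewrite normrM ger0_norm// [`|_^-1|]gtr0_norm ?invr_gt0 ?mulr_gt0 ?exprn_gt0// mulrC.
  apply: ler_pM => //; last by rewrite lerDr.
    by rewrite invr_ge0 mulr_ge0 ?sqr_ge0.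
  rewrite lef_pV2 ?posrE ?mulr_gt0 ?exprn_gt0// ler_wpM2l//.
  by rewrite ler_pXn2r ?nnegrE ?(ltW sb) ?(ltW st)//; lra.
rewrite /hkt normrM [`|heat_kernel _ _ _ _|]gtr0_norm ?heat_kernel_gt0//.
apply: (le_trans (ler_pM (normr_ge0 _) (ltW (heat_kernel_gt0 y x ts)) PK HK)).
have -> : K * (1 + dot (x - y) (x - y)) * (A * gauss c y x) =
  K * A * ((1 + dot (x - y) (x - y)) * gauss c y x) by ring.
by rewrite -[leRHS]mulrA ler_wpM2l ?mulr_ge0// gauss_poly.
Qed.

(** Away from the centre half of the Gaussian exponent is left over, and it
    beats every power of the time to the singularity. *)
Lemma heat_kernel_far : (0 < d)%N -> exists2 C : R, 0 < C &
  forall y s x t, t < s -> 16^-1 <= dot (x - y) (x - y) ->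
  (1 + (s - t)^-1) * heat_kernel y s x t <= C * expR (- (128 * (s - t))^-1).
Proof.
move=> d0.
(* [(1 + v) <= N exp (v / N)], and the power [d + 1] of the exponential is
   [exp (v / 128)]. *)
pose N : R := 128 * d.+1%:R.
have N1 : 1 <= N.
  have : 1 <= d.+1%:R :> R by rewrite ler1n.
  rewrite /N; lra.
have N0 : 0 < N by lra.
exists (N ^+ d.+1); first by rewrite exprn_gt0.
move=> y s x t ts; set Z := dot _ _ => zZ.
have st : 0 < s - t by rewrite subr_gt0.
set v := (s - t)^-1; have v0 : 0 < v by rewrite invr_gt0.
set a : R := (d%:R - 1) / 2.
have a0 : 0 <= a by rewrite divr_ge0// subr_ge0 ler1n.
have d1 : 1 <= d%:R :> R by rewrite ler1n.
have ad : a <= d%:R by rewrite /a; lra.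
have pw : ((4 * pi * (s - t)) `^ a)^-1 <= (1 + v) ^+ d.
  rewrite -powR_inv1 ?powR_ge0// -powRrM [a * _]mulrC powRrM powR_inv1; last first.
    by rewrite mulr_ge0 ?(ltW st)// mulr_ge0// pi_ge0.
  have p1 : (4 * pi * (s - t))^-1 <= 1 + v.
    rewrite invfM -/v; apply: (@le_trans _ _ v); last by rewrite lerDr.
    rewrite ler_piMl ?(ltW v0)// invf_le1; last by rewrite mulr_gt0// pi_gt0.
    by have := pi_ge2 R; move: (pi : R) => p; lra.
  apply: (@le_trans _ _ ((1 + v) `^ a)).
    apply: ge0_ler_powR => //; rewrite nnegrE ?addr_ge0 ?(ltW v0)// invr_ge0.
    by rewrite mulr_ge0 ?(ltW st)// mulr_ge0// pi_ge0.
  rewrite -powR_mulrn; last by rewrite addr_ge0// ltW.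
  by apply: ler_powR => //; rewrite lerDl ltW.
rewrite heat_kernelE -/a.
(* The exponent is at least [1 / (64 (s - t))], twice what is needed. *)
have g1 : gauss (4 * (s - t))^-1 y x <= expR (- (128 * (s - t))^-1) * expR (- (128 * (s - t))^-1).
  rewrite /gauss -/Z -expRD ler_expR !invfM -/v; nra.
have big : (1 + v) ^+ d.+1 <= N ^+ d.+1 * expR (v / 128).
  have -> : v / 128 = d.+1%:R * (v / N).
    rewrite /N; have : d.+1%:R != 0 :> R by rewrite pnatr_eq0.
    by move: (d.+1%:R : R) => D D0; field.
  rewrite expRM_natl -exprMn_comm; last exact: mulrC.
  rewrite lerXn2r ?nnegrE ?addr_ge0 ?mulr_ge0 ?expR_ge0 ?(ltW v0) ?(ltW N0)//.
  have : 1 + v / N <= expR (v / N) by exact: expR_ge1Dx.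
  move=> H; apply: (@le_trans _ _ (N * (1 + v / N))); last by rewrite ler_wpM2l ?(ltW N0).
  by rewrite mulrDr mulr1 mulrCA divff ?gt_eqF// mulr1 lerD2r.
have e0 := expR_gt0 (- (128 * (s - t))^-1).
have E1 : expR (v / 128) * expR (- (128 * (s - t))^-1) = 1.
  by rewrite invfM [_^-1 * _^-1]mulrC -/v -expRD subrr expR0.
apply: (@le_trans _ _ ((1 + v) * ((1 + v) ^+ d *
  (expR (- (128 * (s - t))^-1) * expR (- (128 * (s - t))^-1))))).
  rewrite ler_wpM2l ?addr_ge0 ?(ltW v0)//; apply: ler_pM => //.
    by rewrite invr_ge0 powR_ge0.
  exact: ltW (gauss_gt0 _ _ _).
rewrite mulrA -exprS mulrA ler_wpM2r ?(ltW e0)//.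
apply: (le_trans (ler_wpM2r (ltW e0) big)).
by rewrite -mulrA E1 mulr1.
Qed.

End heat_kernel_bounds.

(** * The time derivative of a weighted energy *)

Section energy_derivative.
Context {R : realType} {d : nat}.
Unset Implicit Arguments.
Context (W : R -> R) (eps : R) (I : set R) (phi phit : 'rV[R]_d -> R -> R) (a b : R).
Context (dW : forall s : R, is_derive s 1 W (derive1 W s)).
Context (cW' : continuous (derive1 W)).
Context (eps0 : 0 < eps).
Context (abI : forall k, a <= k <= b -> I k).
Context (perphi : periodic_on I phi) (perphit : periodic_on I phit).
Context (phi_lt1 : forall x t, I t -> `|phi x t| < 1).
Context (cphi : continuous_on I phi).
Context (dphi : forall i x t, I t -> derivable (phi^~ t) x (evec i)).
Let p i x t := partial i (phi^~ t) x.
Let pp i j x t := partial j (partial i (phi^~ t)) x.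
Context (cp : forall i, continuous_on I (p i)).
Context (dp : forall i j x t, I t -> derivable (partial i (phi^~ t)) x (evec j)).
Context (cpp : forall i j, continuous_on I (pp i j)).
Context (dphit : forall x t, I t -> has_deriv_in I (phi x) t (phit x t)).
Context (cphit : continuous_on I phit).

Let perp i : periodic_on I (p i). Proof. exact: periodic_partial. Qed.
Let perpp i j : periodic_on I (pp i j).
Proof. exact: (periodic_partial j (perp i)). Qed.
Set Implicit Arguments.

Lemma bounded_on_slab (f : 'rV[R]_d -> R -> R) : continuous_on I f -> periodic_on I f ->
  exists2 C : R, 0 <= C & forall x k, a <= k <= b -> `|f x k| <= C.
Proof.
move=> cf pf; have JI : `[a, b]%classic `<=` I by move=> k; rewrite /= in_itv/=; exact: abI.
have [x k v Ik|C CP] := periodic_bounded (continuous_onW JI cf) (_ : periodic_on `[a, b] f).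
  by apply: pf; exact: JI.
by exists `|C| => // x k kab; rewrite (le_trans (CP x k kab))// ler_norm.
Qed.

Lemma bounded_family_on_slab (f : 'I_d -> 'rV[R]_d -> R -> R) :
  (forall i, continuous_on I (f i)) -> (forall i, periodic_on I (f i)) ->
  exists B : 'I_d -> R, (forall i, 0 <= B i) /\
    forall i x k, a <= k <= b -> `|f i x k| <= B i.
Proof.
move=> cf pf.
have H i : exists B : R, 0 <= B /\ forall x k, a <= k <= b -> `|f i x k| <= B.
  by have [B B0 BP] := bounded_on_slab (cf i) (pf i); exists B.
have [B BP] := choice H.
by exists B; split => [i|i]; have [] := BP i.
Qed.

Lemma bdm_slab (f : 'rV[R]_d -> R -> R) k : continuous_on I f -> periodic_on I f ->
  a <= k <= b -> bdm (f^~ k).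
Proof.
move=> cf pf kab; have [C _ CP] := bounded_on_slab cf pf; split; last first.
  by exists C => x; exact: CP.
by apply: continuous_mRd; apply: (continuous_on_space cf); exact: abI.
Qed.

(** The compact interval reaches from [-3] to [3] because the mean value point is
    only known to be within [|v - u| <= 2] of [u]. *)
Lemma potential_lipschitz : exists2 C : R, 0 <= C &
  forall u v : R, `|u| <= 1 -> `|v| <= 1 -> `|W v - W u| <= C * `|v - u|.
Proof.
have cW1 : {within `[-3, 3]%classic, continuous (derive1 W)} by exact: continuous_subspaceT.
have [M [_ MP]] := compact_bounded (continuous_compact cW1 (@segment_compact _ _ _)).
exists `|M + 1| => // u v u1 v1.
have [c cuv ->] := MVT_any u v dW.
rewrite normrM ler_wpM2r//.
rewrite (le_trans (MP (M + 1) _ _ _))// ?ltrDl// ?ler_norm//.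
exists c => //; rewrite /= in_itv/= -ler_norml.
have -> : c = (c - u) + u by rewrite subrK.
have := ler_normD (c - u) u; have := ler_normB v u; lra.
Qed.

Let e x t := energy_density W eps phi x t.

Lemma energy_densityE x t :
  e x t = eps * (\sum_i p i x t ^+ 2) / 2 + W (phi x t) / eps.
Proof.
rewrite /e /energy_density sqr_enorm /dot; congr (_ * _ / _ + _).
by apply: eq_bigr => i _; rewrite mxE expr2.
Qed.

Lemma bdm_comp (g : R -> R) k : continuous g -> a <= k <= b -> bdm (fun x => g (phi x k)).
Proof.
move=> cg kab; split.
  apply: continuous_mRd => x; apply: continuous_comp; last exact: cg.
  exact: (continuous_on_space cphi (abI _ kab)).
have cg1 : {within `[-1, 1]%classic, continuous g} by exact: continuous_subspaceT.
have [M [_ MP]] := compact_bounded (continuous_compact cg1 (@segment_compact _ _ _)).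
exists (M + 1) => x; apply: (MP (M + 1)); first by rewrite ltrDl.
exists (phi x k) => //; rewrite /= in_itv/= -ler_norml.
by rewrite ltW// phi_lt1//; exact: abI.
Qed.

Lemma bdm_potential k : a <= k <= b -> bdm (fun x => W (phi x k)).
Proof. by apply: bdm_comp => s; exact: is_derive1_continuous (dW s). Qed.

Lemma bdm_energy k : a <= k <= b -> bdm (e^~ k).
Proof.
move=> kab; have -> : e^~ k = fun x =>
    eps / 2 * (\sum_i p i x k * p i x k) + eps^-1 * W (phi x k).
  apply/funext => x; rewrite energy_densityE mulrAC [_ / eps]mulrC.
  by congr (_ * _ + _); apply: eq_bigr => i _; rewrite expr2.
apply: bdmD; apply: bdmM; try exact: bdm_cst; last exact: bdm_potential.
by apply: bdm_sum => i; apply: bdmM; exact: bdm_slab.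
Qed.

Lemma energy_bounded : exists2 C : R, 0 <= C &
  forall x k, a <= k <= b -> `|e x k| <= C.
Proof.
have [C C0 CP] := potential_lipschitz.
have [B [BB BP]] := bounded_family_on_slab cp perp.
have B0 : 0 <= \sum_i B i ^+ 2 by apply: sumr_ge0 => i _; exact: sqr_ge0.
have n0 : 0 <= `|W 0| + C by rewrite addr_ge0.
exists (eps * (\sum_i B i ^+ 2) / 2 + (`|W 0| + C) / eps).
  by rewrite addr_ge0 ?divr_ge0 ?mulr_ge0 ?(ltW eps0).
move=> x k kab; rewrite energy_densityE (le_trans (ler_normD _ _))//.
have /ltW p1 := phi_lt1 x _ (abI _ kab).
rewrite lerD//; rewrite normrM [`|_^-1|]ger0_norm ?invr_ge0 ?(ltW eps0)// ler_wpM2r ?invr_ge0 ?(ltW eps0)//.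
  rewrite normrM [`|eps|]gtr0_norm// ler_wpM2l ?(ltW eps0)//.
  rewrite ger0_norm; last by apply: sumr_ge0 => i _; exact: sqr_ge0.
  apply: ler_sum => i _; rewrite -[leLHS]real_normK ?num_real//.
  by rewrite ler_pXn2r ?nnegrE ?BB// BP.
have := CP 0 (phi x k); rewrite normr0 subr0 => /(_ ler01 p1) H.
have -> : W (phi x k) = W 0 + (W (phi x k) - W 0) by rewrite addrC subrK.
rewrite (le_trans (ler_normD _ _))// lerD2l (le_trans H)//.
by rewrite ler_piMr.
Qed.

Unset Implicit Arguments.
Context (y : 'rV[R]_d) (t : R) (tab : a <= t <= b).
Context (psi : 'rV[R]_d -> R -> R) (psi1 : 'I_d -> 'rV[R]_d -> R) (psit : 'rV[R]_d -> R).
Context (gpsi : forall k, a <= k <= b -> gdom y (psi^~ k)).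
Context (dpsi : forall i x, is_derive x (evec i) (psi^~ t) (psi1 i x)).
Context (gpsi1 : forall i, gdom y (psi1 i)).
Context (Cpsi cpsi : R) (cpsi0 : 0 < cpsi).
Context (psi_lip : forall x k, a <= k <= b ->
  `|psi x k - psi x t| <= Cpsi * gauss cpsi y x * `|k - t|).
Context (dpsit : forall x, h^-1 * (psi x (t + h) - psi x t)
  @[h --> within [set h | a <= t + h <= b] (0 : R)^'] --> psit x).

Set Implicit Arguments.

Let A := [set h : R | a <= t + h <= b].

Let F k := intRd setT (fun x => psi x k * e x k).

(* The difference quotient of the integrand, after the difference of the
   gradients has been integrated by parts. *)
Let Kq h x :=
  h^-1 * (psi x (t + h) - psi x t) * e x (t + h)
  + psi x t * (eps^-1 * (h^-1 * (W (phi x (t + h)) - W (phi x t))))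
  - eps / 2 * (h^-1 * (phi x (t + h) - phi x t)) *
    (\sum_i (psi1 i x * (p i x (t + h) + p i x t)
             + psi x t * (pp i i x (t + h) + pp i i x t))).

Let flux h i x :=
  eps / 2 * h^-1 * (psi x t * ((phi x (t + h) - phi x t) * (p i x (t + h) + p i x t))).
Let dflux h i x := eps / 2 * h^-1 *
  (psi1 i x * ((phi x (t + h) - phi x t) * (p i x (t + h) + p i x t))
   + psi x t * ((p i x (t + h) - p i x t) * (p i x (t + h) + p i x t)
      + (phi x (t + h) - phi x t) * (pp i i x (t + h) + pp i i x t))).

Let bphi k : a <= k <= b -> bdm (phi^~ k). Proof. exact: bdm_slab. Qed.
Let bp i k : a <= k <= b -> bdm (p i ^~ k). Proof. exact: bdm_slab. Qed.
Let bpp i j k : a <= k <= b -> bdm (pp i j ^~ k). Proof. exact: bdm_slab. Qed.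

Let bdmB (f g : 'rV[R]_d -> R) : bdm f -> bdm g -> bdm (fun x => f x - g x).
Proof. by move=> bf bg; apply: bdmD => //; exact: bdmN. Qed.

(** [dflux h i] is the derivative of [flux h i] in the direction [i]. *)
Lemma intRd_dflux h i : A h -> intRd setT (dflux h i) = 0.
Proof.
move=> Ah; apply: (@intRd_derive_eq0 _ _ y (evec i) (flux h i)).
- move=> x; apply: is_derive_mulcf.
  have It := abI _ tab; have Ith := abI _ Ah.
  have D1 := is_derive_subf (derivableP (dphi i x _ Ith)) (derivableP (dphi i x _ It)).
  have D2 := is_derive_addf (derivableP (dp i i x _ Ith)) (derivableP (dp i i x _ It)).
  exact: is_derive_mulf (dpsi i x) (is_derive_mulf D1 D2).
- apply: gdomMr; first exact: bdm_cst.
  apply: gdomM; first exact: gpsi.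
  by apply: bdmM; [apply: bdmB | apply: bdmD]; auto.
- apply: gdomMr; first exact: bdm_cst.
  apply: gdomD; apply: gdomM; auto.
    by apply: bdmM; [apply: bdmB | apply: bdmD]; auto.
  by apply: bdmD; apply: bdmM; (apply: bdmB || apply: bdmD); auto.
Qed.

Lemma gdom_dflux h i : A h -> gdom y (dflux h i).
Proof.
move=> Ah; apply: gdomMr; first exact: bdm_cst.
apply: gdomD; apply: gdomM; auto.
  by apply: bdmM; [apply: bdmB | apply: bdmD]; auto.
by apply: bdmD; apply: bdmM; (apply: bdmB || apply: bdmD); auto.
Qed.

Lemma gdom_Kq h : A h -> gdom y (Kq h).
Proof.
move=> Ah; have bW := bdm_potential.
apply: gdomD; first apply: gdomD.
- apply: gdomM; last exact: bdm_energy.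
  apply: gdomMr; first exact: bdm_cst.
  by apply: gdomD; auto; apply: gdomN; auto.
- apply: gdomM; auto; apply: bdmM; first exact: bdm_cst.
  by apply: bdmM; [exact: bdm_cst | apply: bdmB; auto].
- apply: gdomN; apply: gdomMr.
    apply: bdmM; first exact: bdm_cst.
    by apply: bdmM; [exact: bdm_cst | apply: bdmB; auto].
  by apply: gdom_sum => i; apply: gdomD; apply: gdomM; auto; apply: bdmD; auto.
Qed.

(** The difference of [|grad phi|^2] at two times is the difference of the
    gradients times their sum.  Moving the derivatives off the difference
    produces [phi (t + h) - phi t], whose quotient by [h] converges, whereas
    [grad phi] is not assumed to be differentiable in time. *)
Lemma energy_quotient h : A h -> h != 0 -> h^-1 * (F (t + h) - F t) = intRd setT (Kq h).
Proof.
move=> Ah h0.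
have gF k : a <= k <= b -> gdom y (fun x => psi x k * e x k).
  by move=> kab; apply: gdomM; [exact: gpsi | exact: bdm_energy].
have gS : gdom y (fun x => \sum_i dflux h i x) by apply: gdom_sum => i; exact: gdom_dflux.
have -> : h^-1 * (F (t + h) - F t) =
    intRd setT (fun x => h^-1 * (psi x (t + h) * e x (t + h) + - (psi x t * e x t))).
  have gN := gdomN (gF t tab).
  rewrite (@intRdZ _ _ y); last by apply: gdomD; auto.
  rewrite (@intRdD _ _ y)//; last by auto.
  congr (_ * (_ + _)).
  by under eq_fun do rewrite -mulN1r; rewrite (@intRdZ _ _ y) ?mulN1r; auto.
have -> : (fun x => h^-1 * (psi x (t + h) * e x (t + h) + - (psi x t * e x t))) =
    (fun x => Kq h x + \sum_i dflux h i x).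
  apply/funext => x.
  pose a1 := \sum_i psi1 i x * (p i x (t + h) + p i x t).
  pose a2 := \sum_i (p i x (t + h) - p i x t) * (p i x (t + h) + p i x t).
  pose a3 := \sum_i (pp i i x (t + h) + pp i i x t).
  have E1 : \sum_i dflux h i x = eps / 2 * h^-1 * ((phi x (t + h) - phi x t) * a1
      + psi x t * (a2 + (phi x (t + h) - phi x t) * a3)).
    rewrite -mulr_sumr; congr (_ * _).
    rewrite /a1 /a2 /a3 !mulr_sumr -big_split/= mulr_sumr -big_split/=.
    apply: eq_bigr => i _; move: (psi1 i x) (phi x (t + h) - phi x t) (psi x t)
      (p i x (t + h)) (p i x t) (pp i i x (t + h)) (pp i i x t).
    by clear => *; ring.
  have E2 : \sum_i (psi1 i x * (p i x (t + h) + p i x t)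
      + psi x t * (pp i i x (t + h) + pp i i x t)) = a1 + psi x t * a3.
    by rewrite big_split/= -mulr_sumr.
  have E3 : \sum_i p i x (t + h) ^+ 2 = \sum_i p i x t ^+ 2 + a2.
    by rewrite -big_split/=; apply: eq_bigr => i _; move: (p i x _) (p i x t); clear => *; ring.
  rewrite E1 /Kq E2 !energy_densityE E3; clearbody a1 a2 a3; clear E1 E2 E3.
  move: (psi x (t + h)) (psi x t) (W (phi x (t + h))) (W (phi x t))
    (phi x (t + h)) (phi x t) (\sum_i p i x t ^+ 2).
  have e0 : eps != 0 by rewrite gt_eqF.
  move=> *; field.
  by rewrite h0 e0.
rewrite (@intRdD _ _ y)//; last exact: gdom_Kq.
rewrite (@intRd_sum _ _ y); last by move=> i; exact: gdom_dflux.
by rewrite big1 ?addr0// => i _; exact: intRd_dflux.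
Qed.

(** The quotients in time are bounded by suprema of time derivatives over the
    slab, and every other factor is bounded by periodicity, except for the test
    function and its gradient, which are dominated by Gaussians. *)
Lemma Kq_dominated : exists C c : R, 0 < c /\
  forall h x, A h -> h != 0 -> `|Kq h x| <= C * gauss c y x.
Proof.
have [Ce Ce0 CeP] := energy_bounded.
have [CW CW0 CWP] := potential_lipschitz.
have [Ct Ct0 CtP] := bounded_on_slab cphit perphit.
have [B [BB BP]] := bounded_family_on_slab cp perp.
have [B' [BB' BP']] := bounded_family_on_slab (fun i => cpp i i) (fun i => perpp i i).
have [C0 [c0 [C00 c00 psiP]]] := gdom_bound (gpsi _ tab).
have : gdom y (fun x => \sum_i (`|psi1 i x| * (2 * B i) + `|psi x t| * (2 * B' i))).
  apply: gdom_sum => i; apply: gdomD; apply: gdomM; try exact: bdm_cst.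
    have [mf [C1 [c1 [c10 H]]]] := gpsi1 i; split; last first.
      by exists C1, c1; split => // x; rewrite normr_id.
    by apply: measurableT_comp => //; exact: mf.
  have [mf [C1 [c1 [c10 H]]]] := gpsi _ tab; split; last first.
    by exists C1, c1; split => // x; rewrite normr_id.
  by apply: measurableT_comp => //; exact: mf.
move=> /gdom_bound[C1 [c1 [C10 c10 SP]]].
have Cpsi0 : 0 <= Ce * `|Cpsi| by rewrite mulr_ge0.
exists (Ce * `|Cpsi| + C0 * (eps^-1 * (CW * Ct)) + eps / 2 * Ct * C1),
  (Num.min cpsi (Num.min c0 c1)); split; first by rewrite !lt_min cpsi0 c00.
move=> h x Ah h0.
set c := Num.min _ _.
have g1 : gauss cpsi y x <= gauss c y x by rewrite gauss_le// /c ge_min lexx.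
have g2 : gauss c0 y x <= gauss c y x by rewrite gauss_le// /c !ge_min lexx !orbT.
have g3 : gauss c1 y x <= gauss c y x by rewrite gauss_le// /c !ge_min lexx !orbT.
have gp := gauss_gt0 c y x; have gp1 := gauss_gt0 cpsi y x.
have hpos : 0 < `|h| by rewrite normr_gt0.
have th : t + h - t = h by rewrite addrC addKr.
have q1 : `|h^-1 * (psi x (t + h) - psi x t)| <= `|Cpsi| * gauss c y x.
  rewrite normrM normfV mulrC ler_pdivrMr//.
  have := psi_lip x _ Ah; rewrite th => /le_trans; apply; rewrite ler_wpM2r//.
  apply: (@le_trans _ _ (`|Cpsi| * gauss cpsi y x)); last by rewrite ler_wpM2l.
  by rewrite ler_wpM2r ?(ltW gp1)// ler_norm.
have q2 : `|h^-1 * (phi x (t + h) - phi x t)| <= Ct.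
  rewrite normrM normfV mulrC ler_pdivrMr//.
  have := @has_deriv_in_le _ I (phi x) (phit x) a b Ct abI
    (fun k Ik => dphit x k Ik) _ (fun k kab => CtP x k kab) t (t + h) tab Ah.
  rewrite th; apply => k Ik.
  apply: (@continuous_on_cvg _ _ I phi _ (within I (nbhs k)) _ (fun=> x) id x k cphi Ik).
  - exact: cvg_cst.
  - exact: cvg_within.
  - by rewrite near_withinE; exact: nearW.
have q3 : `|h^-1 * (W (phi x (t + h)) - W (phi x t))| <= CW * Ct.
  have := CWP _ _ (ltW (phi_lt1 x _ (abI _ tab))) (ltW (phi_lt1 x _ (abI _ Ah))) => H.
  apply: (@le_trans _ _ (CW * `|h^-1 * (phi x (t + h) - phi x t)|)); last by rewrite ler_wpM2l.
  by rewrite !normrM mulrCA ler_wpM2l.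
have q4 : `|\sum_i (psi1 i x * (p i x (t + h) + p i x t)
             + psi x t * (pp i i x (t + h) + pp i i x t))| <= C1 * gauss c1 y x.
  apply: le_trans (SP x); apply: le_trans (ler_norm_sum _ _ _) (le_trans _ (ler_norm _)).
  apply: ler_sum => i _; apply: le_trans (ler_normD _ _) _; rewrite !normrM.
  have f1 := BP i x _ Ah; have f2 := BP i x _ tab.
  have f3 := BP' i x _ Ah; have f4 := BP' i x _ tab.
  rewrite lerD// ler_wpM2l//.
    by rewrite mulr_natl mulr2n; exact: le_trans (ler_normD _ _) (lerD f1 f2).
  by rewrite mulr_natl mulr2n; exact: le_trans (ler_normD _ _) (lerD f3 f4).
rewrite /Kq (le_trans (ler_normB _ _))// 2!mulrDl lerD//.
  rewrite (le_trans (ler_normD _ _))// lerD//.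
    rewrite normrM -mulrA mulrC; apply: ler_pM => //.
    exact: CeP.
  rewrite normrM [leRHS]mulrAC; apply: ler_pM => //.
    by apply: le_trans (psiP x) _; exact: ler_wpM2l.
  by rewrite normrM gtr0_norm ?invr_gt0// ler_wpM2l ?invr_ge0 ?(ltW eps0).
have e2 : 0 < eps / 2 by rewrite divr_gt0.
rewrite normrM -[leRHS]mulrA; apply: ler_pM => //.
  by rewrite normrM gtr0_norm// ler_wpM2l ?(ltW e2).
by rewrite (le_trans q4)// ler_wpM2l.
Qed.

Let K0 x := psit x * e x t + psi x t * (eps^-1 * (derive1 W (phi x t) * phit x t))
  - eps * phit x t * (\sum_i psi1 i x * p i x t + psi x t * laplacian (phi^~ t) x).

Lemma cvg_time (f : 'rV[R]_d -> R -> R) x : continuous_on I f ->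
  f x (t + h) @[h --> within A (0 : R)^'] --> f x t.
Proof.
move=> cf; apply: (@continuous_on_cvg _ _ I f _ (within A (0 : R)^') _
  (fun=> x) (fun h => t + h) x t cf (abI _ tab)); first exact: cvg_cst.
  rewrite -[X in _ --> X]addr0; apply: cvgD; first exact: cvg_cst.
  by do 2 apply: cvg_within_filter.
by rewrite near_withinE; apply: nearW => h; exact: abI.
Qed.

Lemma cvg_time_quotient x :
  h^-1 * (phi x (t + h) - phi x t) @[h --> within A (0 : R)^'] --> phit x t.
Proof.
have H := dphit x t (abI _ tab); apply: cvg_trans H; apply: cvg_app.
by apply: within_subset => // h; exact: abI.
Qed.

(** The chain rule for a one-sided derivative, by the factorisation of
    Caratheodory. *)
Lemma cvg_potential_quotient x :
  h^-1 * (W (phi x (t + h)) - W (phi x t)) @[h --> within A (0 : R)^']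
  --> derive1 W (phi x t) * phit x t.
Proof.
have /is_derive1_caratheodory [G [GE cG G0]] := dW (phi x t).
have E : (fun h => h^-1 * (W (phi x (t + h)) - W (phi x t))) =
    (fun h => G (phi x (t + h)) * (h^-1 * (phi x (t + h) - phi x t))).
  by apply/funext => h; rewrite GE mulrCA.
rewrite E -G0; apply: cvgM; last exact: cvg_time_quotient.
exact: (cvg_comp (fun h => phi x (t + h)) G (@cvg_time phi x cphi) cG).
Qed.

Lemma Kq_cvg x : Kq h x @[h --> within A (0 : R)^'] --> K0 x.
Proof.
have -> : K0 x = psit x * e x t + psi x t * (eps^-1 * (derive1 W (phi x t) * phit x t))
  - eps / 2 * phit x t * (\sum_i (psi1 i x * (p i x t + p i x t) +
       psi x t * (pp i i x t + pp i i x t))).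
  rewrite /K0 /laplacian; congr (_ - _).
  rewrite [psi x t * _]mulr_sumr -big_split/= !mulr_sumr; apply: eq_bigr => i _.
  rewrite -/(p i x t) -/(pp i i x t).
  by move: (p i x t) (pp i i x t) (psi1 i x) (psi x t) (phit x t) => *; field.
have ce : e x (t + h) @[h --> within A (0 : R)^'] --> e x t.
  rewrite energy_densityE.
  have -> : (fun h => e x (t + h)) = (fun h => eps * (\sum_i p i x (t + h) ^+ 2) / 2
      + W (phi x (t + h)) / eps) by apply/funext => h; rewrite energy_densityE.
  have cWphi : W (phi x (t + h)) @[h --> within A (0 : R)^'] --> W (phi x t).
    apply: (cvg_comp (fun h => phi x (t + h)) W (@cvg_time phi x cphi)); exact: is_derive1_continuous (dW _).
  apply: cvgD; last by apply: cvgM; [exact: cWphi | exact: cvg_cst].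
  apply: cvgM; last exact: cvg_cst.
  apply: cvgM; first exact: cvg_cst.
  apply: cvg_sumr => i; rewrite expr2; under eq_fun do rewrite expr2.
  by apply: cvgM; exact: cvg_time.
apply: cvgB; first apply: cvgD.
- by apply: cvgM; [exact: dpsit | exact: ce].
- apply: cvgM; first exact: cvg_cst.
  by apply: cvgM; [exact: cvg_cst | exact: cvg_potential_quotient].
- apply: cvgM.
    by apply: cvgM; [exact: cvg_cst | exact: cvg_time_quotient].
  apply: cvg_sumr => i; apply: cvgD; (apply: cvgM; first exact: cvg_cst);
    by apply: cvgD; [exact: cvg_time | exact: cvg_cst].
Qed.

(** The derivative of the energy weighted by [psi]: in the limit the integrand is
    [psi_t e + psi W'(phi) phi_t / eps - eps phi_t div (psi grad phi)]. *)
Lemma energy_derivative :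
  h^-1 * (F (t + h) - F t) @[h --> within A (0 : R)^'] --> intRd setT K0.
Proof.
have [C [c [c0 KC]]] := Kq_dominated.
have L : intRd setT (Kq h) @[h --> within A (0 : R)^'] --> intRd setT K0.
  apply: (@intRd_cvg _ _ y A Kq K0 C c c0) => //; last exact: Kq_cvg.
  by move=> h Ah _; have [] := gdom_Kq Ah.
apply: cvg_trans L; apply: near_eq_cvg; rewrite near_withinE; near=> h => Ah.
by rewrite energy_quotient//; near: h; exact: nbhs_dnbhs_neq.
Unshelve. all: by end_near. Qed.

End energy_derivative.

(** * The stress tensor *)

Section stress_tensor.
Context {R : realType} {d : nat}.
Unset Implicit Arguments.
Context (W : R -> R) (eps : R) (f : 'rV[R]_d -> R) (y : 'rV[R]_d).
Context (dW : forall s : R, is_derive s 1 W (derive1 W s)).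
Context (eps0 : 0 < eps).
Let p i := partial i f.
Let pp i j := partial j (partial i f).
Context (df : forall i x, derivable f x (evec i)).
Context (dp : forall i j x, derivable (partial i f) x (evec j)).
Context (cpp : forall i j, continuous (pp i j)).
Context (bW : bdm (fun x => W (f x))) (bW' : bdm (fun x => derive1 W (f x))).
Context (bp : forall i, bdm (p i)) (bpp : forall i j, bdm (pp i j)).
Context (chi1 : 'I_d -> 'rV[R]_d -> R) (chi2 : 'I_d -> 'I_d -> 'rV[R]_d -> R).
Context (dchi1 : forall i j x, is_derive x (evec j) (chi1 i) (chi2 i j x)).
Context (gchi1 : forall i, gdom y (chi1 i)) (gchi2 : forall i j, gdom y (chi2 i j)).
Set Implicit Arguments.

Let e x := eps / 2 * (\sum_i p i x * p i x) + eps^-1 * W (f x).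
Let e' j x := eps / 2 * (\sum_i (pp i j x * p i x + p i x * pp i j x))
  + eps^-1 * (derive1 W (f x) * p j x).

Let de j x : is_derive x (evec j) e (e' j x).
Proof.
apply: is_derive_addf; apply: is_derive_mulcf.
  apply: is_derive_sumf => i.
  exact: is_derive_mulf (derivableP (dp i j x)) (derivableP (dp i j x)).
exact: is_derive_comp1 (dW _) (derivableP (df j x)).
Qed.

Let be : bdm e.
Proof.
apply: bdmD; apply: bdmM; try exact: bdm_cst; last exact: bW.
by apply: bdm_sum => i; apply: bdmM.
Qed.

Let be' j : bdm (e' j).
Proof.
apply: bdmD; apply: bdmM; try exact: bdm_cst; last by apply: bdmM.
by apply: bdm_sum => i; apply: bdmD; apply: bdmM.
Qed.

Let V j x := chi1 j x * e x + - (eps * \sum_i chi1 i x * (p i x * p j x)).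
Let V' j x := (chi2 j j x * e x + chi1 j x * e' j x) + - (eps * \sum_i
  (chi2 i j x * (p i x * p j x) + chi1 i x * (pp i j x * p j x + p i x * pp j j x))).

Let gV j : gdom y (V j).
Proof.
apply: gdomD; first exact: gdomM.
apply: gdomN; apply: gdomMr; first exact: bdm_cst.
by apply: gdom_sum => i; apply: gdomM => //; apply: bdmM.
Qed.

Let gV' j : gdom y (V' j).
Proof.
apply: gdomD; first by apply: gdomD; apply: gdomM.
apply: gdomN; apply: gdomMr; first exact: bdm_cst.
apply: gdom_sum => i; apply: gdomD; apply: gdomM => //; first by apply: bdmM.
by apply: bdmD; apply: bdmM.
Qed.

Let intV' j : intRd setT (V' j) = 0.
Proof.
apply: (@intRd_derive_eq0 _ _ y (evec j) (V j)) => // x.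
apply: is_derive_addf; first exact: is_derive_mulf.
apply: is_derive_oppf; apply: is_derive_mulcf; apply: is_derive_sumf => i.
apply: is_derive_mulf => //.
exact: is_derive_mulf (derivableP (dp i j x)) (derivableP (dp j j x)).
Qed.

(** The divergence of the vector field with components
    [chi_j e - eps (sum_i chi_i p_i) p_j], where [chi] is the gradient of a test
    function and [p] the gradient of [f]: the stress tensor contracted with
    [chi]. *)
Definition stress x := (\sum_j chi2 j j x) * e x
  - eps * (\sum_j \sum_i chi2 i j x * p i x * p j x)
  - eps * (\sum_i chi1 i x * p i x) * (\sum_j pp j j x - derive1 W (f x) / eps ^+ 2).

(** The second derivatives of [f] off the diagonal cancel by symmetry. *)
Let stressE x : stress x = \sum_j V' j x.
Proof.
have sym i j : pp i j x = pp j i x.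
  apply: (@is_derive_swap R _ f (p i) (p j) (pp i j) (pp j i) x (evec i) (evec j)).
  - by move=> z; exact/derivableP/df.
  - by move=> z; exact/derivableP/df.
  - by move=> z; exact/derivableP/dp.
  - by move=> z; exact/derivableP/dp.
  - exact: cpp.
  - exact: cpp.
have e0 : eps != 0 by rewrite gt_eqF.
pose b := \sum_i chi1 i x * p i x.
pose c := \sum_j chi1 j x * \sum_i p i x * pp i j x.
have T1 : \sum_j chi1 j x * e' j x = eps * c + eps^-1 * derive1 W (f x) * b.
  rewrite /c /b !mulr_sumr -big_split/=; apply: eq_bigr => j _.
  have -> : e' j x = eps * (\sum_i p i x * pp i j x) + eps^-1 * (derive1 W (f x) * p j x).
    rewrite /e' big_split/=.
    have -> : \sum_i pp i j x * p i x = \sum_i p i x * pp i j x.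
      by apply: eq_bigr => i _; rewrite mulrC.
    by move: (\sum_i _) => s; congr (_ + _); field.
  by move: (\sum_i _) (p j x) (chi1 j x) (derive1 W _); clear => *; ring.
have T2 : \sum_j \sum_i chi1 i x * (pp i j x * p j x) = c.
  rewrite exchange_big/= /c; apply: eq_bigr => i _; rewrite mulr_sumr.
  by apply: eq_bigr => j _; rewrite (sym i j) [p j x * _]mulrC.
have T3 : \sum_j \sum_i chi1 i x * (p i x * pp j j x) = b * \sum_j pp j j x.
  rewrite mulr_sumr; apply: eq_bigr => j _; rewrite mulr_suml.
  by apply: eq_bigr => i _; rewrite mulrA.
have T4 : \sum_j \sum_i chi2 i j x * (p i x * p j x) =
    \sum_j \sum_i chi2 i j x * p i x * p j x.
  by apply: eq_bigr => j _; apply: eq_bigr => i _; rewrite mulrA.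
have T5 : \sum_j V' j x = (\sum_j chi2 j j x) * e x + \sum_j chi1 j x * e' j x
   - eps * (\sum_j \sum_i chi2 i j x * p i x * p j x + c + b * \sum_j pp j j x).
  rewrite -T4 -T3 -{1}T2 -!big_split/= mulr_suml -big_split/= mulr_sumr -sumrB.
  apply: eq_bigr => j _; congr (_ - eps * _); rewrite -!big_split/=.
  by apply: eq_bigr => i _; rewrite mulrDr addrA.
rewrite T5 T1 /stress -/b; clear T1 T2 T3 T4 T5; clearbody b c.
move: (\sum_j chi2 j j x) (e x) (\sum_j pp j j x) b c (derive1 W _)
  (\sum_j \sum_i chi2 i j x * p i x * p j x).
by move=> *; field.
Qed.

Lemma gdom_stress : gdom y stress.
Proof.
have -> : stress = fun x => \sum_j V' j x by apply/funext => x; rewrite stressE.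
exact: gdom_sum.
Qed.

Lemma intRd_stress : intRd setT stress = 0.
Proof.
have -> : stress = fun x => \sum_j V' j x by apply/funext => x; rewrite stressE.
by rewrite (@intRd_sum _ _ y)// big1.
Qed.

End stress_tensor.

(** * The pointwise inequality *)

Section monotonicity_integrand.
Context {R : realType} {d : nat}.

(** Nonpositive discriminant; the degenerate case [a = 0] forces [b = 0]. *)
Lemma quadratic_ge0 (a b c X : R) : 0 <= a -> 0 <= c -> b ^+ 2 <= a * c ->
  0 <= a * X ^+ 2 + 2 * b * X + c.
Proof.
move=> a0 c0 bac; have [aE|aN] := eqVneq a 0.
  have b0 : b = 0.
    by apply/eqP; rewrite -sqrf_eq0 eq_le sqr_ge0 andbT (le_trans bac)// aE mul0r.
  by rewrite aE b0 !(mul0r, mulr0) !add0r.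
have ap : 0 < a by rewrite lt_def aN.
rewrite -(pmulr_rge0 _ ap).
have -> : a * (a * X ^+ 2 + 2 * b * X + c) = (a * X + b) ^+ 2 + (a * c - b ^+ 2) by ring.
by rewrite addr_ge0 ?sqr_ge0// subr_ge0.
Qed.

(** The integrand of the energy derivative for the test function
    [psi = eta rho], where [rho] is a backward heat kernel at distance [tau]
    from its singular time and [z] is the displacement from its centre.  The
    scalar [H] is the part of the time derivative driven by the energy, [F] the
    forcing.  Completing the square in [H + F / 2] leaves [F ^ 2 / 4]; the
    matrix [D^2 rho - grad rho (x) grad rho / rho] of the heat kernel is
    [- rho / (2 tau)] times the identity, so what is left over is the
    discrepancy, which is nonpositive. *)
Lemma monotonicity_integrand_le (eps Wv W1 rho eta tau ft lap F kappa : R)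
  (z P eta1 : 'I_d -> R) (eta2 : 'I_d -> 'I_d -> R) :
  let H := lap - W1 / eps ^+ 2 in
  let Z := \sum_i z i * z i in
  let PP := \sum_i P i * P i in
  let n := \sum_i eta1 i * P i in
  let rho1 i := - (z i / (2 * tau)) * rho in
  let rho2 i j := (z i * z j / (4 * tau ^+ 2) - (i == j)%:R / (2 * tau)) * rho in
  let psi1 i := eta1 i * rho + eta * rho1 i in
  let psi2 i j := (eta2 i j * rho + eta1 i * rho1 j) + (eta1 j * rho1 i + eta * rho2 i j) in
  let psit := eta * (((d%:R - 1) / (2 * tau) - Z / (4 * tau ^+ 2)) * rho) in
  let e := eps / 2 * PP + eps^-1 * Wv in
  0 < eps -> 0 < tau -> 0 <= rho -> 0 <= eta -> 0 <= kappa -> n ^+ 2 <= eta * kappa ->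
  eps / 2 * PP <= eps^-1 * Wv -> ft = H + F ->
  psit * e + eta * rho * (eps^-1 * (W1 * ft))
    - eps * ft * (\sum_i psi1 i * P i + eta * rho * lap)
  + ((\sum_j psi2 j j) * e - eps * (\sum_j \sum_i psi2 i j * P i * P j)
     - eps * (\sum_i psi1 i * P i) * H)
  <= eps * (eta * rho) * F ^+ 2 / 4
     + rho * ((\sum_j eta2 j j - (\sum_i eta1 i * z i) / tau) * e
              + eps * (kappa - \sum_j \sum_i eta2 i j * P i * P j)).
Proof.
move=> H Z PP n rho1 rho2 psi1 psi2 psit e eps0 tau0 rho0 eta0 kappa0 nk disc ftE.
pose m := \sum_i z i * P i.
pose l := \sum_i eta1 i * z i.
pose Q := \sum_j \sum_i eta2 i j * P i * P j.
pose De := \sum_j eta2 j j.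
have t0 : tau != 0 by rewrite gt_eqF.
have e0 : eps != 0 by rewrite gt_eqF.
have Eb : \sum_i psi1 i * P i = rho * n - eta * rho * m / (2 * tau).
  have -> : eta * rho * m / (2 * tau) = (eta * rho / (2 * tau)) * m by field.
  rewrite /n /m !mulr_sumr -sumrB; apply: eq_bigr => i _.
  by rewrite /psi1 /rho1; field.
have Et : \sum_j psi2 j j = rho * De - rho * l / tau +
    eta * rho * (Z / (4 * tau ^+ 2) - d%:R / (2 * tau)).
  have -> : d%:R / (2 * tau) = \sum_(j < d) (2 * tau)^-1.
    by rewrite sumr_const card_ord -[RHS]mulr_natl.
  have -> : rho * l / tau = (rho / tau) * l by field.
  rewrite /De /l /Z mulr_suml -sumrB !mulr_sumr -sumrB -big_split/=.
  apply: eq_bigr => j _; rewrite /psi2 /rho1 /rho2 eqxx/= mulr1n; field; exact: t0.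
have EQ : \sum_j \sum_i psi2 i j * P i * P j = rho * Q - rho * n * m / tau +
    eta * rho * (m ^+ 2 / (4 * tau ^+ 2) - PP / (2 * tau)).
  have S1 : \sum_j \sum_i (eta1 i * P i) * (z j * P j) = n * m.
    rewrite /m mulr_sumr; apply: eq_bigr => j _.
    by rewrite /n mulr_suml.
  have S2 : \sum_j \sum_i (z i * P i) * (eta1 j * P j) = n * m.
    rewrite mulrC /n mulr_sumr; apply: eq_bigr => j _.
    by rewrite /m mulr_suml.
  have S3 : \sum_j \sum_i (z i * P i) * (z j * P j) = m ^+ 2.
    rewrite expr2 {2}/m mulr_sumr; apply: eq_bigr => j _.
    by rewrite /m mulr_suml.
  have S4 : \sum_j \sum_i ((i == j)%:R * (P i * P j)) = PP.
    apply: eq_bigr => j _; rewrite (bigD1 j)//= big1 => [|i /negbTE ->].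
      by rewrite eqxx mul1r addr0.
    by rewrite mul0r.
  have -> : rho * n * m / tau = rho / (2 * tau) * (n * m) + rho / (2 * tau) * (n * m) by field.
  rewrite -{1}S1 -S2 -S3 -S4.
  transitivity (rho * Q + - (rho / (2 * tau)) * (\sum_j \sum_i (eta1 i * P i) * (z j * P j))
    + - (rho / (2 * tau)) * (\sum_j \sum_i (z i * P i) * (eta1 j * P j))
    + eta * rho / (4 * tau ^+ 2) * (\sum_j \sum_i (z i * P i) * (z j * P j))
    + - (eta * rho / (2 * tau)) * (\sum_j \sum_i ((i == j)%:R * (P i * P j)))).
    rewrite !mulr_sumr -!big_split/=; apply: eq_bigr => j _.
    rewrite !mulr_sumr -!big_split/=; apply: eq_bigr => i _.
    by rewrite /psi2 /rho1 /rho2; move: (_ == _)%:R => delta; field.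
  move: (\sum_j \sum_i (eta1 i * P i) * _) (\sum_j \sum_i _ * (eta1 j * _)) => s1 s2.
  by move: (\sum_j \sum_i (z i * P i) * _) (\sum_j \sum_i (_%:R * _)) => s3 s4; field.
(* Up to the factor [eps rho], what the square completed in
   [X = H + F / 2 - m / (2 tau)] leaves is [eta X^2 + 2 n X + kappa]. *)
have key := quadratic_ge0 (lap - W1 / eps ^+ 2 + F / 2 - m / (2 * tau)) eta0 kappa0 nk.
rewrite Eb Et EQ -/De -/l -/Q ftE /psit -/H.
have g1 : 0 <= eps * rho * (eta * (H + F / 2 - m / (2 * tau)) ^+ 2 +
    2 * n * (H + F / 2 - m / (2 * tau)) + kappa).
  by rewrite mulr_ge0// mulr_ge0// ltW.
have g2 : 0 <= eta * rho / (2 * tau) * (eps^-1 * Wv - eps / 2 * PP).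
  by rewrite mulr_ge0 ?subr_ge0// divr_ge0 ?mulr_ge0// ltW.
rewrite -subr_ge0.
set RHS := (X in 0 <= X).
suff -> : RHS = eps * rho * (eta * (H + F / 2 - m / (2 * tau)) ^+ 2 +
    2 * n * (H + F / 2 - m / (2 * tau)) + kappa)
    + eta * rho / (2 * tau) * (eps^-1 * Wv - eps / 2 * PP) by rewrite addr_ge0.
rewrite /RHS /e; have -> : lap = H + W1 / eps ^+ 2 by rewrite /H subrK.
clearbody H Z PP n m l Q De.
by field; rewrite t0 e0.
Qed.

End monotonicity_integrand.

(** * Estimates on the cut-off function *)

Section cutoff_facts.
Context {R : realType}.

(** A nonnegative function with bounded second derivative cannot have a steep
    slope at a point where it is small, for it would become negative nearby. *)
Lemma sqr_derive_le (f f' f'' : R -> R) (M x : R) : 0 < M ->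
  (forall z : R, is_derive z 1 f (f' z)) -> (forall z : R, is_derive z 1 f' (f'' z)) ->
  (forall z, 0 <= f z) -> (forall z, `|f'' z| <= M) -> f' x ^+ 2 <= 4 * M * f x.
Proof.
move=> M0 df df' f0 f''M.
(* The minimum point of the parabola that bounds [f] from above. *)
pose s := - f' x / (2 * M).
have [c cs E] := MVT_any x (x + s) df.
have [c' cs' E'] := MVT_any x c df'.
have xs : x + s - x = s by rewrite addrC addKr.
rewrite xs in cs E.
have H1 : `|f' c - f' x| <= M * `|s|.
  by rewrite E' normrM; apply: ler_pM.
have H2 : s * (f' c - f' x) <= M * s ^+ 2.
  rewrite (le_trans (ler_norm _))// normrM -[s ^+ 2]real_normK ?num_real// expr2 mulrA mulrC.
  by rewrite ler_wpM2r.
have f1 := f0 (x + s).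
have sE : f' x = - (2 * M * s) by rewrite /s; field; rewrite gt_eqF.
have E2 : f (x + s) = f x + f' c * s by rewrite -E; ring.
rewrite sE in H2 *.
have : 0 <= f x - M * s ^+ 2 by nra.
have E3 : 4 * M * f x - (- (2 * M * s)) ^+ 2 = 4 * M * (f x - M * s ^+ 2) by ring.
by move=> H3; rewrite -subr_ge0 E3 mulr_ge0// mulr_ge0// ltW.
Qed.

Context {d : nat}.
Implicit Types (x y : 'rV[R]_d) (f : 'rV[R]_d -> R).

Lemma partial_locally_cst f (c : R) x i : (\forall z \near x, f z = c) -> partial i f x = 0.
Proof.
move=> fc; rewrite /partial (@near_eq_derive _ _ _ f (cst c) x (evec i))//.
exact: derive_cst.
Qed.

(** The support is contained in a compact cube. *)
Lemma bounded_of_support f : continuous f -> (forall x, 1 <= enorm x -> f x = 0) ->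
  exists C : R, forall x, `|f x| <= C.
Proof.
move=> cf f0.
pose box := [set v : 'rV[R]_d | forall i, `[-1, 1]%classic (v ord0 i)].
have cb : compact box.
  by apply: (@rV_compact R d (fun=> `[-1, 1]%classic)) => _; exact: segment_compact.
have cfb : {within box, continuous f} by exact: continuous_subspaceT.
have [M [_ MP]] := compact_bounded (continuous_compact cfb cb).
exists `|M + 1| => x; have [x1|x1] := leP 1 (enorm x); first by rewrite f0// normr0.
rewrite (le_trans (MP (M + 1) _ _ _)) ?ltrDl ?ler_norm//.
exists x => // i; rewrite /= in_itv/= -ler_norml.
exact: le_trans (coord_le_enorm x i) (ltW x1).
Qed.

Lemma is_derive_subr f (a : R) y x v : is_derive (x - y) v f a ->
  is_derive x v (fun z => f (z - y)) a.
Proof.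
move=> /is_derive_cvg H; apply/is_derive_cvg.
by under eq_fun do rewrite -addrA.
Qed.

Context (eta : 'rV[R]_d -> R) (heta : cutoff eta).

Let eta1 i := partial i eta.
Let eta2 i j := partial j (partial i eta).

Lemma cutoff_derivable i x : derivable eta x (evec i).
Proof. by have [/(_ 1%N)[_ /(_ i)[]]] := heta. Qed.
Lemma cutoff_continuous : continuous eta.
Proof. by have [/(_ 0%N)[]] := heta. Qed.
Lemma cutoff_derivable2 i j x : derivable (partial i eta) x (evec j).
Proof. by have [/(_ 2%N)[_ /(_ i)[_ [_ /(_ j)[]]]]] := heta. Qed.
Lemma cutoff_continuous1 i : continuous (partial i eta).
Proof. by have [/(_ 1%N)[_ /(_ i)[_ []]]] := heta. Qed.
Lemma cutoff_continuous2 i j : continuous (partial j (partial i eta)).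
Proof. by have [/(_ 2%N)[_ /(_ i)[_ [_ /(_ j)[_ []]]]]] := heta. Qed.

(** The closure of the support is contained in the open ball of radius [1/2], so
    its complement is an open set containing every such [x]. *)
Lemma near_cutoff_eq0 x : 2^-1 <= enorm x -> \forall z \near x, eta z = 0.
Proof.
move=> x2; have [_ _ supp _ _] := heta.
have nx : (~` closure [set z | eta z != 0]) x.
  by move=> /supp; rewrite /eball/= subr0 ltNge x2.
have : nbhs x (~` closure [set z | eta z != 0]).
  by apply: open_nbhs_nbhs; split => //; apply: closed_openC; exact: closed_closure.
apply: filterS => z nz; apply/eqP; apply: contrapT => /negP z0.
by apply: nz; exact: subset_closure.
Qed.

Lemma near_cutoff_eq1 x : enorm x < 4^-1 -> \forall z \near x, eta z = 1.
Proof.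
move=> x4; have [_ _ _ one _] := heta.
have c0 := @continuous_edist R d 0 x; rewrite /continuous_at in c0.
have : \forall z \near x, enorm (z - 0) < 4^-1 by apply: cvgr_lt c0 _ _; rewrite subr0.
by apply: filterS => z; exact: one.
Qed.

Let eta_cst x : enorm x < 4^-1 \/ 2^-1 <= enorm x ->
  exists c : R, \forall z \near x, eta z = c.
Proof.
by case=> [/near_cutoff_eq1|/near_cutoff_eq0]; [exists 1 | exists 0].
Qed.

Lemma cutoff_partial_eq0 i x : enorm x < 4^-1 \/ 2^-1 <= enorm x -> eta1 i x = 0.
Proof. by move=> /eta_cst[c H]; exact: partial_locally_cst H. Qed.

Lemma cutoff_partial2_eq0 i j x : enorm x < 4^-1 \/ 2^-1 <= enorm x -> eta2 i j x = 0.
Proof.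
move=> /eta_cst[c H]; apply: (@partial_locally_cst _ 0).
have [A /= oA AP] : exists2 A : set 'rV[R]_d, open_nbhs x A & forall z, A z -> eta z = c.
  by move: H; rewrite /prop_near1 nbhsE => -[A oA AP]; exists A.
have : nbhs x A by exact: open_nbhs_nbhs.
apply: filterS => z Az; apply: (@partial_locally_cst _ c).
have : nbhs z A by apply: open_nbhs_nbhs; split => //; case: oA.
by apply: filterS => w; exact: AP.
Qed.

Lemma cutoff_derivatives_bounded : exists2 M : R, 0 < M &
  (forall i x, `|eta1 i x| <= M) /\ (forall i j x, `|eta2 i j x| <= M).
Proof.
have far x : 1 <= enorm x -> enorm x < 4^-1 \/ 2^-1 <= enorm x.
  by move=> x1; right; rewrite (le_trans _ x1)// invf_le1// ler1n.
have H1 i : exists C : R, forall x, `|eta1 i x| <= C.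
  apply: bounded_of_support; first exact: cutoff_continuous1.
  by move=> x /far; exact: cutoff_partial_eq0.
have H2 (ij : 'I_d * 'I_d) : exists C : R, forall x, `|eta2 ij.1 ij.2 x| <= C.
  apply: bounded_of_support; first exact: cutoff_continuous2.
  by move=> x /far; exact: cutoff_partial2_eq0.
have [B1 B1P] := choice H1; have [B2 B2P] := choice H2.
have s1 : 0 <= \sum_i `|B1 i| by exact: sumr_ge0.
have s2 : 0 <= \sum_ij `|B2 ij| by exact: sumr_ge0.
exists (1 + \sum_i `|B1 i| + \sum_ij `|B2 ij|); first by rewrite -addrA ltr_pwDl// addr_ge0.
split=> [i x|i j x].
  rewrite (le_trans (B1P i x))// (le_trans (ler_norm _))//.
  rewrite (bigD1 i)//= in s1 *.
  have : 0 <= \sum_(k | k != i) `|B1 k| by exact: sumr_ge0.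
  by move: s2 (normr_ge0 (B1 i)); lra.
rewrite (le_trans (B2P (i, j) x))// (le_trans (ler_norm _))//.
rewrite (bigD1 (i, j))//= in s2 *.
have : 0 <= \sum_(k | k != (i, j)) `|B2 k| by exact: sumr_ge0.
by move: s1; lra.
Qed.

(** The cut-off is nonnegative with bounded second derivatives, so
    [sqr_derive_le] applies on every coordinate line. *)
Lemma cutoff_gradient_sqr (M : R) i x : 0 < M -> (forall x, `|eta2 i i x| <= M) ->
  eta1 i x ^+ 2 <= 4 * M * eta x.
Proof.
move=> M0 MP; have [_ _ _ _ rng] := heta.
have := @sqr_derive_le (fun k => eta (k *: evec i + x)) (fun k => eta1 i (k *: evec i + x))
  (fun k => eta2 i i (k *: evec i + x)) M 0 M0.
rewrite scale0r add0r; apply.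
- move=> k; apply: (is_derive_line eta x (evec i) k _).1.
  by apply: derivableP; exact: cutoff_derivable.
- move=> k; apply: (is_derive_line (eta1 i) x (evec i) k _).1.
  by apply: derivableP; exact: cutoff_derivable2.
- by move=> k; have /andP[] := rng (k *: evec i + x).
- by move=> k; exact: MP.
Qed.

End cutoff_facts.

(** * The weighted monotonicity formula *)

Section weighted_monotonicity.
Context {R : realType} {d : nat}.

Lemma is_derive_has_deriv_in (I : set R) (F : R -> R) (t l : R) :
  is_derive t 1 F l -> has_deriv_in I F t l.
Proof.
move=> /is_derive_cvg H; rewrite /has_deriv_in.
have E : (fun h => h^-1 * (F (t + h) - F t)) = (fun h : R => h^-1 * (F (h *: (1 : R) + t) - F t)).
  by apply/funext => h; rewrite /GRing.scale/= mulr1 [h + t]addrC.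
by rewrite E; apply: cvg_within_filter.
Qed.

(** The quotients of the kernel in time are dominated by one Gaussian. *)
Lemma heat_kernel_lipschitz (y : 'rV[R]_d) (s a b : R) : (0 < d)%N -> b < s ->
  exists C c : R, [/\ 0 <= C, 0 < c & forall x k k', a <= k <= b -> a <= k' <= b ->
    `|heat_kernel y s x k' - heat_kernel y s x k| <= C * gauss c y x * `|k' - k|].
Proof.
move=> d0 bs; have [C [c [C0 c0 CP]]] := @hkt_bounded _ _ y s a b d0 bs.
exists C, c; split => // x k k' kab k'ab.
apply: (@has_deriv_in_le _ [set k | k < s] (heat_kernel y s x) (hkt y s x) a b) => //.
- by move=> z /andP[_ zb]; exact: le_lt_trans bs.
- by move=> z /= zs; apply: is_derive_has_deriv_in; exact: is_derive_heat_kernel_time.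
- move=> z /= zs; apply: cvg_within_filter.
  exact: is_derive1_continuous (is_derive_heat_kernel_time y x zs).
- by move=> z zab; exact: CP.
Qed.

Unset Implicit Arguments.
Context (W : R -> R) (eps : R) (I : set R) (phi phit : 'rV[R]_d -> R -> R) (a b : R).
Context (d0 : (0 < d)%N).
Context (dW : forall s : R, is_derive s 1 W (derive1 W s)).
Context (cW' : continuous (derive1 W)).
Context (W0 : forall s, 0 <= W s).
Context (eps0 : 0 < eps).
Context (abI : forall k, a <= k <= b -> I k).
Context (perphi : periodic_on I phi) (perphit : periodic_on I phit).
Context (phi_lt1 : forall x t, I t -> `|phi x t| < 1).
Context (cphi : continuous_on I phi).
Context (dphi : forall i x t, I t -> derivable (phi^~ t) x (evec i)).
Let p i x t := partial i (phi^~ t) x.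
Let pp i j x t := partial j (partial i (phi^~ t)) x.
Context (cp : forall i, continuous_on I (p i)).
Context (dp : forall i j x t, I t -> derivable (partial i (phi^~ t)) x (evec j)).
Context (cpp : forall i j, continuous_on I (pp i j)).
Context (dphit : forall x t, I t -> has_deriv_in I (phi x) t (phit x t)).
Context (cphit : continuous_on I phit).
Context (y : 'rV[R]_d) (s t : R) (bs : b < s) (tab : a <= t <= b).
Context (f : 'rV[R]_d -> R) (bf : bdm f).
Context (pde : forall x, phit x t = (laplacian (phi^~ t) x - derive1 W (phi x t) / eps ^+ 2)
  + Num.sqrt (2 * W (phi x t)) / eps * f x).
Context (disc : forall x, eps / 2 * (\sum_i p i x t * p i x t) <= eps^-1 * W (phi x t)).
Context (w : 'rV[R]_d -> R) (w1 : 'I_d -> 'rV[R]_d -> R) (w2 : 'I_d -> 'I_d -> 'rV[R]_d -> R).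
Context (dw : forall i x, is_derive x (evec i) w (w1 i x)).
Context (dw1 : forall i j x, is_derive x (evec j) (w1 i) (w2 i j x)).
Context (bw : bdm w) (bw1 : forall i, bdm (w1 i)) (bw2 : forall i j, bdm (w2 i j)).
Context (w0 : forall x, 0 <= w x).
Context (kappa E : 'rV[R]_d -> R) (gE : gdom y E).
Context (kappa0 : forall x, 0 <= kappa x).
Context (w1_kappa : forall x, (\sum_i w1 i x * p i x t) ^+ 2 <= w x * kappa x).
Let e x := eps / 2 * (\sum_i p i x t * p i x t) + eps^-1 * W (phi x t).
Context (E_ge : forall x, heat_kernel y s x t *
  ((\sum_j w2 j j x - (\sum_i w1 i x * (x - y) 0 i) / (s - t)) * e x
   + eps * (kappa x - \sum_j \sum_i w2 i j x * p i x t * p j x t)) <= E x).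
Set Implicit Arguments.

Let ts : t < s. Proof. by case/andP: tab => _ tb; exact: le_lt_trans bs. Qed.
Let It : I t. Proof. exact: abI. Qed.
Let psi x k := w x * heat_kernel y s x k.
Let psi1 i x := w1 i x * heat_kernel y s x t + w x * hk1 y s i x t.
Let psi2 i j x := (w2 i j x * heat_kernel y s x t + w1 i x * hk1 y s j x t)
  + (w1 j x * hk1 y s i x t + w x * hk2 y s i j x t).
Let psit x := w x * hkt y s x t.

Let dpsi i x : is_derive x (evec i) (psi^~ t) (psi1 i x).
Proof. exact: is_derive_mulf (dw i x) (is_derive_heat_kernel y i x ts). Qed.

Let dpsi1 i j x : is_derive x (evec j) (psi1 i) (psi2 i j x).
Proof.
apply: is_derive_addf.
  exact: is_derive_mulf (dw1 i j x) (is_derive_heat_kernel y j x ts).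
exact: is_derive_mulf (dw j x) (is_derive_hk1 y i j x ts).
Qed.

Let gpsi k : a <= k <= b -> gdom y (psi^~ k).
Proof.
move=> /andP[_ kb]; apply: gdomMr => //; apply: gdom_heat_kernel.
exact: le_lt_trans bs.
Qed.

Let gpsi1 i : gdom y (psi1 i).
Proof.
by apply: gdomD; apply: gdomMr => //; [exact: gdom_heat_kernel | exact: gdom_hk1].
Qed.

Let gpsi2 i j : gdom y (psi2 i j).
Proof.
apply: gdomD; apply: gdomD; apply: gdomMr => //;
  by [exact: gdom_heat_kernel | exact: gdom_hk1 | exact: gdom_hk2].
Qed.

Let gpsit : gdom y psit.
Proof. by apply: gdomMr => //; exact: gdom_hkt. Qed.

Let dpsit x : h^-1 * (psi x (t + h) - psi x t)
  @[h --> within [set h | a <= t + h <= b] (0 : R)^'] --> psit x.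
Proof.
have -> : (fun h => h^-1 * (psi x (t + h) - psi x t)) =
    (fun h => w x * (h^-1 * (heat_kernel y s x (t + h) - heat_kernel y s x t))).
  by apply/funext => h; rewrite -mulrBr mulrCA.
apply: cvgM; first exact: cvg_cst.
exact: (is_derive_has_deriv_in `[a, b]%classic (is_derive_heat_kernel_time y x ts)).
Qed.

Let F k := intRd setT (fun x => psi x k * energy_density W eps phi x k).

(** The derivative of the energy and the vanishing integral of the divergence of
    the stress tensor are added, and their integrands compared by
    [monotonicity_integrand_le].  The weight [w] will be [1] or a cut-off;
    [kappa] controls the square of its gradient and [E] collects the terms with
    derivatives of [w]. *)
Lemma weighted_monotonicity : exists2 D : R,
  h^-1 * (F (t + h) - F t) @[h --> within [set h | a <= t + h <= b] (0 : R)^'] --> D &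
  D <= 2^-1 * intRd setT (fun x => psi x t * `|f x| ^+ 2 * (W (phi x t) / eps))
       + intRd setT E.
Proof.
have [Cw Cw0 CwP] := bdm_bound bw.
have [C [c [C0 c0 HK]]] := @heat_kernel_lipschitz y s a b d0 bs.
have psi_lip x k : a <= k <= b ->
    `|psi x k - psi x t| <= (Cw * C) * gauss c y x * `|k - t|.
  move=> kab; rewrite -mulrBr normrM -!mulrA ler_pM// mulrA; exact: HK.
have L := energy_derivative dW cW' eps0 abI perphi perphit phi_lt1 cphi dphi cp dp cpp
  dphit cphit tab gpsi dpsi gpsi1 c0 psi_lip dpsit.
eexists; first exact: L.
have bp i : bdm (p i ^~ t) := bdm_slab abI (cp i) (periodic_partial i perphi) tab.
have bpp i j : bdm (pp i j ^~ t) :=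
  bdm_slab abI (cpp i j) (periodic_partial j (periodic_partial i perphi)) tab.
have bphit : bdm (phit^~ t) := bdm_slab abI cphit perphit tab.
have bW : bdm (fun x => W (phi x t)) := bdm_potential dW abI phi_lt1 cphi tab.
have bW' : bdm (fun x => derive1 W (phi x t)) := bdm_comp abI phi_lt1 cphi cW' tab.
have ben := bdm_energy eps dW abI perphi phi_lt1 cphi cp tab.
have ccpp i j : continuous (partial j (partial i (phi^~ t))).
  exact: (continuous_on_space (cpp i j) It).
have S0 := intRd_stress dW eps0 (fun i x => dphi i x t It) (fun i j x => dp i j x t It)
  ccpp bW bW' bp bpp dpsi1 gpsi1 gpsi2.
have gS := gdom_stress eps0 (fun i x => dphi i x t It) (fun i j x => dp i j x t It)
  ccpp bW bW' bp bpp gpsi1 gpsi2.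
have gpt := gpsi tab.
set K := (X in intRd setT X <= _).
have gK : gdom y K.
  apply: gdomD; first apply: gdomD.
  - by apply: gdomM.
  - by apply: gdomM => //; apply: bdmM; [exact: bdm_cst | exact: bdmM].
  - apply: gdomN; apply: gdomMr; first by apply: bdmM => //; exact: bdm_cst.
    apply: gdomD; first by apply: gdom_sum => i; exact: (gdomM (gpsi1 i) (bp i)).
    by apply: gdomM => //; apply: bdm_sum => i; exact: bpp.
have gR : gdom y (fun x => psi x t * `|f x| ^+ 2 * (W (phi x t) / eps)).
  apply: gdomM; last by apply: bdmM => //; exact: bdm_cst.
  apply: gdomM => //.
  have -> : (fun x => `|f x| ^+ 2) = (fun x => f x * f x).
    by apply/funext => x; rewrite real_normK ?num_real// expr2.
  exact: bdmM.
rewrite -[leLHS]addr0 -S0 -(intRdD gK gS) -(intRdZ _ gR).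
have gR2 : gdom y (fun x => 2^-1 * (psi x t * `|f x| ^+ 2 * (W (phi x t) / eps))).
  by apply: gdomMr => //; exact: bdm_cst.
rewrite -(intRdD gR2 gE).
apply: (le_intRd (gdomD gK gS) (gdomD gR2 gE)) => x.
have tau0 : 0 < s - t by rewrite subr_gt0.
have rho0 := ltW (heat_kernel_gt0 y x ts).
have M := @monotonicity_integrand_le R d eps (W (phi x t)) (derive1 W (phi x t))
  (heat_kernel y s x t) (w x) (s - t) (phit x t) (laplacian (phi^~ t) x)
  (Num.sqrt (2 * W (phi x t)) / eps * f x) (kappa x)
  (fun i => (x - y) 0 i) (fun i => p i x t) (fun i => w1 i x) (fun i j => w2 i j x)
  eps0 tau0 rho0 (w0 x) (kappa0 x) (w1_kappa x) (disc x) (pde x).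
have EE : energy_density W eps phi x t = e x.
  rewrite energy_densityE /e; congr (_ + _); last exact: mulrC.
  rewrite mulrAC; congr (_ * _).
rewrite /K EE.
apply: (le_trans M).
rewrite lerD//.
  rewrite le_eqVlt; apply/orP; left; apply/eqP.
  rewrite exprMn expr_div_n sqr_sqrtr ?mulr_ge0// real_normK ?num_real// /psi.
  by field; rewrite gt_eqF.
Qed.

End weighted_monotonicity.

(** * The distance function *)

Section distance_function.
Context {R : realType} {d : nat}.
Unset Implicit Arguments.
Context (W q : R -> R) (eps : R) (eps0 : 0 < eps).
Context (qW : standing_wave W eps q).
Context (dW : forall s : R, is_derive s 1 W (derive1 W s)).
Set Implicit Arguments.

(** The derivative of the inverse profile. *)
Definition slope (s : R) : R := eps / Num.sqrt (2 * W s).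
Definition slope' (s : R) : R := - (eps * derive1 W s / Num.sqrt (2 * W s) ^+ 3).

Lemma sqrt_potential_gt0 s : `|s| < 1 -> 0 < Num.sqrt (2 * W s).
Proof.
by move=> s1; rewrite sqrtr_gt0 mulr_gt0//; exact: (wave_potential_gt0 eps0 qW).
Qed.

Lemma is_derive_slope (s : R) : `|s| < 1 -> is_derive s 1 slope (slope' s).
Proof.
move=> s1; have W0 : 0 < 2 * W s by rewrite mulr_gt0//; exact: (wave_potential_gt0 eps0 qW).
have D1 := is_derive_mulcf 2 (dW s).
have D2 := @is_derive_comp1 _ _ (fun s => 2 * W s) Num.sqrt s 1 _ _ (is_derive1_sqrt W0) D1.
have q0 := sqrt_potential_gt0 s1.
have D3 := @is_deriveV R (fun s => Num.sqrt (2 * W s)) s _ 1 (lt0r_neq0 q0) D2.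
apply: (is_derive_eq (is_derive_mulcf eps D3)).
rewrite /slope' /GRing.scale/=; move: (Num.sqrt _) q0 => S S0; field.
by rewrite gt_eqF.
Qed.

Unset Implicit Arguments.
Context (f : 'rV[R]_d -> R) (f1 : forall x, `|f x| < 1).
Context (df : forall i x, derivable f x (evec i)).
Set Implicit Arguments.

Let r x := wave_inv q (f x).

(** The chain rule, with [slope] as the derivative of the inverse profile. *)
Lemma is_derive_dist i x : is_derive x (evec i) r (slope (f x) * partial i f x).
Proof.
apply: (@is_derive_comp1 _ _ f (wave_inv q)); last exact: derivableP.
exact: (is_derive_wave_inv eps0 qW (f1 x)).
Qed.

Lemma partial_dist i : partial i r = fun x => slope (f x) * partial i f x.
Proof. by apply/funext => x; have [_] := is_derive_dist i x. Qed.

Lemma is_derive_partial_dist i x : derivable (partial i f) x (evec i) ->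
  is_derive x (evec i) (partial i r)
   (slope' (f x) * partial i f x ^+ 2 + slope (f x) * partial i (partial i f) x).
Proof.
move=> ddf; rewrite partial_dist.
have D := @is_derive_comp1 _ _ f slope x (evec i) _ _ (is_derive_slope (f1 x)) (derivableP (df i x)).
apply: (is_derive_eq (is_derive_mulf D (derivableP ddf))).
by rewrite -mulrA -expr2.
Qed.

Lemma continuous_slope : continuous f -> continuous (fun x => slope (f x)).
Proof.
move=> cf x; apply: (@continuous_comp _ _ _ f slope); first exact: cf.
exact: is_derive1_continuous (is_derive_slope (f1 x)).
Qed.

Lemma grad_dist x : grad r x = slope (f x) *: grad f x.
Proof. by apply/rowP => i; rewrite !mxE partial_dist. Qed.

(** The discrepancy is a positive multiple of [|grad r|^2 - 1]. *)
Lemma discrepancy_le0 x : enorm (grad r x) <= 1 ->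
  eps / 2 * (\sum_i partial i f x * partial i f x) <= eps^-1 * W (f x).
Proof.
have W0 := wave_potential_gt0 eps0 qW (f1 x).
rewrite grad_dist => g1.
have : enorm (slope (f x) *: grad f x) ^+ 2 <= 1 by rewrite expr_le1// enorm_ge0.
rewrite sqr_enorm dotZl dotZr mulrA.
have -> : dot (grad f x) (grad f x) = \sum_i partial i f x * partial i f x.
  by apply: eq_bigr => i _; rewrite !mxE.
have -> : slope (f x) * slope (f x) = eps ^+ 2 / (2 * W (f x)).
  by rewrite -expr2 expr_div_n sqr_sqrtr// mulr_ge0// ltW.
rewrite mulrAC ler_pdivrMr ?mulr_gt0// mul1r => H.
have e2 : 0 < 2 * eps by rewrite mulr_gt0.
rewrite -(ler_pM2l e2); move: H; move: (\sum_i _) (W (f x)) => S w H.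
have -> : 2 * eps * (eps / 2 * S) = eps ^+ 2 * S by field.
have -> : 2 * eps * (eps^-1 * w) = 2 * w by field; rewrite gt_eqF.
exact: H.
Qed.

(** The factor [q'(r)] is common to all terms and cancels.  Since the profile
    solves a first-order equation, its second derivative is a function of the
    profile, and it enters only through the multiple of [|grad r|^2 - 1]. *)
Lemma phase_field_dist (phit g L : R) (u : 'rV[R]_d) x :
  (forall i, derivable (partial i f) x (evec i)) ->
  eps * phit = eps * laplacian f x - derive1 W (f x) / eps - eps * dot u (grad f x)
    - (g + L * r x) * Num.sqrt (2 * W (f x)) ->
  slope (f x) * phit = laplacian r x
    + derive1 W (f x) / (eps * Num.sqrt (2 * W (f x))) * (enorm (grad r x) ^+ 2 - 1)
    - dot u (grad r x) - g - L * r x.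
Proof.
move=> ddf pde; have q0 := sqrt_potential_gt0 (f1 x).
have -> : laplacian r x = slope' (f x) * dot (grad f x) (grad f x) + slope (f x) * laplacian f x.
  rewrite /dot /laplacian !mulr_sumr -big_split/=; apply: eq_bigr => i _.
  have [_ E] := is_derive_partial_dist (ddf i).
  by rewrite [LHS]E !mxE -expr2.
rewrite sqr_enorm grad_dist dotZl !dotZr.
have e0 : eps != 0 by rewrite gt_eqF.
have -> : phit = laplacian f x - derive1 W (f x) / eps ^+ 2 - dot u (grad f x)
    - (g + L * r x) * Num.sqrt (2 * W (f x)) / eps.
  by apply: (mulfI e0); rewrite pde; field.
rewrite /slope /slope'; move: (Num.sqrt _) q0 => S S0.
move: (laplacian f x) (derive1 W _) (dot u (grad f x)) (dot (grad f x) (grad f x)) (r x) => *; field.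
by rewrite e0 gt_eqF.
Qed.

(** Isolates the part of [phi_t] driven by the energy; the factor of
    [sqrt (2 W) / eps] in the remainder is the forcing. *)
Lemma phase_field_forcing (phit g L : R) (u : 'rV[R]_d) x :
  eps * phit = eps * laplacian f x - derive1 W (f x) / eps - eps * dot u (grad f x)
    - (g + L * r x) * Num.sqrt (2 * W (f x)) ->
  phit = (laplacian f x - derive1 W (f x) / eps ^+ 2)
    + Num.sqrt (2 * W (f x)) / eps * (- dot u (grad r x) - g - L * r x).
Proof.
move=> pde; have q0 := sqrt_potential_gt0 (f1 x).
have e0 : eps != 0 by rewrite gt_eqF.
apply: (mulfI e0); rewrite pde grad_dist dotZr /slope.
move: (Num.sqrt _) q0 => S S0.
move: (laplacian f x) (derive1 W _) (dot u _) (r x) => *; field.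
by rewrite e0 gt_eqF.
Qed.

End distance_function.

Section transport_lipschitz.
Context {R : realType} {d : nat}.
Unset Implicit Arguments.
Context (T : R) (T0 : 0 < T).
Context (u : 'rV[R]_d -> R -> 'rV[R]_d) (g : 'rV[R]_d -> R -> R).
Context (peru : periodic_on `[0, T] u) (su : forall i, smooth_on `[0, T] (fun x t => u x t 0 i)).
Context (perg : periodic_on `[0, T] g) (sg : smooth_on `[0, T] g).
Set Implicit Arguments.

Let sub t : 0 < t < T -> `[0, T]%classic t.
Proof. by move=> /andP[t0 tT]; rewrite /= in_itv/= !ltW. Qed.

Lemma periodic_coord i : periodic_on `[0, T] (fun x t => u x t 0 i).
Proof. by move=> x t k It; rewrite peru. Qed.

Let uder i j : [/\ forall x t, `[0, T]%classic t -> derivable (fun z => u z t 0 i) x (evec j),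
  continuous_on `[0, T] (fun x t => partial j (fun z => u z t 0 i) x) &
  periodic_on `[0, T] (fun x t => partial j (fun z => u z t 0 i) x)].
Proof.
have [_ [/(_ j)[H1 [H2 _]] _]] := su i 1%N; split => //.
exact: (periodic_partial j (periodic_coord i)).
Qed.

Let gder j : [/\ forall x t, `[0, T]%classic t -> derivable (g^~ t) x (evec j),
  continuous_on `[0, T] (fun x t => partial j (g^~ t) x) &
  periodic_on `[0, T] (fun x t => partial j (g^~ t) x)].
Proof.
have [_ [/(_ j)[H1 [H2 _]] _]] := sg 1%N; split => //.
exact: (periodic_partial j perg).
Qed.

Let supu := sup [set a | exists (x : 'rV[R]_d) (t : R), 0 < t < T /\ a = jac_norm u x t].
Let supg := sup [set a | exists (x : 'rV[R]_d) (t : R), 0 < t < T /\ a = enorm (grad (g^~ t) x)].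

(** The supremum is finite: the entries of the Jacobian are continuous and
    periodic up to the end points of the time interval. *)
Lemma jac_norm_le_sup x t : 0 < t < T -> jac_norm u x t <= supu.
Proof.
move=> t0T; apply: ub_le_sup; last by exists x, t.
have H (ij : 'I_d * 'I_d) : exists C : R, forall x t, 0 <= t <= T ->
    `|partial ij.2 (fun z => u z t 0 ij.1) x| <= C.
  by have [_ c p] := uder ij.1 ij.2; exact: periodic_bounded.
have [B BP] := choice H.
exists (Num.sqrt (\sum_i \sum_j B (i, j) ^+ 2)) => _ [z [k [/andP[k0 kT] ->]]].
rewrite ler_sqrt; last by apply: sumr_ge0 => i _; apply: sumr_ge0 => j _; exact: sqr_ge0.
apply: ler_sum => i _; apply: ler_sum => j _.
rewrite -[leLHS]real_normK ?num_real//.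
have kk : 0 <= k <= T by rewrite !ltW.
have /= H1 := BP (i, j) z k kk.
by rewrite ler_pXn2r ?nnegrE ?normr_ge0// (le_trans _ H1).
Qed.

Lemma grad_norm_le_sup x t : 0 < t < T -> enorm (grad (g^~ t) x) <= supg.
Proof.
move=> t0T; apply: ub_le_sup; last by exists x, t.
have H j : exists C : R, forall x t, 0 <= t <= T -> `|partial j (g^~ t) x| <= C.
  by have [_ c p] := gder j; exact: periodic_bounded.
have [B BP] := choice H.
exists (Num.sqrt (\sum_j B j ^+ 2)) => _ [z [k [/andP[k0 kT] ->]]].
rewrite ler_sqrt; last by apply: sumr_ge0 => i _; exact: sqr_ge0.
apply: ler_sum => j _; rewrite mxE -expr2 -[leLHS]real_normK ?num_real//.
have kk : 0 <= k <= T by rewrite !ltW.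
have H1 := BP j z k kk.
by rewrite ler_pXn2r ?nnegrE ?normr_ge0// (le_trans _ H1).
Qed.

Let supu_ge0 : 0 <= supu.
Proof.
have t2 : 0 < T / 2 < T by rewrite divr_gt0//= ltr_pdivrMr// ltr_pMr// ltr1n.
exact: le_trans (sqrtr_ge0 _) (jac_norm_le_sup 0 t2).
Qed.

Let supg_ge0 : 0 <= supg.
Proof.
have t2 : 0 < T / 2 < T by rewrite divr_gt0//= ltr_pdivrMr// ltr_pMr// ltr1n.
exact: le_trans (sqrtr_ge0 _) (grad_norm_le_sup 0 t2).
Qed.

Lemma Lconst_ge0 : 0 <= Lconst T u g.
Proof. by rewrite /Lconst addr_ge0// mulr_ge0. Qed.

(** The operator norm of a matrix is at most its Frobenius norm. *)
Lemma jacobian_le (v e : 'rV[R]_d) x t :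
  `|\sum_k e 0 k * dot (grad (fun z => u z t 0 k) x) v| <= enorm e * (jac_norm u x t * enorm v).
Proof.
pose w : 'rV[R]_d := \row_k dot (grad (fun z => u z t 0 k) x) v.
have -> : \sum_k e 0 k * dot (grad (fun z => u z t 0 k) x) v = dot e w.
  by apply: eq_bigr => k _; rewrite mxE.
rewrite (le_trans (cauchy_schwarz _ _))// ler_wpM2l ?enorm_ge0//.
have J0 : 0 <= jac_norm u x t by exact: sqrtr_ge0.
rewrite -(@ler_pXn2r _ 2)// ?nnegrE ?mulr_ge0 ?enorm_ge0// exprMn !sqr_enorm.
rewrite /jac_norm sqr_sqrtr; last first.
  by apply: sumr_ge0 => i _; apply: sumr_ge0 => j _; exact: sqr_ge0.
rewrite mulr_suml; apply: ler_sum => k _.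
rewrite mxE -expr2 (le_trans (cauchy_schwarz_sqr _ _))// ler_wpM2r ?dot_ge0//.
by rewrite /dot; apply: ler_sum => j _; rewrite !mxE expr2.
Qed.

(** This is what the constant [Lconst] is made for: it dominates the growth of
    the Lipschitz constant caused by the transport field and the forcing. *)
Lemma transport_lipschitz x y e t : 0 < t < T -> enorm e = 1 ->
  dot (u y t - u x t) e + (g y t - g x t) <= Lconst T u g * enorm (x - y).
Proof.
move=> t0T e1; have It := sub t0T.
have Du k z : is_derive z (y - x) (fun z => u z t 0 k) (dot (grad (fun z => u z t 0 k) z) (y - x)).
  apply: is_derive_grad => [i w|i]; first by have [H _ _] := uder k i; exact: H.
  by have [_ H _] := uder k i; exact: (continuous_on_space H It).
have Dg z : is_derive z (y - x) (g^~ t) (dot (grad (g^~ t) z) (y - x)).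
  apply: is_derive_grad => [i w|i]; first by have [H _ _] := gder i; exact: H.
  by have [_ H _] := gder i; exact: (continuous_on_space H It).
have D z : is_derive z (y - x) (fun z => \sum_k e 0 k * u z t 0 k)
    (\sum_k e 0 k * dot (grad (fun z => u z t 0 k) z) (y - x)).
  by apply: is_derive_sumf => k; exact: is_derive_mulcf.
have [c1 _] := MVT_line x 1 D; rewrite scale1r subrK mul1r => E1.
have [c2 _] := MVT_line x 1 Dg; rewrite scale1r subrK mul1r => E2.
have -> : dot (u y t - u x t) e = \sum_k e 0 k * u y t 0 k - \sum_k e 0 k * u x t 0 k.
  by rewrite -sumrB; apply: eq_bigr => k _; rewrite !mxE; ring.
rewrite E1 E2 /Lconst mulrDl; have n0 := enorm_ge0 (y - x).
have -> : enorm (x - y) = enorm (y - x) by rewrite -enormN opprB.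
apply: lerD.
  rewrite (le_trans (ler_norm _))// (le_trans (jacobian_le _ _ _ _))// e1 mul1r.
  rewrite ler_wpM2r// (le_trans (jac_norm_le_sup _ t0T))// -/supu.
  by rewrite mulr_natl mulr2n lerDl.
rewrite (le_trans (ler_norm _))// (le_trans (cauchy_schwarz _ _))// ler_wpM2r//.
exact: grad_norm_le_sup.
Qed.

End transport_lipschitz.

(** * The gradient bound for the phase field *)

Section phase_field.
Context {R : realType} {d : nat}.
Unset Implicit Arguments.
Context (W : R -> R) (q : R -> R) (T eps : R) (T0 : 0 < T) (eps0 : 0 < eps).
Context (qW : standing_wave W eps q).
Context (dW : forall s : R, is_derive s 1 W (derive1 W s)).
Context (cW' : continuous (derive1 W)).
Context (u : 'rV[R]_d -> R -> 'rV[R]_d) (g phi : 'rV[R]_d -> R -> R) (phi0 : 'rV[R]_d -> R).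
Context (peru : periodic_on `[0, T] u) (su : forall i, smooth_on `[0, T] (fun x t => u x t 0 i)).
Context (perg : periodic_on `[0, T] g) (sg : smooth_on `[0, T] g).
Let L := Lconst T u g.
Let r := dist_fun q phi.
Let f := forcing u g L r.
Context (sol : classical_solution W eps T u g L r phi phi0).
Context (init : forall x, differentiable (r^~ 0) x /\ enorm (grad (r^~ 0) x) <= 1).
Set Implicit Arguments.

Let perphi : periodic_on `[0, T[ phi. Proof. by case: sol. Qed.
Let cphi : continuous_on `[0, T[ phi. Proof. by case: sol => _ []. Qed.
Let phi_lt1 x t : 0 <= t < T -> `|phi x t| < 1. Proof. by case: sol => _ _ H _ _; exact: H. Qed.

Let reg : C21_on `]0, T[ phi. Proof. by case: sol => _ []. Qed.

Lemma continuous_on_dist : continuous_on `[0, T[ r.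
Proof.
apply: continuous_onP => x t It.
have tT : 0 <= t < T by move: It; rewrite /= in_itv.
set G := within _ _.
have FG : Filter G by exact: within_filter.
have G1 : p @[p --> G] --> (x, t) by exact: cvg_within.
have px : p.1 @[p --> G] --> x by apply: (cvg_comp _ _ G1); exact: cvg_fst.
have pt : p.2 @[p --> G] --> t by apply: (cvg_comp _ _ G1); exact: cvg_snd.
have GI : \forall p \near G, `[0, T[%classic p.2.
  by rewrite /G near_withinE; apply: nearW => -[? ?] [_ /= H].
have H := @continuous_on_cvg _ _ _ _ _ G FG _ _ x t cphi It px pt GI.
have C := is_derive1_continuous (is_derive_wave_inv eps0 qW (phi_lt1 x tT)).
exact: (cvg_comp (fun p => phi p.1 p.2) (wave_inv q) H C).
Qed.

Lemma periodic_dist : periodic_on `[0, T[ r.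
Proof. by move=> x t k It; rewrite /r /dist_fun perphi. Qed.

Let slice t : 0 < t < T ->
  (forall i x, derivable (phi^~ t) x (evec i)) /\
  (forall i j x, derivable (partial i (phi^~ t)) x (evec j)).
Proof.
move=> tT; have It : `]0, T[%classic t by rewrite /= in_itv.
have [_ H1 H2 _] := reg; split => [i x|i j x].
  by have [H _] := H1 i; exact: H.
by have [H _] := H2 i j; exact: H.
Qed.

Let dtime x t : 0 < t < T -> is_derive t 1 (phi x) (derive1 (phi x) t).
Proof.
move=> tT; have It : `]0, T[%classic t by rewrite /= in_itv.
have [_ _ _ [ft dft _]] := reg.
have D : is_derive t 1 (phi x) (ft x t).
  by apply: (has_deriv_in_interior tT _ (dft x t It)) => k kT; rewrite /= in_itv.
by case: D => D1 D2; split => //; rewrite derive1E.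
Qed.

Let ge0lt t : 0 < t < T -> 0 <= t < T. Proof. by case/andP => /ltW -> ->. Qed.

(** The two-point maximum principle for the equation of the distance function;
    the gradient bound at the initial time starts it. *)
Lemma dist_lipschitz x y t : 0 <= t < T -> r x t - r y t <= enorm (x - y).
Proof.
move=> tT.
have pde x' t' : 0 < t' < T -> eps * derive1 (phi x') t' = eps * laplacian (phi^~ t') x'
    - derive1 W (phi x' t') / eps - eps * dot (u x' t') (grad (phi^~ t') x')
    - (g x' t' + L * r x' t') * Num.sqrt (2 * W (phi x' t')).
  by move=> H; case: sol => _ _ _ E _; rewrite E.
have dist_t x' t' : 0 < t' < T ->
    is_derive t' 1 (r x') (slope W eps (phi x' t') * derive1 (phi x') t').
  move=> H; apply: (@is_derive_comp1 _ _ (phi x') (wave_inv q)); last exact: dtime.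
  exact: (is_derive_wave_inv eps0 qW (phi_lt1 _ (ge0lt H))).
apply: (@lipschitz_preserved _ _ r
  (fun x t => slope W eps (phi x t) * derive1 (phi x) t) g
  (fun x t => derive1 W (phi x t) / (eps * Num.sqrt (2 * W (phi x t)))) u T L) => //.
- exact: continuous_on_dist.
- exact: periodic_dist.
- move=> i x' t' H; have [d1 _] := slice H.
  have [D _] := is_derive_dist eps0 qW (fun x => phi_lt1 x (ge0lt H)) d1 i x'.
  exact: D.
- move=> i x' t' H; have [d1 d2] := slice H.
  have [D _] := is_derive_partial_dist eps0 qW dW (fun x => phi_lt1 x (ge0lt H)) d1 (d2 i i x').
  exact: D.
- move=> x' t' H; have [d1 d2] := slice H.
  apply: (phase_field_dist eps0 qW dW (fun x => phi_lt1 x (ge0lt H)) d1) => //.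
  exact: pde.
- exact: Lconst_ge0.
- by move=> x' y' e t' H e1; exact: transport_lipschitz.
- by apply: grad_le1_lipschitz => z; have [] := init z.
Qed.

Lemma dist_grad_le1 x t : 0 <= t < T -> enorm (grad (r^~ t) x) <= 1.
Proof.
move=> /[dup] tT /andP[]; rewrite le_eqVlt => /predU1P[<- _|t0 t1].
  by have [] := init x.
have H : 0 < t < T by rewrite t0.
have [d1 d2] := slice H; have It : `]0, T[%classic t by rewrite /= in_itv.
have f1 z : `|phi z t| < 1 by exact: phi_lt1.
apply: lipschitz_grad_le1.
- by move=> i z; have [D _] := is_derive_dist eps0 qW f1 d1 i z; exact: D.
- move=> i; have [c0 /(_ i)[_ ci] _ _] := reg.
  have E : partial i (r^~ t) = _ := partial_dist eps0 qW f1 d1 i.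
  have c1 := continuous_slope eps0 qW dW f1 (continuous_on_space c0 It).
  rewrite E => z; exact: (continuousM (c1 z) (@continuous_on_space _ _ _ _ _ ci It z)).
- by move=> z z'; exact: dist_lipschitz.
Qed.

(** The equation extends by continuity to the initial time when the solution
    is regular up to it. *)
Lemma phase_field_eq_on (I : set R) (phit : 'rV[R]_d -> R -> R) x t :
  (forall k, I k -> 0 <= k < T) -> (forall k, 0 < k < T -> I k) -> I t ->
  (forall i, continuous_on I (fun x t => partial i (phi^~ t) x)) ->
  (forall i j, continuous_on I (fun x t => partial j (partial i (phi^~ t)) x)) ->
  (forall x t, I t -> has_deriv_in I (phi x) t (phit x t)) -> continuous_on I phit ->
  eps * phit x t = eps * laplacian (phi^~ t) x
    - derive1 W (phi x t) / eps - eps * dot (u x t) (grad (phi^~ t) x)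
    - (g x t + L * r x t) * Num.sqrt (2 * W (phi x t)).
Proof.
move=> IT TI It cp cpp dphit cphit.
pose res k := eps * phit x k - (eps * laplacian (phi^~ k) x
    - derive1 W (phi x k) / eps - eps * dot (u x k) (grad (phi^~ k) x)
    - (g x k + L * r x k) * Num.sqrt (2 * W (phi x k))).
have interior k : 0 < k < T -> res k = 0.
  move=> kT; apply/eqP; rewrite subr_eq0; apply/eqP.
  have D : is_derive k 1 (phi x) (phit x k).
    by apply: (@has_deriv_in_interior _ I _ k _ 0 T) => //; apply: dphit; exact: TI.
  have <- : derive1 (phi x) k = phit x k by rewrite derive1E; case: D.
  by case: sol => _ _ _ E _; rewrite E.
apply/eqP; rewrite -subr_eq0 -/(res t); apply/eqP.
have := IT t It => /andP[]; rewrite le_eqVlt => /predU1P[t0 _|t0 tT]; last first.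
  by apply: interior; rewrite t0.
rewrite -t0 in It *.
have idc : k @[k --> (0 : R)^'+] --> (0 : R) by exact: cvg_within.
have nearT : \forall k \near (0 : R)^'+, 0 < k < T.
  near=> k; apply/andP; split; first by near: k; exact: nbhs_right_gt.
  by near: k; exact: nbhs_right_lt.
have nI : \forall k \near (0 : R)^'+, I k by apply: filterS nearT => k; exact: TI.
have nT : \forall k \near (0 : R)^'+, `[0, T]%classic k.
  by apply: filterS nearT => k /andP[a b]; rewrite /= in_itv/= !ltW.
have nT' : \forall k \near (0 : R)^'+, `[0, T[%classic k.
  by apply: filterS nearT => k /andP[a b]; rewrite /= in_itv/= b ltW.
have I0T : `[0, T]%classic (0 : R) by rewrite /= in_itv/= lexx ltW.
have I0T' : `[0, T[%classic (0 : R) by rewrite /= in_itv/= lexx.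
have cx : (fun=> x) k @[k --> (0 : R)^'+] --> x by exact: cvg_cst.
have lim (J : set R) (h : 'rV[R]_d -> R -> R) : continuous_on J h -> J 0 ->
    (\forall k \near (0 : R)^'+, J k) -> h x k @[k --> (0 : R)^'+] --> h x 0.
  by move=> ch J0 nJ; exact: (continuous_on_cvg ch J0 cx idc nJ).
have lphi := lim _ _ cphi I0T' nT'.
(* The defect of the equation is continuous at the initial time and vanishes
   at all later times. *)
have c0 : res k @[k --> (0 : R)^'+] --> res 0.
  apply: cvgB; first by apply: cvgM; [exact: cvg_cst | exact: (lim _ _ cphit It nI)].
  apply: cvgB; first apply: cvgB; first apply: cvgB.
  - apply: cvgM; first exact: cvg_cst.
    by apply: cvg_sumr => i; exact: (lim _ _ (cpp i i) It nI).
  - apply: cvgM; last exact: cvg_cst.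
    by apply: (cvg_comp (phi x) (derive1 W) lphi); exact: cW'.
  - apply: cvgM; first exact: cvg_cst.
    apply: cvg_sumr => i; apply: cvgM.
      by apply: (lim _ (fun x t => u x t 0 i) _ I0T nT); have [] := su i 0%N.
    rewrite mxE; under eq_fun do rewrite mxE.
    exact: (lim _ _ (cp i) It nI).
  - apply: cvgM.
      apply: cvgD; first by apply: (lim _ g _ I0T nT); have [] := sg 0%N.
      apply: cvgM; first exact: cvg_cst.
      exact: (lim _ _ continuous_on_dist I0T' nT').
    apply: (cvg_comp (phi x) (fun s => Num.sqrt (2 * W s)) lphi).
    apply: (@continuous_comp _ _ _ (fun s => 2 * W s) Num.sqrt); last exact: sqrt_continuous.
    by apply: continuousM; [exact: cst_continuous | exact: is_derive1_continuous (dW _)].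
have res_cvg0 : res k @[k --> (0 : R)^'+] --> (0 : R).
  have z0 : (fun=> 0 : R) k @[k --> (0 : R)^'+] --> (0 : R) by exact: cvg_cst.
  apply: cvg_trans z0; apply: near_eq_cvg.
  by apply: filterS nearT => k kT; rewrite interior.
exact: (cvg_unique _ c0 res_cvg0).
Unshelve. all: by end_near. Qed.

End phase_field.

(** * The error caused by the cut-off *)

Section cutoff_error.
Context {R : realType} {d : nat}.

Lemma norm_sum_le (F : 'I_d -> R) (M : R) : (forall i, `|F i| <= M) -> `|\sum_i F i| <= d%:R * M.
Proof.
move=> FM; apply: (le_trans (ler_norm_sum _ _ _)).
apply: (@le_trans _ _ (\sum_(i < d) M)); first exact: ler_sum.
by rewrite sumr_const card_ord mulr_natl.
Qed.

(** By [2 |a b| <= a^2 + b^2] in every entry. *)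
Lemma quadratic_form_bound (A : 'I_d -> 'I_d -> R) (p : 'I_d -> R) (M : R) :
  (forall i j, `|A i j| <= M) ->
  - \sum_j \sum_i A i j * p i * p j <= M * (d%:R * \sum_i p i * p i).
Proof.
move=> AM.
have H i j : - (A i j * p i * p j) <= M / 2 * (p i * p i) + M / 2 * (p j * p j).
  have M0 : 0 <= M by exact: le_trans (normr_ge0 _) (AM i j).
  have h : - (A i j * p i * p j) <= M * `|p i * p j|.
    rewrite -mulrA (le_trans (ler_norm _))// normrN normrM ler_wpM2r//.
  apply: (le_trans h); rewrite -mulrDr -mulrA ler_wpM2l//.
  rewrite normrM -[p i * p i]expr2 -[p j * p j]expr2.
  rewrite -(real_normK (num_real (p i))) -(real_normK (num_real (p j))).
  have := sqr_ge0 (`|p i| - `|p j|); rewrite sqrrB; move: `|p i| `|p j| => a b; lra.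
have -> : - \sum_j \sum_i A i j * p i * p j = \sum_j \sum_i - (A i j * p i * p j).
  by rewrite -sumrN; apply: eq_bigr => j _; rewrite -sumrN.
apply: (@le_trans _ _ (\sum_(j < d) \sum_(i < d) (M / 2 * (p i * p i) + M / 2 * (p j * p j)))).
  by apply: ler_sum => j _; apply: ler_sum => i _; exact: H.
under eq_bigr do rewrite big_split/= sumr_const card_ord -mulr_sumr.
rewrite big_split/= sumr_const card_ord sumrMnl -mulr_sumr -mulrnDl.
by rewrite -[(_ + _) *+ d]mulr_natl le_eqVlt; apply/orP; left; apply/eqP; field.
Qed.

(** The constant is found by adding up: the Laplacian of the cut-off gives
    [d M e], the first-order term [d M e / tau], the square of the gradient
    [8 d M e], and the Hessian [2 d M e], the last two because
    [eps |grad phi|^2 <= 2 e]. *)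
Lemma cutoff_error_le (W2 : 'I_d -> 'I_d -> R) (w1 z p : 'I_d -> R) (M tau eps e : R) :
  0 < eps -> 0 < tau -> 0 <= e -> 0 <= M ->
  (forall i j, `|W2 i j| <= M) -> (forall i, `|w1 i| <= M) -> (forall i, `|z i| <= 1) ->
  eps / 2 * (\sum_i p i * p i) <= e ->
  (\sum_j W2 j j - (\sum_i w1 i * z i) / tau) * e
    + eps * (4 * d%:R * M * (\sum_i p i * p i) - \sum_j \sum_i W2 i j * p i * p j)
  <= 11 * d%:R * M * ((1 + tau^-1) * e).
Proof.
move=> eps0 tau0 e0 M0 W2M w1M z1 pe.
have h1 : \sum_j W2 j j <= d%:R * M.
  by rewrite (le_trans (ler_norm _))// norm_sum_le// => i; exact: W2M.
have h2 : - (\sum_i w1 i * z i) <= d%:R * M.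
  rewrite (le_trans (ler_norm _))// normrN norm_sum_le// => i.
  by rewrite normrM -[leRHS]mulr1 ler_pM.
have h3 := quadratic_form_bound p W2M.
set S := \sum_i p i * p i in pe h3 *; move: h1 h2 h3.
move: (\sum_j W2 j j) (\sum_i w1 i * z i) (\sum_j \sum_i _) => a b c h1 h2 h3.
have D0 : 0 <= d%:R * M by rewrite mulr_ge0.
have t0 : 0 < tau^-1 by rewrite invr_gt0.
have k1 : a * e <= d%:R * M * e by rewrite ler_wpM2r.
have k2 : - b * tau^-1 * e <= d%:R * M * tau^-1 * e by rewrite ler_wpM2r// ler_wpM2r// ltW.
have k3 : eps * - c <= eps * (M * (d%:R * S)) by rewrite ler_wpM2l// ltW.
have k4 : d%:R * M * (eps / 2 * S) <= d%:R * M * e by rewrite ler_wpM2l.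
have k5 : 0 <= d%:R * M * tau^-1 * e by rewrite !mulr_ge0// ltW.
have -> : 11 * d%:R * M * ((1 + tau^-1) * e) =
    11 * (d%:R * M * e) + 11 * (d%:R * M * tau^-1 * e).
  by move: (d%:R : R) => D; ring.
have -> : (a - b / tau) * e + eps * (4 * d%:R * M * S - c)
  = a * e + (- b * tau^-1 * e) + 8 * (d%:R * M * (eps / 2 * S)) + eps * - c.
  by move: (d%:R : R) => D; field; rewrite gt_eqF.
have E : eps * (M * (d%:R * S)) = 2 * (d%:R * M * (eps / 2 * S)).
  by move: (d%:R : R) => D; field.
rewrite E in k3; move: k1 k2 k3 k4 k5.
move: (a * e) (- b * tau^-1 * e) (eps * - c) (d%:R * M * (eps / 2 * S)) (d%:R * M * e)
  (d%:R * M * tau^-1 * e) => A1 A2 A3 A4 A5 A6.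
lra.
Qed.

(** On the ball of radius [1/2] the Gaussian of rate [1] is at least [exp (-1)]. *)
Lemma gdom_indicator_eball (y : 'rV[R]_d) f : bdm f -> gdom y (f \_ (eball y 2^-1)).
Proof.
move=> bf; have [C C0 fC] := bdm_bound bf.
have mB : measurable (@vec R d @^-1` eball y 2^-1).
  have := @continuous_mRd _ _ _ (continuous_edist (w := y)) measurableT _
    (measurable_itv `]-oo, 2^-1[%R).
  by rewrite setTI; congr measurable.
have E z : (f \_ (eball y 2^-1)) (vec z) =
    ((fun z => f (vec z)) \_ (@vec R d @^-1` eball y 2^-1)) z.
  by rewrite !patchE; congr (if _ then _ else _); apply/asboolP/asboolP; rewrite !inE.
split.
  have -> : mRd (f \_ (eball y 2^-1)) =
      measurable_fun setT ((fun z => f (vec z)) \_ (@vec R d @^-1` eball y 2^-1)).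
    by congr measurable_fun; exact/funext.
  by apply/(measurable_restrictT _ mB); exact: measurable_funTS bf.1.
exists (C * expR 1), 1; split => // x; rewrite patchE; case: ifPn; last first.
  by rewrite normr0 => _; rewrite mulr_ge0// ?mulr_ge0// ?expR_ge0.
rewrite inE /eball/= => xy.
have x1 : dot (x - y) (x - y) <= 1.
  by rewrite -sqr_enorm expr_le1// ?enorm_ge0// (le_trans (ltW xy))// invf_le1// ler1n.
rewrite (le_trans (fC x))// -mulrA -[leLHS]mulr1 ler_wpM2l// -expRD -[leLHS]expR0 ler_expR.
by rewrite mul1r subr_ge0.
Qed.

End cutoff_error.

(** * Monotonicity for the energy measure *)

Section energy_measure.
Context {R : realType} {d : nat}.
Unset Implicit Arguments.
Context (d0 : (0 < d)%N).
Context (W : R -> R) (q : R -> R) (T eps : R) (T0 : 0 < T) (eps0 : 0 < eps).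
Context (qW : standing_wave W eps q).
Context (dW : forall s : R, is_derive s 1 W (derive1 W s)).
Context (cW' : continuous (derive1 W)).
Context (W0 : forall s, 0 <= W s).
Context (u : 'rV[R]_d -> R -> 'rV[R]_d) (g phi : 'rV[R]_d -> R -> R) (phi0 : 'rV[R]_d -> R).
Context (peru : periodic_on `[0, T] u) (su : forall i, smooth_on `[0, T] (fun x t => u x t 0 i)).
Context (perg : periodic_on `[0, T] g) (sg : smooth_on `[0, T] g).
Let L := Lconst T u g.
Let r := dist_fun q phi.
Let f := forcing u g L r.
Let sigma := surface_tension W.
Context (sol : classical_solution W eps T u g L r phi phi0).
Context (init : forall x, differentiable (r^~ 0) x /\ enorm (grad (r^~ 0) x) <= 1).
Context (y : 'rV[R]_d) (t s : R) (t0 : 0 <= t) (ts : t < s) (sT : s < T).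
Context (reg0 : t = 0 -> C21_on `[0, T[ phi).
Set Implicit Arguments.

Let tT : 0 <= t < T. Proof. by rewrite t0 (lt_trans ts). Qed.
Let phi_lt1 x k : 0 <= k < T -> `|phi x k| < 1.
Proof. by case: sol => _ _ H _ _; exact: H. Qed.

(** Regularity up to the initial time is available when [t = 0], and only at
    positive times when [t > 0].  Both cases are treated at once by an interval
    [I] of regularity and a compact part of it, between [a] and [b], which
    contains all nonnegative times near [t]. *)
Let regular_slab : exists (I : set R) (a b : R),
  [/\ C21_on I phi, (forall k, I k -> 0 <= k < T), (forall k, 0 < k < T -> I k),
      (forall k, a <= k <= b -> I k) & a <= t <= b /\ b < s] /\
  \forall h \near (0 : R)^', 0 <= t + h < s -> a <= t + h <= b.
Proof.
have small (e : R) : 0 < e -> \forall h \near (0 : R)^', `|h| <= e by exact: dnbhs0_le.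
have [tp|tn] := ltP 0 t.
  exists `]0, T[%classic, (t / 2), ((t + s) / 2); split; last first.
    have e0 : 0 < Num.min (t / 2) ((s - t) / 2) by rewrite lt_min !divr_gt0//= subr_gt0.
    apply: filterS (small _ e0) => h; rewrite le_min !ler_norml => /andP[/andP[h1 h2] /andP[h3 h4]] _.
    by apply/andP; split; lra.
  split.
  - by case: sol => _ [].
  - by move=> k; rewrite /= in_itv/= => /andP[/ltW -> ->].
  - by move=> k kT; rewrite /= in_itv.
  - move=> k /andP[k1 k2]; rewrite /= in_itv/=.
    have hs := sT; have ht := ts; have k3 : 0 < k by apply: (lt_le_trans _ k1); rewrite divr_gt0.
    by rewrite k3/=; apply: (le_lt_trans k2); lra.
  - by have hs := ts; split; [apply/andP; split|]; lra.
have tE : t = 0 by apply/eqP; rewrite eq_le tn.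
exists `[0, T[%classic, 0, (s / 2); split; last first.
  have s0 : 0 < s by rewrite -tE.
  have e0 : 0 < s / 2 by rewrite divr_gt0.
  apply: filterS (small _ e0) => h; rewrite ler_norml tE add0r => /andP[h1 h2] /andP[h3 _].
  by rewrite h3.
split.
- exact: reg0.
- by move=> k; rewrite /= in_itv.
- by move=> k /andP[k0 kT]; rewrite /= in_itv/= kT ltW.
- move=> k /andP[k1 k2]; rewrite /= in_itv/= k1/=.
  by move: ts sT; rewrite tE => *; lra.
- by move: ts; rewrite tE => *; split; [apply/andP; split|]; lra.
Qed.

Let bdm_space (h : 'rV[R]_d -> R -> R) (J : set R) : continuous_on J h -> periodic_on J h ->
  J t -> bdm (h^~ t).
Proof.
move=> ch ph Jt; apply: (@bdm_slab _ _ J t t _ h t ch ph); last by rewrite lexx.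
by move=> k /andP[k1 k2]; have -> : k = t by apply/eqP; rewrite eq_le k1 k2.
Qed.

Let I0T : `[0, T]%classic t. Proof. by rewrite /= in_itv/= t0 ltW// (lt_trans ts). Qed.
Let I0T' : `[0, T[%classic t. Proof. by rewrite /= in_itv. Qed.

Let slice : [/\ continuous (phi^~ t), (forall i x, derivable (phi^~ t) x (evec i)) &
  forall i, continuous (partial i (phi^~ t))].
Proof.
have [I [a [b [[reg IT TI abI [tab bs]] _]]]] := regular_slab.
have It : I t by exact: abI.
have [c0 c1 _ _] := reg; split.
- exact: (continuous_on_space c0 It).
- by move=> i x; have [H _] := c1 i; exact: H.
- by move=> i; have [_ H] := c1 i; exact: (continuous_on_space H It).
Qed.

(** The gradient bound controls the transport term; the other terms are
    continuous and periodic. *)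
Lemma bdm_forcing : bdm (f^~ t).
Proof.
have [c0 d1 c1] := slice.
have f1 x : `|phi x t| < 1 by exact: phi_lt1.
have bgrad i : bdm (fun x => grad (r^~ t) x 0 i).
  split; last first.
    exists 1 => x; rewrite (le_trans (coord_le_enorm _ _))//.
    exact: (dist_grad_le1 T0 eps0 qW dW peru su perg sg sol init).
  apply: continuous_mRd; under eq_fun do rewrite mxE.
  have E : partial i (r^~ t) = _ := partial_dist eps0 qW f1 d1 i.
  have cs := continuous_slope eps0 qW dW f1 c0.
  rewrite E => z; exact: (continuousM (cs z) (c1 i z)).
have br : bdm (r^~ t).
  apply: (bdm_space _ _ I0T').
    exact: (continuous_on_dist eps0 qW sol).
  exact: (periodic_dist sol).
have bg : bdm (g^~ t) by apply: (bdm_space _ perg I0T); have [] := sg 0%N.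
have bu i : bdm (fun x => u x t 0 i).
  apply: (bdm_space (h := fun x t => u x t 0 i) _ _ I0T).
    by have [] := su i 0%N.
  exact: periodic_coord.
apply: bdmD; first apply: bdmD.
- by apply: bdmN; apply: bdm_sum => i; exact: bdmM.
- exact: bdmN.
- by apply: bdmN; apply: bdmM => //; exact: bdm_cst.
Qed.

Let e x := eps / 2 * (\sum_i partial i (phi^~ t) x * partial i (phi^~ t) x) + eps^-1 * W (phi x t).

Lemma energy_densityE' x : energy_density W eps phi x t = e x.
Proof.
rewrite energy_densityE /e; congr (_ + _); last exact: mulrC.
by rewrite mulrAC; congr (_ * _).
Qed.

Lemma energy_ge0 x : 0 <= e x.
Proof.
rewrite addr_ge0 ?mulr_ge0 ?invr_ge0 ?(ltW eps0)//.
by apply: sumr_ge0 => i _; rewrite -expr2 sqr_ge0.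
Qed.

Lemma bdm_e : bdm e.
Proof.
have [I [a [b [[[c0 c1 _ _] IT TI abI [tab bs]] _]]]] := regular_slab.
have perI : periodic_on I phi.
  by case: sol => per _ _ _ _ x k v Ik; apply: per; rewrite /= in_itv/=; exact: IT.
have cp i : continuous_on I (fun x t => partial i (phi^~ t) x) by have [] := c1 i.
have := bdm_energy eps dW abI perI (fun x k Ik => phi_lt1 x (IT k Ik)) c0 cp tab.
by congr bdm; apply/funext => x; rewrite energy_densityE'.
Qed.

Lemma sigma_ge0 : 0 <= sigma.
Proof. by apply: Rintegral_ge0 => x _; exact: sqrtr_ge0. Qed.

Lemma mu_intE k (h : 'rV[R]_d -> R) :
  mu_int W eps phi k setT h =
  intRd setT (fun x => sigma^-1 * (h x * energy_density W eps phi x k)).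
Proof. by rewrite /mu_int; congr intRd; apply/funext => x; rewrite mulrCA. Qed.

(** [weighted_monotonicity] for solutions.  The derivative there is taken within
    the compact interval between [a] and [b]; as this contains all nonnegative
    times near [t], it is the derivative relative to the times before [s]. *)
Lemma weighted_mu_monotonicity (w : 'rV[R]_d -> R) (w1 : 'I_d -> 'rV[R]_d -> R)
    (w2 : 'I_d -> 'I_d -> 'rV[R]_d -> R) (kappa E : 'rV[R]_d -> R) :
  (forall i x, is_derive x (evec i) w (w1 i x)) ->
  (forall i j x, is_derive x (evec j) (w1 i) (w2 i j x)) ->
  bdm w -> (forall i, bdm (w1 i)) -> (forall i j, bdm (w2 i j)) ->
  (forall x, 0 <= w x) -> gdom y E -> (forall x, 0 <= kappa x) ->
  (forall x, (\sum_i w1 i x * partial i (phi^~ t) x) ^+ 2 <= w x * kappa x) ->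
  (forall x, heat_kernel y s x t *
    ((\sum_j w2 j j x - (\sum_i w1 i x * (x - y) 0 i) / (s - t)) * e x
     + eps * (kappa x - \sum_j \sum_i w2 i j x * partial i (phi^~ t) x * partial j (phi^~ t) x))
     <= E x) ->
  exists2 D : R, has_deriv_in `[0, s[
      (fun k => mu_int W eps phi k setT (fun x => w x * heat_kernel y s x k)) t D &
    D <= (2 * sigma)^-1 * intRd setT (fun x => w x * heat_kernel y s x t * `|f x t| ^+ 2 *
                                            (W (phi x t) / eps))
         + sigma^-1 * intRd setT E.
Proof.
move=> dw dw1 bw bw1 bw2 w0 gE kappa0 w1k E_ge.
have [I [a [b [[[c0 c1 c2 [ft dft cft]] IT TI abI [tab bs]] nearJ]]]] := regular_slab.
have It : I t by exact: abI.
have cp i : continuous_on I (fun x t => partial i (phi^~ t) x) by have [] := c1 i.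
have dp1 i x k : I k -> derivable (phi^~ k) x (evec i) by have [H _] := c1 i; exact: H.
have cpp i j : continuous_on I (fun x t => partial j (partial i (phi^~ t)) x) by have [] := c2 i j.
have dp2 i j x k : I k -> derivable (partial i (phi^~ k)) x (evec j).
  by have [H _] := c2 i j; exact: H.
have lt1 x k : I k -> `|phi x k| < 1 by move=> Ik; apply: phi_lt1; exact: IT.
have perI : periodic_on I phi.
  by case: sol => per _ _ _ _ x k v Ik; apply: per; rewrite /= in_itv/=; exact: IT.
have pde x k : I k -> _ := fun Ik => phase_field_eq_on T0 eps0 qW dW cW' su sg sol x
  IT TI Ik cp cpp dft cft.
have perft : periodic_on I ft.
  move=> x k v Ik; have e0 : eps != 0 by rewrite gt_eqF.
  have Ik0 : `[0, T]%classic k.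
    by have /andP[a1 a2] := IT k Ik; rewrite /= in_itv/= a1 ltW.
  apply: (mulfI e0); rewrite !pde//.
  have pp i : partial i (phi^~ k) (x + map_mx intr v) = partial i (phi^~ k) x.
    exact: (periodic_partial i perI).
  have -> : laplacian (phi^~ k) (x + map_mx intr v) = laplacian (phi^~ k) x.
    apply: eq_bigr => i _.
    exact: (periodic_partial i (periodic_partial i perI)).
  have -> : grad (phi^~ k) (x + map_mx intr v) = grad (phi^~ k) x.
    by apply/rowP => i; rewrite !mxE.
  by rewrite /r /dist_fun perI// peru// perg.
have disc x : eps / 2 * (\sum_i partial i (phi^~ t) x * partial i (phi^~ t) x) <=
    eps^-1 * W (phi x t).
  apply: (discrepancy_le0 eps0 qW (fun x => lt1 x t It) (fun i x => dp1 i x t It)).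
  exact: (dist_grad_le1 T0 eps0 qW dW peru su perg sg sol init).
have pdef x : ft x t = (laplacian (phi^~ t) x - derive1 W (phi x t) / eps ^+ 2)
    + Num.sqrt (2 * W (phi x t)) / eps * f x t.
  apply: (phase_field_forcing eps0 qW (fun x => lt1 x t It) (fun i x => dp1 i x t It)).
  exact: pde.
have [D DF DE] := weighted_monotonicity d0 dW cW' W0 eps0 abI perI perft lt1 c0 dp1 cp
  dp2 cpp dft cft bs tab bdm_forcing pdef disc dw dw1 bw bw1 bw2 w0 gE kappa0 w1k E_ge.
have gI k : a <= k <= b -> gdom y (fun x => w x * heat_kernel y s x k * energy_density W eps phi x k).
  move=> kab; apply: gdomM.
    apply: gdomMr => //; apply: gdom_heat_kernel.
    by case/andP: kab => _ kb; exact: le_lt_trans bs.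
  exact: (bdm_energy eps dW abI perI lt1 c0 cp kab).
exists (sigma^-1 * D).
  have DF' : sigma^-1 * (h^-1 * (intRd setT (fun x => w x * heat_kernel y s x (t + h) *
       energy_density W eps phi x (t + h)) - intRd setT (fun x => w x * heat_kernel y s x t *
       energy_density W eps phi x t)))
       @[h --> within [set h | a <= t + h <= b] (0 : R)^'] --> sigma^-1 * D.
    by apply: cvgM; [exact: cvg_cst | exact: DF].
  have sub : h @[h --> within [set h | `[0, s[%classic (t + h)] (0 : R)^'] -->
      within [set h | a <= t + h <= b] (0 : R)^'.
    move=> P; rewrite /within/= => HP; apply: filterS2 nearJ HP => h h1 h2 h3.
    by apply/h2/h1; move: h3; rewrite /= in_itv.
  have Q := cvg_trans (cvg_app _ sub) DF'.
  apply: cvg_trans Q; apply: near_eq_cvg; rewrite near_withinE.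
  apply: filterS nearJ => h hJ; rewrite /= in_itv/= => /hJ hab.
  rewrite !mu_intE (intRdZ _ (gI _ hab)) (intRdZ _ (gI _ tab)).
  by rewrite -mulrBr mulrCA.
have s0 : 0 <= sigma^-1 by rewrite invr_ge0 sigma_ge0.
apply: (le_trans (ler_wpM2l s0 DE)).
by rewrite mulrDr invfM mulrA [sigma^-1 * 2^-1]mulrC.
Qed.


Let gdom_density h : gdom y h -> gdom y (fun x => h x * e x).
Proof. by move=> gh; exact: gdomM gh bdm_e. Qed.

(** The weight is [1], so there is no error term. *)
Lemma monotonicity : exists2 D : R, has_deriv_in `[0, s[
      (fun k => mu_int W eps phi k setT (fun x => heat_kernel y s x k)) t D &
    D <= (2 * sigma)^-1 * intRd setT (fun x => heat_kernel y s x t * `|f x t| ^+ 2 *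
                                            (W (phi x t) / eps))
      <= 2^-1 * mu_int W eps phi t setT (fun x => heat_kernel y s x t * `|f x t| ^+ 2).
Proof.
have z0 (h : 'I_d -> R) : \sum_i 0 * h i = 0 by rewrite big1// => i _; rewrite mul0r.
have [||||||||D DF DE] := @weighted_mu_monotonicity (fun=> 1) (fun _ _ => 0) (fun _ _ _ => 0)
  (fun=> 0) (fun=> 0).
- exact: bdm_cst.
- by move=> i; exact: bdm_cst.
- by move=> i j; exact: bdm_cst.
- by move=> x; exact: ler01.
- exact: gdom0.
- by [].
- by move=> x; rewrite z0 expr0n mulr0.
- move=> x; rewrite z0 mul0r big1// subrr mul0r big1 ?subrr ?mulr0 ?addr0 ?mulr0// => j _.
  by rewrite big1// => i _; rewrite !mul0r.
exists D.
  have hE : (fun k => mu_int W eps phi k setT (fun x => 1 * heat_kernel y s x k)) =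
      fun k => mu_int W eps phi k setT (fun x => heat_kernel y s x k).
    by apply/funext => k; congr mu_int; apply/funext => x; rewrite mul1r.
  by rewrite -hE.
have E0 : intRd [set: 'rV[R]_d] (fun=> 0 : R) = 0 :> R.
  rewrite -[RHS](mul0r (intRd [set: 'rV[R]_d] (fun=> 0 : R))) -(intRdZ _ (gdom0 y)).
  by congr intRd; apply/funext => x; rewrite mul0r.
move: DE; rewrite E0 mulr0 addr0; under eq_fun do rewrite mul1r.
move=> -> /=; rewrite mu_intE.
have gh : gdom y (fun x => heat_kernel y s x t * `|f x t| ^+ 2).
  apply: gdomM; first exact: gdom_heat_kernel.
  have -> : (fun x => `|f x t| ^+ 2) = fun x => f x t * f x t.
    by apply/funext => x; rewrite real_normK ?num_real.
  exact: bdmM bdm_forcing bdm_forcing.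
have gW : gdom y (fun x => heat_kernel y s x t * `|f x t| ^+ 2 * (W (phi x t) / eps)).
  apply: gdomM gh _.
  have [I [a [b [[[c0 c1 _ _] IT TI abI [tab bs]] _]]]] := regular_slab.
  apply: (@bdmM _ _ (fun x => W (phi x t)) (fun=> eps^-1)); last exact: bdm_cst.
  exact: (bdm_potential dW abI (fun x k Ik => phi_lt1 x (IT k Ik)) c0 tab).
have ge : gdom y (fun x => heat_kernel y s x t * `|f x t| ^+ 2 * energy_density W eps phi x t).
  by under eq_fun do rewrite energy_densityE'; exact: gdom_density.
rewrite (intRdZ _ ge) mulrA invfM ler_wpM2l//.
  by rewrite mulr_ge0// invr_ge0// sigma_ge0.
apply: (le_intRd gW ge) => x; rewrite ler_wpM2l//.
  by rewrite mulr_ge0 ?sqr_ge0// ltW// heat_kernel_gt0.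
by rewrite /energy_density lerDr mulr_ge0 ?invr_ge0// mulr_ge0 ?sqr_ge0// ltW.
Qed.

(** All derivatives of the cut-off vanish off the annulus between the radii [1/4]
    and [1/2], where the heat kernel is exponentially small. *)
Lemma cut_monotonicity (eta : 'rV[R]_d -> R) (M Cfar : R) : cutoff eta -> 0 < M ->
  (forall i x, `|partial i eta x| <= M) ->
  (forall i j x, `|partial j (partial i eta) x| <= M) -> 0 < Cfar ->
  (forall x, 16^-1 <= dot (x - y) (x - y) ->
    (1 + (s - t)^-1) * heat_kernel y s x t <= Cfar * expR (- (128 * (s - t))^-1)) ->
  exists2 D : R, has_deriv_in `[0, s[
      (fun k => mu_int W eps phi k setT (fun x => cut_heat_kernel eta y s x k)) t D &
    D <= (2 * sigma)^-1 * intRd setT (fun x => cut_heat_kernel eta y s x t * `|f x t| ^+ 2 *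
                                            (W (phi x t) / eps))
      + 11 * d%:R * M * Cfar * expR (- (128 * (s - t))^-1) * mu W eps phi t (eball y 2^-1).
Proof.
move=> heta M0 M1 M2 Cf0 far.
have [_ _ _ _ rng] := heta.
pose w1 i x := partial i eta (x - y); pose w2 i j x := partial j (partial i eta) (x - y).
pose ann x := (4^-1 <= enorm (x - y)) && (enorm (x - y) < 2^-1).
pose S x := \sum_i partial i (phi^~ t) x * partial i (phi^~ t) x.
pose kappa x := if ann x then 4 * d%:R * M * S x else 0.
pose A := 11 * d%:R * M * Cfar * expR (- (128 * (s - t))^-1).
have A0 : 0 <= A by rewrite !mulr_ge0 ?expR_ge0// ltW.
pose E x := A * (e \_ (eball y 2^-1)) x.
have S0 x : 0 <= S x by apply: sumr_ge0 => i _; rewrite -expr2 sqr_ge0.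
have nann x : ~~ ann x -> enorm (x - y) < 4^-1 \/ 2^-1 <= enorm (x - y).
  by rewrite negb_and -ltNge -leNgt => /orP.
have cy : continuous (fun x : 'rV[R]_d => x - y).
  by move=> x; exact: (cvgB cvg_id (cvg_cst y)).
have bsub (h : 'rV[R]_d -> R) (B : R) : continuous h -> (forall x, `|h x| <= B) ->
    bdm (fun x => h (x - y)).
  move=> ch hB; split; last by exists B => x; exact: hB.
  apply: continuous_mRd => x.
  exact: (cvg_comp _ _ (cy x) (ch (x - y))).
have gE0 : gdom y (e \_ (eball y 2^-1)) by apply: gdom_indicator_eball; exact: bdm_e.
have gE : gdom y E by apply: gdomMr gE0; exact: bdm_cst.
have E0 x : 0 <= E x.
  by rewrite mulr_ge0// patchE; case: ifP => // _; exact: energy_ge0.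
have [||||||||||D DF DE] := @weighted_mu_monotonicity (fun x => eta (x - y)) w1 w2 kappa E.
- by move=> i x; apply: is_derive_subr; apply: derivableP; exact: cutoff_derivable.
- by move=> i j x; apply: is_derive_subr; apply: derivableP; exact: cutoff_derivable2.
- apply: (bsub _ 1); first exact: cutoff_continuous.
  by move=> x; have /andP[a b] := rng x; rewrite ger0_norm.
- by move=> i; apply: (bsub _ M) => //; exact: cutoff_continuous1.
- by move=> i j; apply: (bsub _ M) => //; exact: cutoff_continuous2.
- by move=> x; have /andP[] := rng (x - y).
- exact: gE.
- by move=> x; rewrite /kappa; case: ifP => // _; rewrite !mulr_ge0// ltW.
- move=> x; rewrite /kappa; case: ifPn => [_|/nann xy]; last first.
    rewrite mulr0 big1 ?expr0n// => i _.
    by rewrite /w1 (cutoff_partial_eq0 heta i xy) mul0r.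
  have -> : \sum_i w1 i x * partial i (phi^~ t) x
      = dot (\row_i w1 i x) (grad (phi^~ t) x).
    by apply: eq_bigr => i _; rewrite !mxE.
  apply: (le_trans (cauchy_schwarz_sqr _ _)).
  have -> : dot (grad (phi^~ t) x) (grad (phi^~ t) x) = S x.
    by apply: eq_bigr => i _; rewrite !mxE.
  rewrite [leRHS]mulrA ler_wpM2r//.
  have -> : eta (x - y) * (4 * d%:R * M) = \sum_(i < d) 4 * M * eta (x - y).
    by rewrite sumr_const card_ord -mulr_natl; ring.
  apply: ler_sum => i _; rewrite !mxE -expr2.
  exact: cutoff_gradient_sqr.
- move=> x; rewrite /kappa; case: ifPn => [/andP[x4 x2]|/nann xy]; last first.
    apply: le_trans (E0 x).
    rewrite big1 => [|j _]; last exact: cutoff_partial2_eq0.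
    rewrite big1 => [|i _]; last by rewrite /w1 (cutoff_partial_eq0 heta i xy) mul0r.
    rewrite big1 => [|j _]; last first.
      by rewrite big1// => i _; rewrite /w2 (cutoff_partial2_eq0 heta i j xy) !mul0r.
    by rewrite mul0r !subrr mul0r mulr0 addr0 mulr0.
  have st0 : 0 < s - t by rewrite subr_gt0.
  have H : eps / 2 * S x <= e x by rewrite lerDl mulr_ge0// invr_ge0 ltW.
  have z1 i : `|(x - y) 0 i| <= 1.
    rewrite (le_trans (coord_le_enorm _ _))// (le_trans (ltW x2))//.
    by rewrite invf_le1// ler1n.
  have Q := cutoff_error_le eps0 st0 (energy_ge0 x) (ltW M0)
    (fun i j => M2 i j (x - y)) (fun i => M1 i (x - y)) z1 H.
  have hk0 : 0 <= heat_kernel y s x t by rewrite ltW// heat_kernel_gt0.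
  apply: (le_trans (ler_wpM2l hk0 Q)).
  have -> : E x = A * e x by rewrite /E patchE ifT// inE.
  have x16 : 16^-1 <= dot (x - y) (x - y).
    have -> : 16^-1 = (4^-1) ^+ 2 :> R by rewrite exprVn -natrX.
    by rewrite -sqr_enorm ler_pXn2r ?nnegrE ?enorm_ge0// invr_ge0.
  have B0 : 0 <= 11 * d%:R * M * e x by rewrite !mulr_ge0 ?energy_ge0// ltW.
  have := ler_wpM2l B0 (far x x16); rewrite /A.
  move: (heat_kernel _ _ _ _) (expR _) (e x) (d%:R : R) (1 + _) => a1 a2 a3 a4 a5 F.
  have -> : a1 * (11 * a4 * M * (a5 * a3)) = 11 * a4 * M * a3 * (a5 * a1) by ring.
  by rewrite (le_trans F)// le_eqVlt; apply/orP; left; apply/eqP; ring.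
exists D => //.
apply: (le_trans DE); rewrite lerD2l le_eqVlt; apply/orP; left; apply/eqP.
rewrite /E (intRdZ _ gE0) -/A mulrCA; congr (_ * _).
rewrite /mu /mu_int [RHS]intRd_mkcond -(intRdZ _ gE0); congr intRd.
apply/funext => x; rewrite !patchE; case: ifP => _; last by rewrite mulr0.
by rewrite mul1r energy_densityE'.
Qed.

End energy_measure.

Unset Implicit Arguments.
Theorem lemma4p9 (R : realType) (d : nat) (hd : (2 <= d)%N)
    (eta : 'rV[R]_d -> R) (heta : cutoff eta) :
  exists2 C : R, 0 < C &
  forall (W : R -> R) (q : R -> R -> R) (T eps gamma : R)
    (u : 'rV[R]_d -> R -> 'rV[R]_d) (g phi : 'rV[R]_d -> R -> R)
    (phi0 : 'rV[R]_d -> R),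
  let L := Lconst T u g in
  let r := dist_fun (q eps) phi in
  let f := forcing u g L r in
  let sigma := surface_tension W in
  (forall e, 0 < e -> standing_wave W e (q e)) ->
  admissible_potential W (q 1) ->
  0 < T -> 0 < eps < 1 -> 0 < gamma < 2^-1 ->
  periodic_on `[0, T] u -> (forall i, smooth_on `[0, T] (fun x t => u x t 0 i)) ->
  periodic_on `[0, T] g -> smooth_on `[0, T] g ->
  L <= eps `^ (- gamma) ->
  classical_solution W eps T u g L r phi phi0 ->
  (forall x, `|phi0 x| < 1) ->
  (forall x, differentiable (r^~ 0) x /\ enorm (grad (r^~ 0) x) <= 1) ->
  forall (y : 'rV[R]_d) (t s : R), 0 <= t -> t < s -> s < T ->
  (t = 0 -> C21_on `[0, T[ phi) ->
  (exists2 D : R,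
     has_deriv_in `[0, s[
       (fun t' => mu_int W eps phi t' setT (fun x => heat_kernel y s x t')) t D &
     D <= (2 * sigma)^-1 *
          intRd setT (fun x => heat_kernel y s x t * `|f x t| ^+ 2 *
                               (W (phi x t) / eps))
       <= 2^-1 *
          mu_int W eps phi t setT (fun x => heat_kernel y s x t * `|f x t| ^+ 2)) /\
  (exists2 D : R,
     has_deriv_in `[0, s[
       (fun t' => mu_int W eps phi t' setT (fun x => cut_heat_kernel eta y s x t'))
       t D &
     D <= (2 * sigma)^-1 *
          intRd setT (fun x => cut_heat_kernel eta y s x t * `|f x t| ^+ 2 *
                               (W (phi x t) / eps))
          + C * expR (- (128 * (s - t))^-1) * mu W eps phi t (eball y 2^-1)).
Proof.
have d0 : (0 < d)%N by exact: leq_trans hd.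
have [M M0 [M1 M2]] := cutoff_derivatives_bounded heta.
have [Cfar Cf0 far] := @heat_kernel_far R d d0.
exists (11 * d%:R * M * Cfar); first by rewrite !mulr_gt0// ltr0n.
move=> W q T eps gamma u g phi phi0 L r f sigma qW [[sW W0] _ _ _ _] T0 /andP[eps0 _] _
  peru su perg sg _ sol _ init y t s t0 ts sT reg0.
have dW (z : R) : is_derive z (1 : R) W (derive1 W z).
  by rewrite derive1E; apply: derivableP; exact: (sW 0%N).
have cW' : continuous (derive1 W).
  move=> z; apply: differentiable_continuous; apply/derivable1_diffP; exact: (sW 1%N).
have swe := qW _ eps0.
split; first exact: (monotonicity d0 T0 eps0 swe dW cW' W0 peru su perg sg sol init y t0 ts sT reg0).
apply: (cut_monotonicity d0 T0 eps0 swe dW cW' W0 peru su perg sg sol init t0 ts sT reg0) => //.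
by move=> x; exact: far.
Qed.
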